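(* Under the standing assumptions below, for each $1\le i\le r$ and each $1\le j\le \ell$, as $n\to\infty$: $$\lambda_{\lceil nc_{j-1}\rceil+i}(\widetilde X_n)\xrightarrow{a.s.}\begin{cases} G^{-1}_{\mu_X,(b_j,a_{j-1})}(1/\theta_i) & \text{if } G_{\mu_X}(a_{j-1}^-)<1/\theta_i<G_{\mu_X}(b_j^+),\\ b_j & \text{if } 1/\theta_i\ge G_{\mu_X}(b_j^+),\\ a_{j-1} & \text{if } 1/\theta_i\le G_{\mu_X}(a_{j-1}^-).\end{cases}$$
   Context: Standing assumptions (Hermitian setting). For each $n$, $X_n$ is an $n\times n$ real symmetric (resp. complex Hermitian) random matrix whose distribution is invariant under conjugation by orthogonal (resp. unitary) matrices, with ordered eigenvalues $\lambda_1(X_n)\ge\cdots\ge\lambda_n(X_n)$. The empirical eigenvalue distribution $\mu_{X_n}=\frac1n\sum_{i=1}^n\delta_{\lambda_i(X_n)}$ converges almost surely weakly to a non-random compactly supported probability measure $\mu_X=\sum_{j=1}^{\ell}p_j\mu_j$, where $p_j>0$, $\sum_j p_j=1$, each $\mu_j$ is a non-random probability measure supported on $[a_j,b_j]$ with $d\mu_j(z)>0$ for $z\in(a_j,b_j)$, and $a_\ell<b_\ell<a_{\ell-1}<b_{\ell-1}<\cdots<a_1<b_1$. Set $c_0=0$, $c_k=\sum_{i=1}^k p_i$ (so $c_\ell=1$). It is assumed that for $j=1,\dots,\ell$, $\lambda_{\lceil nc_{j-1}\rceil+1}(X_n)\to b_j$ and $\lambda_{\lceil nc_j\rceil}(X_n)\to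 a_j$ almost surely. Fix $r\ge1$ and deterministic reals $\theta_1\ge\cdots\ge\theta_r>0$ independent of $n$; $P_n$ is a deterministic $n\times n$ symmetric (resp. Hermitian) matrix of rank $r$ whose nonzero eigenvalues are $\theta_1,\dots,\theta_r$; $X_n$ and $P_n$ are independent; $\widetilde X_n=X_n+P_n$ with ordered eigenvalues $\lambda_1(\widetilde X_n)\ge\cdots\ge\lambda_n(\widetilde X_n)$. $G_{\mu_X}(z)=\int\frac{1}{z-t}d\mu_X(t)$ for $z\notin\mathrm{supp}\,\mu_X$ is the Cauchy transform; $f(c^+)=\lim_{z\downarrow c}f(z)$, $f(c^-)=\lim_{z\uparrow c}f(z)$; $a_0:=+\infty$ (so $G_{\mu_X}(a_0^-)=0$). $G^{-1}_{\mu_X,(b_j,a_{j-1})}$ denotes the inverse of the (strictly decreasing) restriction of $G_{\mu_X}$ to the interval $(b_j,a_{j-1})$. *)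

(* Defs.v *)
From HB Require Import structures.
From mathcomp Require Import all_boot all_order all_algebra.
From mathcomp Require Import all_classical all_reals all_analysis.
From mathcomp.real_closed Require Import complex.
Set Implicit Arguments. Unset Strict Implicit. Unset Printing Implicit Defensive.
Import Order.TTheory GRing.Theory Num.Theory.
Import numFieldNormedType.Exports.
Local Open Scope classical_set_scope.
Local Open Scope ring_scope.

Section Defs.
Variable R : realType.
Local Notation C := R[i].

Definition ctr (n : nat) (M : 'M[C]_n) : 'M[C]_n := (map_mx Num.conj M)^T.

Definition hermitian (n : nat) (M : 'M[C]_n) : Prop := ctr M = M.

Definition real_mx (n : nat) (M : 'M[C]_n) : Prop := forall i j, complex.Im (M i j) = 0.

Definition setting_mx (cplx : bool) (n : nat) (M : 'M[C]_n) : Prop :=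
  hermitian M /\ (~~ cplx -> real_mx M).

Definition setting_group (cplx : bool) (n : nat) (U : 'M[C]_n) : Prop :=
  U *m ctr U = 1%:M /\ (~~ cplx -> real_mx U).

Definition eigseq (n : nat) (M : 'M[C]_n) : seq R :=
  sort (fun x y : R => y <= x)
    (map (fun z : C => complex.Re z)
       (xget [::] [set s : seq C | char_poly M = \prod_(z <- s) ('X - z%:P)])).

(* lambda_k(M), 1-indexed *)
Definition eig (n : nat) (k : nat) (M : 'M[C]_n) : R := nth 0 (eigseq M) k.-1.

Definition mx_borel (n : nat) : set (set 'M[C]_n) :=
  <<s [set B | exists (i j : 'I_n) (A : set R), measurable A /\
         (B = [set M : 'M[C]_n | A (complex.Re (M i j))] \/ B = [set M : 'M[C]_n | A (complex.Im (M i j))])] >>.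

Definition cauchy_tr (mu : {measure set R -> \bar R}) (z : R) : R :=
  fine (\int[mu]_t ((z - t)^-1)%:E).

Definition right_lim (f : R -> R) (c : R) : \bar R := lim ((fun z => (f z)%:E) @ c^'+).
Definition left_lim (f : R -> R) (c : R) : \bar R := lim ((fun z => (f z)%:E) @ c^'-).
Definition lim_pinfty (f : R -> R) : \bar R := lim ((fun z => (f z)%:E) @ +oo).

Definition inv_on (f : R -> R) (lo hi : \bar R) (y : R) : R :=
  xget 0 [set x | (lo < x%:E < hi)%E /\ f x = y].

End Defs.

(* Main.v *)
(* For [z] off the spectrum of [X], write [P = U^* Theta U] with [U] of size [r x n].
   The two Schur complements of the Hermitian block matrix
   [[z - X, U^*], [U, Theta^-1]] and Sylvester's law of inertia show that the
   number of eigenvalues of [X + P] above [z] exceeds that of [X] by the number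
   of negative eigenvalues of the [r x r] matrix [Theta^-1 - U (z - X)^-1 U^*].

   When [z] lies in a gap of the support of [mu_X], this small matrix converges
   almost surely to [Theta^-1 - G(z)].  Indeed, conjugation invariance allows one to
   replace a fixed vector [u] by [D_eps h u], where [h] is a Householder reflection
   spreading [u] evenly over the coordinates and [D_eps] is any diagonal matrix of
   signs.  Averaging over the signs turns the centred quadratic form of the
   resolvent into a Rademacher chaos of order two, whose fourth moment is
   [O(n^-2)]; Borel-Cantelli applies without any Haar measure.

   Hence the eigenvalue of index [ceil(n c_(j-1)) + i] is eventually above (below)
   [z] when [G(z) > 1/theta_i] ([G(z) < 1/theta_i]), and the limits follow from
   the monotonicity of [G] on the gap and, at the edges, from Weyl's inequalities. *)

Require Import Defs.
From HB Require Import structures.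
From mathcomp Require Import all_boot all_order all_fingroup all_algebra.
From mathcomp Require Import zify ring lra.
From mathcomp Require Import all_classical all_reals all_analysis measurable_realfun.
From mathcomp.real_closed Require Import complex.
Import Order.TTheory GRing.Theory Num.Theory.
Import numFieldNormedType.Exports.
Set Implicit Arguments. Unset Strict Implicit. Unset Printing Implicit Defensive.
Local Open Scope ring_scope.
Local Open Scope sesquilinear_scope.

(** * Inertia and Schur complements *)

(** Invariance of the law concerns one deterministic conjugation at a time: it says that each of the
    2^n deviation events attached to the rotated vectors [u *m g e] has the probability of the event
    attached to [u]. For a frozen matrix the sign vectors for which the event occurs are counted,
    and the count is integrated. The event must therefore make sense for every matrix, so it carries
    its own truncation: [z - X] is invertible and its inverse has bounded normalised Hilbert-Schmidt
    norm. Separation of the spectrum from [z], which holds only eventually and almost surely, enters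
    after Borel-Cantelli. The second moment of the chaos would give O(1/n), which is not summable;
    this is why the fourth is used. Almost sure statements are obtained for one [z] at a time, so
    limits are reached through countably many points. In the real setting the reflections are
    orthogonal and move only real vectors, while polarisation and the complex diagonalisation of P
    produce complex ones; these are split into real and imaginary parts. *)

Section Inertia.
Variable C : numClosedFieldType.

Lemma trmxC_mul m n p (A : 'M[C]_(m, n)) (B : 'M[C]_(n, p)) :
  (A *m B)^t* = B^t* *m A^t*.
Proof. by rewrite trmx_mul map_mxM. Qed.

Lemma trmxCD m n (A B : 'M[C]_(m, n)) : (A + B)^t* = A^t* + B^t*.
Proof. by rewrite linearD /= map_mxD. Qed.

Lemma trmxCN m n (A : 'M[C]_(m, n)) : (- A)^t* = - A^t*.
Proof. by rewrite linearN /= map_mxN. Qed.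

Lemma trmxCZ m n a (A : 'M[C]_(m, n)) : (a *: A)^t* = a^* *: A^t*.
Proof. by rewrite linearZ /= map_mxZ. Qed.

Lemma trmxC1 n : (1%:M : 'M[C]_n)^t* = 1%:M.
Proof. by rewrite trmx1 map_mx1. Qed.

Definition qform n (H : 'M[C]_n) (x : 'rV[C]_n) : C := (x *m H *m x^t*) 0 0.

Lemma qform_mul m n (H : 'M[C]_n) (S : 'M[C]_(m, n)) x :
  qform H (x *m S) = qform (S *m H *m S^t*) x.
Proof. by rewrite /qform trmxC_mul !mulmxA. Qed.

Lemma qformD n (H K : 'M[C]_n) x : qform (H + K) x = qform H x + qform K x.
Proof. by rewrite /qform mulmxDr mulmxDl mxE. Qed.

Lemma qformN n (H : 'M[C]_n) x : qform (- H) x = - qform H x.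
Proof. by rewrite /qform mulmxN mulNmx mxE. Qed.

Lemma qformZ n a (H : 'M[C]_n) x : qform (a *: H) x = a * qform H x.
Proof. by rewrite /qform -scalemxAr -scalemxAl mxE. Qed.

Lemma qform_block m n (A : 'M[C]_m) (D : 'M[C]_n) x y :
  qform (block_mx A 0 0 D) (row_mx x y) = qform A x + qform D y.
Proof.
rewrite /qform mul_row_block !mulmx0 addr0 add0r tr_row_mx map_col_mx.
by rewrite mul_row_col mxE.
Qed.

Lemma qformE n (H : 'M[C]_n) x :
  qform H x = \sum_i \sum_j x 0 i * (x 0 j)^* * H i j.
Proof.
rewrite /qform mxE exchange_big; apply: eq_bigr => j _.
rewrite !mxE mulr_suml; apply: eq_bigr => i _.
by rewrite -!mulrA [(x 0 j)^* * _]mulrC.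
Qed.

Lemma qform_diag n (d : 'rV[C]_n) x :
  qform (diag_mx d) x = \sum_i d 0 i * `|x 0 i| ^+ 2.
Proof.
rewrite qformE; apply: eq_bigr => i _; rewrite (bigD1 i) //= big1 ?addr0.
  by rewrite mxE eqxx mulr1n normCK mulrC.
by move=> j ji; rewrite mxE eq_sym (negbTE ji) mulr0.
Qed.

(** Strict negativity at every nonzero [y] forces the rows of [E] to be independent, so [E] spans a
    subspace of dimension [k]. *)
Definition negdim n (H : 'M[C]_n) k :=
  exists E : 'M[C]_(k, n), forall y, y != 0 -> qform H (y *m E) < 0.

Definition nonnegdim n (H : 'M[C]_n) k :=
  exists2 F : 'M[C]_(k, n), row_free F & forall y, 0 <= qform H (y *m F).

(** Says that exactly [k] eigenvalues are negative, zero eigenvalues being counted on the other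
    side. Two subspaces of complementary dimensions certify it, so that uniqueness is a dimension
    count and congruences act on the certificates directly. *)
Definition neg_index n (H : 'M[C]_n) k :=
  [/\ (k <= n)%N, negdim H k & nonnegdim H (n - k)].

(** If the dimensions added up to more than [n], the two subspaces would share a nonzero vector, on
    which the form is both negative and nonnegative. *)
Lemma negdim_nonnegdim n (H : 'M[C]_n) e f :
  negdim H e -> nonnegdim H f -> (e + f <= n)%N.
Proof.
move=> [E negE] [F freeF nonnegF]; rewrite leqNgt; apply/negP => nef.
have freeE : row_free E.
  rewrite -kermx_eq0; apply/rowV0P => y /sub_kermxP yE.
  apply/eqP/negPn/negP => /negE; rewrite yE /qform !mul0mx mxE ltxx //.
have [x] : exists2 x : 'rV[C]_n, x != 0 & (x <= E :&: F)%MS.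
  have : (E :&: F)%MS != 0.
    rewrite -mxrank_eq0 -lt0n -(ltn_add2l (\rank (E + F)%MS)) addn0.
    rewrite mxrank_sum_cap (eqP freeE) (eqP freeF).
    by apply: leq_ltn_trans nef; exact: rank_leq_col.
  by move=> /rowV0Pn[v vEF v0]; exists v.
rewrite sub_capmx => x0 /andP[/submxP[y xy] /submxP[z xz]].
have y0 : y != 0 by apply: contraNneq x0 => y0; rewrite xy y0 mul0mx.
by have := lt_le_trans (negE y y0) (nonnegF z); rewrite -xy -xz ltxx.
Qed.

Lemma neg_index_uniq n (H : 'M[C]_n) k l :
  neg_index H k -> neg_index H l -> k = l.
Proof.
move=> [kn nk pk] [ln nl pl]; apply/eqP; rewrite eqn_leq.
by have := negdim_nonnegdim nk pl; have := negdim_nonnegdim nl pk; lia.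
Qed.

(** Sylvester's law of inertia: right multiplication by [invmx S] carries both certifying subspaces
    of [H] to those of the congruent matrix. *)
Lemma neg_index_congr n (H S : 'M[C]_n) k : S \in unitmx ->
  neg_index H k -> neg_index (S *m H *m S^t*) k.
Proof.
move=> uS [kn [E nE] [F fF pF]]; split=> //.
  exists (E *m invmx S) => y y0.
  by rewrite -qform_mul mulmxA mulmxKV // nE.
exists (F *m invmx S); last by move=> y; rewrite -qform_mul mulmxA mulmxKV.
by rewrite /row_free mxrankMfree // row_free_unit unitmx_inv.
Qed.

Lemma row_free_block_diag m1 n1 m2 n2 (A : 'M[C]_(m1, n1)) (D : 'M[C]_(m2, n2)) :
  row_free A -> row_free D -> row_free (block_mx A 0 0 D).
Proof.
move=> /row_freeP[A' AA'] /row_freeP[D' DD']; apply/row_freeP.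
exists (block_mx A' 0 0 D').
by rewrite mulmx_block !mulmx0 !mul0mx !addr0 !add0r AA' DD' -scalar_mx_block.
Qed.

Lemma neg_index_block m n (A : 'M[C]_m) (D : 'M[C]_n) k l :
  neg_index A k -> neg_index D l -> neg_index (block_mx A 0 0 D) (k + l).
Proof.
move=> [km [E nE] [F fF pF]] [ln [E' nE'] [F' fF' pF']].
split; first by rewrite leq_add.
  exists (block_mx E 0 0 E') => y; rewrite -[y]hsubmxK mul_row_block.
  rewrite !mulmx0 addr0 add0r qform_block row_mx_eq0 negb_and.
  (* One half of a nonzero [y] may vanish; that half contributes only a weak inequality, and the
     other half the strict one. *)
  have n0 p q (B : 'M[C]_p) (G : 'M[C]_(q, p)) z :
      (forall y, y != 0 -> qform B (y *m G) < 0) -> qform B (z *m G) <= 0.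
    move=> nG; have [->|z0] := eqVneq z 0; last exact/ltW/nG.
    by rewrite /qform !mul0mx mxE.
  case/orP => y0; first by rewrite ltr_wnDr ?nE // n0.
  by rewrite ltr_wnDl ?nE' // n0.
have -> : (m + n - (k + l) = (m - k) + (n - l))%N by lia.
exists (block_mx F 0 0 F'); first exact: row_free_block_diag.
move=> y; rewrite -[y]hsubmxK mul_row_block !mulmx0 addr0 add0r qform_block.
by rewrite addr_ge0.
Qed.

Lemma qform_diag_rowsub n (d : 'rV[C]_n) (A : {set 'I_n}) (y : 'rV[C]_#|A|) :
  qform (diag_mx d) (y *m rowsub enum_val 1%:M) =
  \sum_(k < #|A|) d 0 (enum_val k) * `|y 0 k| ^+ 2.
Proof.
rewrite qform_mul qformE; apply: eq_bigr => k _.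
have rE i j : (rowsub (enum_val (A := A)) 1%:M *m diag_mx d *m
    (rowsub (enum_val (A := A)) 1%:M)^t*) i j = d 0 (enum_val i) *+ (i == j).
  rewrite mul_mx_diag mxE (bigD1 (enum_val i)) //= big1 ?addr0.
    rewrite !mxE eqxx mul1r; case: (eqVneq i j) => [->|ij].
      by rewrite eqxx conjC1 mulr1.
    by rewrite (inj_eq enum_val_inj) eq_sym (negbTE ij) conjC0 mulr0.
  by move=> l li; rewrite !mxE eq_sym (negbTE li) !mul0r.
rewrite (bigD1 k) //= big1 ?addr0; first by rewrite rE eqxx mulr1n normCK mulrC.
by move=> j jk; rewrite rE eq_sym (negbTE jk) mulr0.
Qed.

Lemma neg_index_diag n (d : 'rV[C]_n) : d \is a realmx ->
  neg_index (diag_mx d) #|[set i | d 0 i < 0]|.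
Proof.
move=> /mxOverP dR; set A := [set i | _].
split; first by have := max_card (mem A); rewrite card_ord.
  exists (rowsub enum_val 1%:M) => y y0; rewrite qform_diag_rowsub.
  have dA k : d 0 (enum_val (A := A) k) < 0.
    by have := enum_valP k; rewrite inE.
  have /rV0Pn[k yk] := y0; rewrite (bigD1 k) //=; apply: ltr_wnDr.
    by rewrite -oppr_ge0 -sumrN sumr_ge0 // => i _; rewrite -mulNr mulr_ge0 ?exprn_ge0 ?oppr_ge0 ?(ltW (dA _)).
  by rewrite nmulr_rlt0 ?exprn_gt0 ?normr_gt0.
have -> : (n - #|A| = #|~: A|)%N by have := cardsC A; rewrite card_ord; lia.
exists (rowsub enum_val 1%:M).
  apply/row_freeP; exists ((rowsub enum_val 1%:M)^T).
  apply/matrixP => i j; rewrite !mxE (bigD1 (enum_val i)) //= big1 ?addr0.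
    by rewrite !mxE eqxx mul1r (inj_eq enum_val_inj) eq_sym.
  by move=> l li; rewrite !mxE eq_sym (negbTE li) mul0r.
move=> y; rewrite qform_diag_rowsub; apply: sumr_ge0 => k _.
rewrite mulr_ge0 ?exprn_ge0 //.
have := enum_valP k; rewrite !inE => dk.
(* The order of [C] is partial: that an entry is not negative gives nonnegativity only because the
   entry is real. *)
by rewrite real_leNgt // dR.
Qed.

(** The spectral theorem makes [H] congruent to a real diagonal matrix, where coordinate subspaces
    serve as certificates. *)
Lemma neg_index_exists n (H : 'M[C]_n) : H^t* = H -> exists k, neg_index H k.
Proof.
move=> HH; have Hh : H \is hermsymmx.
  by apply/is_hermitianmxP; rewrite expr0 scale1r HH.
have /orthomx_spectralP -> := hermitian_normalmx Hh.
rewrite invmx_unitary ?spectral_unitarymx //.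
set V := spectralmx H; rewrite -{2}[V]trmxCK.
eexists; apply: neg_index_congr; last first.
  exact/neg_index_diag/hermitian_spectral_diag_real.
by apply: unitarymx_unit; rewrite trmxC_unitary spectral_unitarymx.
Qed.

Lemma unitmx_lower m n (S : 'M[C]_(n, m)) : block_mx 1%:M 0 S 1%:M \in unitmx.
Proof. by rewrite unitmxE det_lblock !det1 mulr1 unitr1. Qed.

Lemma unitmx_upper m n (S : 'M[C]_(m, n)) : block_mx 1%:M S 0 1%:M \in unitmx.
Proof. by rewrite unitmxE det_ublock !det1 mulr1 unitr1. Qed.

Lemma trmxC_block m n p q (A : 'M[C]_(m, n)) (B : 'M[C]_(m, p))
    (D : 'M[C]_(q, n)) (E : 'M[C]_(q, p)) :
  (block_mx A B D E)^t* = block_mx (A^t*) (D^t*) (B^t*) (E^t*).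
Proof. by rewrite tr_block_mx map_block_mx. Qed.

(* Both Schur complements of the same Hermitian block matrix [[A, U*], [U, T]]. *)
Lemma neg_index_schur m n (A : 'M[C]_m) (T : 'M[C]_n) (U : 'M[C]_(n, m)) j k l :
  A \in unitmx -> T \in unitmx -> A^t* = A -> T^t* = T ->
  neg_index T 0 -> neg_index A k -> neg_index (T - U *m invmx A *m U^t*) l ->
  neg_index (A - U^t* *m invmx T *m U) j -> j = (k + l)%N.
Proof.
move=> uA uT AH TH nT nA nD nM.
have invH p (B : 'M[C]_p) : B \in unitmx -> B^t* = B -> (invmx B)^t* = invmx B.
  by move=> uB BH; rewrite trmx_inv map_invmx BH.
have iA := invH _ _ uA AH; have iT := invH _ _ uT TH.
have E1 := neg_index_congr (unitmx_lower (U *m invmx A)) (neg_index_block nA nD).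
have E2 := neg_index_congr (unitmx_upper (U^t* *m invmx T)) (neg_index_block nM nT).
rewrite addn0 in E2; apply: neg_index_uniq E2 _.
suff -> : block_mx 1%:M (U^t* *m invmx T) 0 1%:M *m
   block_mx (A - U^t* *m invmx T *m U) 0 0 T *m
   (block_mx 1%:M (U^t* *m invmx T) 0 1%:M)^t* = 
   block_mx 1%:M 0 (U *m invmx A) 1%:M *m
   block_mx A 0 0 (T - U *m invmx A *m U^t*) *m
   (block_mx 1%:M 0 (U *m invmx A) 1%:M)^t* by [].
rewrite !trmxC_block !trmxC_mul iA iT trmxCK !trmxC1 !trmx0 !map_mx0.
rewrite !mulmx_block !mulmx0 !mul0mx !mulmx1 !mul1mx !addr0 !add0r.
rewrite (mulmxKV uT (U^t*)) (mulmxKV uA U) (mulKVmx uT U) (mulKVmx uA (U^t*)).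
by rewrite !mulmxA subrK addrC subrK.
Qed.

End Inertia.

(** * Rademacher chaos of order two *)

(** Cauchy-Schwarz without square roots: in X Y <= (b/a X^2 + a/b Y^2) / 2 the weights are tuned so
    that both sums contribute equally. In the degenerate cases [a = 0] and [b = 0] one of the
    families vanishes. *)
Lemma sum_cauchy (R : realFieldType) (I : finType) (X Y : I -> R) c a b :
  0 <= c -> 0 <= a -> 0 <= b ->
  \sum_i X i ^+ 2 <= c * a ^+ 2 -> \sum_i Y i ^+ 2 <= c * b ^+ 2 ->
  \sum_i X i * Y i <= c * (a * b).
Proof.
have sq0 (Z : I -> R) : \sum_i Z i ^+ 2 <= 0 -> forall i, Z i = 0.
  move=> Z0 i; apply/eqP; rewrite -sqrf_eq0; apply/eqP.
  apply: (@psumr_eq0P _ _ xpredT (fun i => Z i ^+ 2)) => //.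
    by move=> j _; exact: sqr_ge0.
  by apply/eqP; rewrite eq_le Z0 sumr_ge0 // => j _; exact: sqr_ge0.
move=> c0; rewrite [0 <= a]le_eqVlt => /predU1P[<- _|a0].
  rewrite expr0n mulr0 => /sq0 X0 _; rewrite mul0r mulr0 big1 // => i _.
  by rewrite X0 mul0r.
rewrite [0 <= b]le_eqVlt => /predU1P[<- _|b0].
  rewrite expr0n /= mulr0 => /sq0 Y0; rewrite !mulr0 big1 // => i _.
  by rewrite Y0 mulr0.
move=> Xa Yb.
apply: (@le_trans _ _ (\sum_i (b / a * X i ^+ 2 + a / b * Y i ^+ 2) / 2)).
  apply: ler_sum => i _; rewrite -subr_ge0.
  have -> : (b / a * X i ^+ 2 + a / b * Y i ^+ 2) / 2 - X i * Y i =
    (b * X i - a * Y i) ^+ 2 / (2 * a * b) by field; rewrite !gt_eqF.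
  by rewrite divr_ge0 ?sqr_ge0 // !mulr_ge0 // ltW.
rewrite -mulr_suml big_split /= -!mulr_sumr.
have -> : c * (a * b) = (b / a * (c * a ^+ 2) + a / b * (c * b ^+ 2)) / 2.
  by field; rewrite !gt_eqF.
by apply: ler_wpM2r; rewrite ?invr_ge0 // lerD // ler_wpM2l // divr_ge0 // ltW.
Qed.

Section Rademacher.
Variables (R : realFieldType) (n : nat).
Local Notation signs := {ffun 'I_n -> bool}.
Local Notation N := (#|{: signs}|%:R : R).

Definition sgn (e : signs) j : R := (-1) ^+ e j.

Definition flip (k : 'I_n) (e : signs) : signs :=
  [ffun j => if j == k then ~~ e j else e j].

Lemma flipK k : involutive (flip k).
Proof.
by move=> e; apply/ffunP => j; rewrite !ffunE; case: eqP => // _; rewrite negbK.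
Qed.

Lemma sgn_flip k e : sgn (flip k e) k = - sgn e k.
Proof. by rewrite /sgn ffunE eqxx signrN. Qed.

Lemma sgn_flip_neq k j e : j != k -> sgn (flip k e) j = sgn e j.
Proof. by move=> jk; rewrite /sgn ffunE (negbTE jk). Qed.

Lemma sgn_sqr e k : sgn e k ^+ 2 = 1.
Proof. by rewrite /sgn sqrr_sign. Qed.

Definition indep k (f : signs -> R) := forall e, f (flip k e) = f e.

(** Flipping the sign at [k] permutes the sign vectors and negates each summand, so the sum equals
    its own opposite. *)
Lemma sum_sgn_indep k f : indep k f -> \sum_e sgn e k * f e = 0.
Proof.
move=> fi; set s := \sum_e _; suff : s = - s by move=> h; lra.
rewrite {1}/s (reindex_inj (inv_inj (flipK k))) -sumrN /=.
by apply: eq_bigr => e _; rewrite sgn_flip fi mulNr.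
Qed.

Lemma sum_sgn_sqr k g h : indep k g -> indep k h ->
  \sum_e (sgn e k * h e + g e) ^+ 2 = \sum_e g e ^+ 2 + \sum_e h e ^+ 2.
Proof.
move=> gi hi.
have fi : indep k (fun e => 2 * (g e * h e)) by move=> e; rewrite gi hi.
rewrite -[RHS]addr0 -[X in _ + X](sum_sgn_indep fi) -!big_split; apply: eq_bigr => e _ /=.
have := sgn_sqr e k; set s := sgn e k => s2.
have -> : h e ^+ 2 = s ^+ 2 * h e ^+ 2 by rewrite s2 mul1r.
by ring.
Qed.

(** Odd powers of the sign at [k] sum to zero and even ones are 1, so of the binomial coefficients
    1, 4, 6, 4, 1 only 1, 6, 1 survive. *)
Lemma sum_sgn_quart k g h : indep k g -> indep k h ->
  \sum_e (sgn e k * h e + g e) ^+ 4 =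
  \sum_e g e ^+ 4 + 6 * \sum_e (g e ^+ 2 * h e ^+ 2) + \sum_e h e ^+ 4.
Proof.
move=> gi hi.
have fi : indep k (fun e => 4 * (g e ^+ 3 * h e + g e * h e ^+ 3)).
  by move=> e; rewrite gi hi.
rewrite -[RHS]addr0 -[X in _ + X](sum_sgn_indep fi) mulr_sumr -!big_split.
apply: eq_bigr => e _ /=.
have := sgn_sqr e k; set s := sgn e k => s2.
have -> : (s * h e + g e) ^+ 4 = (s ^+ 2) ^+ 2 * h e ^+ 4 + 4 * (s ^+ 2 * s) * (h e ^+ 3 * g e)
   + 6 * (s ^+ 2) * (h e ^+ 2 * g e ^+ 2) + 4 * s * h e * g e ^+ 3 + g e ^+ 4 by ring.
by rewrite s2; ring.
Qed.

Lemma sum_ltS (V : nmodType) (k : 'I_n) (F : 'I_n -> V) :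
  \sum_(j < n | (j < k.+1)%N) F j = F k + \sum_(j < n | (j < k)%N) F j.
Proof.
rewrite (bigD1 k) //=; congr (_ + _); apply: eq_bigl => j.
by rewrite ltnS [in RHS]ltn_neqAle andbC.
Qed.

(** Truncated at [k] so that the next sign is always independent of the partial sum before it: the
    moment bounds go by induction on [k]. *)
Definition lin (a : 'I_n -> R) k e := \sum_(j < n | (j < k)%N) sgn e j * a j.

Lemma lin_indep a (k : 'I_n) m : (m <= k)%N -> indep k (lin a m).
Proof.
move=> mk e; apply: eq_bigr => j jm; rewrite sgn_flip_neq //.
by apply: contraTneq jm => ->; rewrite -leqNgt.
Qed.

Definition sqs (a : 'I_n -> R) k := \sum_(j < n | (j < k)%N) a j ^+ 2.

Lemma sum_lin_sqr a k : (k <= n)%N -> \sum_e lin a k e ^+ 2 = N * sqs a k.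
Proof.
elim: k => [|k IH] kn.
  rewrite (_ : sqs a 0 = 0) ?mulr0; last by rewrite /sqs big_pred0.
  apply: big1 => e _.
  by rewrite /lin big_pred0 // expr0n.
pose k' := Ordinal kn.
have linS e : lin a k.+1 e = sgn e k' * a k' + lin a k e by exact: (sum_ltS k').
under eq_bigr do rewrite linS.
rewrite (sum_sgn_sqr (h := fun=> a k') (@lin_indep a k' k (leqnn k))) //.
rewrite IH 1?ltnW // sumr_const -[a k' ^+ 2 *+ _]mulr_natl -mulrDr /sqs (sum_ltS k').
by rewrite addrC.
Qed.

Lemma sqs_ge0 a k : 0 <= sqs a k.
Proof. by apply: sumr_ge0 => j _; exact: sqr_ge0. Qed.

(** Khintchine's inequality for the fourth moment. The Gaussian constant 3 reproduces itself in the
    induction, since 3 (s + a^2)^2 exceeds 3 s^2 + 6 s a^2 + a^4 by 2 a^4. *)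
Lemma sum_lin_quart a k : (k <= n)%N ->
  \sum_e lin a k e ^+ 4 <= N * (3 * sqs a k ^+ 2).
Proof.
elim: k => [|k IH] kn.
  rewrite big1 ?mulr_ge0 ?sqr_ge0 ?exprn_ge0 ?sqs_ge0 ?sumr_ge0 // => e _.
  by rewrite /lin big_pred0 // expr0n.
pose k' := Ordinal kn.
have linS e : lin a k.+1 e = sgn e k' * a k' + lin a k e by exact: (sum_ltS k').
under eq_bigr do rewrite linS.
rewrite (sum_sgn_quart (h := fun=> a k') (@lin_indep a k' k (leqnn k))) //.
rewrite -mulr_suml sum_lin_sqr 1?ltnW // sumr_const -[a k' ^+ 4 *+ _]mulr_natl.
rewrite [X in _ <= _ * (_ * X ^+ 2)](sum_ltS k') -/(sqs a k).
apply: (@le_trans _ _ (N * (3 * sqs a k ^+ 2) + 6 * (N * sqs a k * a k' ^+ 2) + N * a k' ^+ 4)).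
  by rewrite !lerD2r IH // ltnW.
rewrite -subr_ge0.
have -> : N * (3 * (a k' ^+ 2 + sqs a k) ^+ 2) -
  (N * (3 * sqs a k ^+ 2) + 6 * (N * sqs a k * a k' ^+ 2) + N * a k' ^+ 4) =
  N * (2 * (a k' ^+ 2) ^+ 2) by ring.
by rewrite mulr_ge0 // mulr_ge0 // sqr_ge0.
Qed.

(** The chaos arranged as a martingale: each sign multiplies a linear form in the earlier signs.
    Only the strict lower triangle of [S] enters. *)
Definition quad (S : 'I_n -> 'I_n -> R) k e :=
  \sum_(j < n | (j < k)%N) sgn e j * lin (S j) j e.

Definition qsqs S k := \sum_(j < n | (j < k)%N) sqs (S j) j.

Lemma quad_indep S (k : 'I_n) m : (m <= k)%N -> indep k (quad S m).
Proof.
move=> mk e; apply: eq_bigr => j jm; rewrite sgn_flip_neq ?lin_indep //.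
  by rewrite ltnW // (leq_trans jm).
by apply: contraTneq jm => ->; rewrite -leqNgt.
Qed.

Lemma qsqs_ge0 S k : 0 <= qsqs S k.
Proof. by apply: sumr_ge0 => j _; exact: sqs_ge0. Qed.

(** The cross term is controlled by Cauchy-Schwarz between the fourth moments of [quad] and [lin].
    For a constant c in place of 27 the induction asks for 6 sqrt(3 c) <= 2 c, and 27 is the least
    solution. *)
Lemma sum_quad_quart S k : (k <= n)%N ->
  \sum_e quad S k e ^+ 4 <= N * (27 * qsqs S k ^+ 2).
Proof.
elim: k => [|k IH] kn.
  rewrite big1 ?mulr_ge0 ?sqr_ge0 ?exprn_ge0 ?sqs_ge0 ?sumr_ge0 // => e _.
  by rewrite /quad big_pred0 // expr0n.
pose k' := Ordinal kn.
have quadS e : quad S k.+1 e = sgn e k' * lin (S k') k e + quad S k e by exact: (sum_ltS k').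
under eq_bigr do rewrite quadS.
rewrite (sum_sgn_quart (@quad_indep S k' k (leqnn k)) (@lin_indep (S k') k' k (leqnn k))) //.
rewrite [X in _ <= _ * (_ * X ^+ 2)](sum_ltS k') -/(qsqs S k) /=.
have IHk := IH (ltnW kn); have L4 := sum_lin_quart (S k') (ltnW kn).
set F := qsqs S k in IHk *; set s := sqs (S k') k in L4 *.
have F0 : 0 <= F := qsqs_ge0 S k; have s0 : 0 <= s := sqs_ge0 _ _.
have n0 : 0 <= N by rewrite ler0n.
have cross : \sum_e quad S k e ^+ 2 * lin (S k') k e ^+ 2 <= N * (9 * F * s).
  (* The factor 3 gives both families the common constant 27 N, since 9 times 3 is 27. *)
  have := @sum_cauchy R _ (fun e => quad S k e ^+ 2) (fun e => 3 * lin (S k') k e ^+ 2)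
    (27 * N) F s.
  under eq_bigr do rewrite -exprM.
  under [X in _ -> _ -> _ -> _ -> X <= _ -> _]eq_bigr do
    rewrite exprMn -exprM.
  under [X in _ -> _ -> _ -> _ -> _ -> X <= _]eq_bigr do rewrite mulrCA.
  rewrite -!mulr_sumr => /(_ (mulr_ge0 _ n0) F0 s0); lra.
apply: (@le_trans _ _ (N * (27 * F ^+ 2) + 6 * (N * (9 * F * s)) + N * (3 * s ^+ 2))).
  by rewrite !lerD // ler_wpM2l.
rewrite -subr_ge0.
have -> : N * (27 * (s + F) ^+ 2) -
   (N * (27 * F ^+ 2) + 6 * (N * (9 * F * s)) + N * (3 * s ^+ 2)) =
  N * (24 * s ^+ 2) by ring.
by rewrite mulr_ge0 // mulr_ge0 // sqr_ge0.
Qed.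

End Rademacher.

Lemma sum_sym (R : pzRingType) n (f : 'I_n -> 'I_n -> R) :
  (forall i j, f i j = f j i) ->
  \sum_i \sum_j f i j = \sum_i f i i + (\sum_(j < n) \sum_(i < n | (i < j)%N) f j i) *+ 2.
Proof.
move=> fs; have split_row i : \sum_j f i j =
    f i i + (\sum_(j < n | (j < i)%N) f i j + \sum_(j < n | (i < j)%N) f j i).
  rewrite (bigD1 i) //=; congr (_ + _).
  rewrite (bigID (fun j : 'I_n => (j < i)%N)) /=; congr (_ + _).
    by apply: eq_bigl => j; rewrite andbC ltn_neqAle -andbA andbC -andbA andbb andbC.
  rewrite [RHS](eq_bigr (fun j => f i j)) => [|j _]; last exact: fs.
  by apply: eq_bigl => j; rewrite -leqNgt [RHS]ltn_neqAle eq_sym.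
under eq_bigr do rewrite split_row.
rewrite big_split /= big_split /= mulr2n; congr (_ + (_ + _)).
by rewrite (exchange_big_dep xpredT).
Qed.

Section SignForm.
Local Open Scope complex_scope.
Variables (R : rcfType) (n : nat).
Local Notation C := R[i].
Local Notation signs := {ffun 'I_n -> bool}.

Definition sgn_row (e : signs) : 'rV[C]_n := \row_j (sgn R e j)%:C.

Lemma ReM_rc (a : R) (z : C) : complex.Re (a%:C * z) = a * complex.Re z.
Proof. by case: z => x y /=; rewrite mul0r subr0. Qed.

Lemma Re_sum (I : finType) (P : pred I) (F : I -> C) :
  complex.Re (\sum_(i | P i) F i) = \sum_(i | P i) complex.Re (F i).
Proof. by apply: (big_morph (@complex.Re R)) => // -[? ?] []. Qed.

Lemma Re_conj (z : C) : complex.Re (Num.conj z) = complex.Re z.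
Proof. by case: z. Qed.

(** Squares of signs are 1, so the diagonal contributes the trace, which vanishes; symmetric pairs
    of entries add up to twice a real part. *)
Lemma qform_sgn_row (H : 'M[C]_n) e : H^t* = H -> \tr H = 0 ->
  qform H (sgn_row e) = (2 * quad (fun j i => complex.Re (H j i)) n e)%:C.
Proof.
move=> HH trH; have HRe i j : complex.Re (H i j) = complex.Re (H j i).
  by rewrite -{1}HH !mxE Re_conj.
have qR : qform H (sgn_row e) \is Num.real.
  apply/CrealP; rewrite /qform.
  transitivity (((sgn_row e *m H *m (sgn_row e)^t*)^t*) 0 0); first by rewrite !mxE.
  by rewrite !trmxC_mul trmxCK HH mulmxA.
rewrite -(RRe_real qR); congr _%:C; rewrite qformE Re_sum.
transitivity (\sum_i \sum_j sgn R e i * sgn R e j * complex.Re (H i j)).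
  apply: eq_bigr => i _; rewrite Re_sum; apply: eq_bigr => j _.
  rewrite !mxE conj_Creal; last by apply/complex_realP; exists (sgn R e j).
  by rewrite -rmorphM /= ReM_rc.
rewrite sum_sym => [|i j]; last by rewrite HRe [sgn R e i * _]mulrC.
have -> : \sum_i sgn R e i * sgn R e i * complex.Re (H i i) = 0.
  under eq_bigr do rewrite -expr2 sgn_sqr mul1r.
  by rewrite -Re_sum -/(\tr H) trH.
rewrite add0r mulr_natl; congr (_ *+ 2); rewrite /quad.
rewrite [RHS](eq_bigl xpredT) => [|j]; last by rewrite ltn_ord.
apply: eq_bigr => j _; rewrite mulr_sumr; apply: eq_bigr => i _.
by rewrite mulrA.
Qed.

(** Here 432 is 2^4 times 27: the 2 comes from the symmetric pairs and 27 from the chaos. The lower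
    triangle of real parts is dominated by the whole Hilbert-Schmidt norm. *)
Lemma sum_qform_sgn_row (H : 'M[C]_n) F : H^t* = H -> \tr H = 0 ->
  \sum_i \sum_j `|H i j| ^+ 2 <= F%:C ->
  \sum_e (complex.Re (qform H (sgn_row e))) ^+ 4 <= #|{: signs}|%:R * (432 * F ^+ 2).
Proof.
move=> HH trH HF; under eq_bigr do rewrite qform_sgn_row //= exprMn.
rewrite -mulr_sumr.
set S := fun j i => complex.Re (H j i).
have S0 := qsqs_ge0 S n.
have SF : qsqs S n <= F.
  rewrite -lecR; apply: le_trans HF.
  have -> : \sum_i \sum_j `|H i j| ^+ 2 =
     (\sum_i \sum_j ((complex.Re (H i j)) ^+ 2 + (complex.Im (H i j)) ^+ 2))%:C.
    rewrite rmorph_sum; apply: eq_bigr => i _; rewrite rmorph_sum.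
    by apply: eq_bigr => j _; rewrite -add_Re2_Im2.
  rewrite lecR /qsqs /sqs (eq_bigl xpredT) => [|j]; last by rewrite ltn_ord.
  apply: ler_sum => j _; rewrite big_mkcond; apply: ler_sum => i _.
  by case: ifP => _; rewrite ?lerDl ?addr_ge0 ?sqr_ge0.
have := sum_quad_quart S (leqnn n); set Q := \sum_e _ => QS.
have : qsqs S n ^+ 2 <= F ^+ 2 by rewrite ler_sqr ?nnegrE // (le_trans S0).
set N := #|_|%:R in QS *; have n0 : 0 <= N by rewrite ler0n.
move=> /(ler_wpM2l n0); lra.
Qed.

(** Markov's inequality for the fourth power, as a count of sign vectors. *)
Lemma card_qform_sgn_row (H : 'M[C]_n) F eta : H^t* = H -> \tr H = 0 ->
  \sum_i \sum_j `|H i j| ^+ 2 <= F%:C -> 0 <= eta ->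
  #|[set e : signs | eta < `|complex.Re (qform H (sgn_row e))|]|%:R * eta ^+ 4
    <= #|{: signs}|%:R * (432 * F ^+ 2).
Proof.
move=> HH trH HF eta0; apply: le_trans (sum_qform_sgn_row HH trH HF).
rewrite mulr_natl -sumr_const [leRHS](bigID (mem [set e : signs | eta < `|complex.Re (qform H (sgn_row e))|])) /=.
rewrite -[leLHS]addr0 lerD //; last first.
  by apply: sumr_ge0 => e _; rewrite exprn_even_ge0.
apply: ler_sum => e; rewrite inE => /ltW etae.
rewrite -[leRHS]ger0_norm ?exprn_even_ge0 // normrX.
by rewrite lerXn2r ?nnegrE.
Qed.

End SignForm.

Local Open Scope classical_set_scope.
Local Open Scope ring_scope.

(** * Eigenvalues of low-rank perturbations *)

Lemma sorted_ge_nth (R : realDomainType) (s : seq R) z i :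
  sorted (fun x y : R => y <= x) s -> (i < size s)%N ->
  (z < nth 0 s i) = (i < count (fun x => z < x)%R s)%N.
Proof.
elim: s i => [|x s IH] i //= pxs.
have ss := path_sorted pxs.
have xs : all (fun y => y <= x) s.
  by apply: order_path_min pxs => a b c /= ba cb; exact: le_trans cb ba.
case: i => [_|i] /=.
  have [zx|xz] := ltP z x; first by rewrite ltnS.
  rewrite add0n; apply/esym/negbTE; rewrite -leqNgt leqn0 -leqn0 leqNgt -has_count.
  apply/hasPn => y ys; rewrite -leNgt; apply: le_trans xz.
  by move/allP: xs => /(_ y ys).
rewrite ltnS => si; rewrite (IH i ss si); have [zx|xz] := ltP z x.
  by rewrite add1n ltnS.
have -> : count (fun x => z < x)%R s = 0%N; last by rewrite addn0 !ltn0.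
apply/eqP; rewrite -leqn0 leqNgt -has_count; apply/hasPn => y ys.
by rewrite -leNgt; apply: le_trans xz; move/allP: xs => /(_ y ys).
Qed.

Lemma char_poly_unitary (C : numClosedFieldType) n (V : 'M[C]_n) (d : 'rV[C]_n) :
  V \is unitarymx ->
  char_poly (V^t* *m diag_mx d *m V) = \prod_(i < n) ('X - (d 0 i)%:P).
Proof.
move=> uV; have VV : V^t* *m V = 1%:M.
  by rewrite -(invmx_unitary uV) mulVmx // unitarymx_unit.
have -> : char_poly (V^t* *m diag_mx d *m V) = char_poly (diag_mx d).
  have EV : char_poly_mx (V^t* *m diag_mx d *m V) =
      map_mx polyC (V^t*) *m char_poly_mx (diag_mx d) *m map_mx polyC V.
    rewrite /char_poly_mx mulmxBr mulmxBl !map_mxM; congr (_ - _).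
    by rewrite mul_mx_scalar -scalemxAl -map_mxM VV map_mx1 scalemx1.
  rewrite /char_poly EV !det_mulmx mulrAC -det_mulmx -map_mxM VV.
  by rewrite map_mx1 det1 mul1r.
rewrite char_poly_trig ?diag_mx_is_trig //.
by apply: eq_bigr => i _; rewrite mxE eqxx mulr1n.
Qed.

Section Eig.
Local Open Scope complex_scope.
Variable R : realType.
Local Notation C := R[i].
Implicit Types (n : nat).

Lemma ctrE n (M : 'M[C]_n) : ctr M = M^t*.
Proof. by rewrite /ctr map_trmx. Qed.

(** [eigseq] sorts an arbitrarily chosen list of roots; unique factorisation into linear factors
    makes the choice immaterial up to order. *)
Lemma eigseq_perm n (M : 'M[C]_n) (s : seq C) :
  char_poly M = \prod_(z <- s) ('X - z%:P) ->
  perm_eq (eigseq M) (map (@complex.Re R) s).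
Proof.
move=> Ms; rewrite /eigseq perm_sort; apply: perm_map.
case: xgetP => [t _ /= Mt|/(_ s)/(_ Ms)//].
by apply: prod_XsubC_eq; rewrite -Mt.
Qed.

Lemma eigseq_sorted n (M : 'M[C]_n) :
  sorted (fun x y : R => y <= x) (eigseq M).
Proof. by apply: sort_sorted => x y; exact: le_total. Qed.

Lemma eigseq_unitary n (V : 'M[C]_n) (d : 'I_n -> R) :
  V \is unitarymx ->
  perm_eq (eigseq (V^t* *m diag_mx (\row_i (d i)%:C) *m V))
          [seq d i | i <- enum 'I_n].
Proof.
move=> uV; have := char_poly_unitary (\row_i (d i)%:C) uV.
have -> : \prod_(i < n) ('X - ((\row_i (d i)%:C : 'rV[C]_n) 0 i)%:P) =
    \prod_(z <- [seq (\row_i (d i)%:C : 'rV[C]_n) 0 i | i <- enum 'I_n]) ('X - z%:P).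
  by rewrite big_map big_enum.
move=> /eigseq_perm /perm_trans; apply; rewrite -map_comp.
rewrite (@eq_map _ _ _ d) ?perm_refl //.
by move=> i /=; rewrite mxE.
Qed.

(** The diagonalising matrix lists the eigenvalues in an arbitrary order; permuting its rows by the
    sorting permutation puts [eig k.+1 M] in place [k]. *)
Lemma hermitian_spectral n (M : 'M[C]_n) : M^t* = M ->
  exists2 V : 'M[C]_n, V \is unitarymx &
    M = V^t* *m diag_mx (\row_(k < n) (eig k.+1 M)%:C) *m V.
Proof.
move=> MH.
have Mh : M \is hermsymmx by apply/is_hermitianmxP; rewrite expr0 scale1r MH.
have /orthomx_spectralP := hermitian_normalmx Mh.
have /mxOverP dR := hermitian_spectral_diag_real Mh.
have uV := spectral_unitarymx M.
rewrite invmx_unitary //; set V := spectralmx M in uV *.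
pose d i := complex.Re (spectral_diag M 0 i).
have -> : spectral_diag M = \row_i (d i)%:C.
  by apply/rowP => i; rewrite mxE RRe_real.
move=> ME; have := eigseq_unitary d uV; rewrite -ME.
have -> : [seq d i | i <- enum 'I_n] = [tuple d i | i < n] :> seq R by [].
move=> /tuple_permP[s es].
exists (row_perm s V).
  apply/unitarymxP; rewrite row_permE trmxC_mul mulmxA -(mulmxA _ V).
  rewrite (unitarymxP uV) mulmx1 tr_perm_mx map_perm_mx -perm_mxM.
  by rewrite mulgV perm_mx1.
rewrite row_permE trmxC_mul [LHS]ME !mulmxA; congr (_ *m _).
rewrite -!mulmxA; congr (_ *m _); rewrite mulmxA.
rewrite tr_perm_mx map_perm_mx -row_permE -{2}[s]invgK -col_permE.
apply/matrixP => i j; rewrite !mxE (inj_eq perm_inj); congr (_ *+ _).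
congr _%:C; rewrite /eig es.
by rewrite (_ : (s^-1 i)%g.+1.-1 = (s^-1 i)%g) // -tnth_nth !tnth_mktuple permKV.
Qed.

Lemma size_eigseq n (M : 'M[C]_n) : M^t* = M -> size (eigseq M) = n.
Proof.
move=> /hermitian_spectral[V uV ->].
by rewrite (perm_size (eigseq_unitary _ uV)) size_map size_enum_ord.
Qed.

Definition neig n (z : R) (M : 'M[C]_n) := count (fun x => z < x) (eigseq M).

(** The passage between ordered eigenvalues and counts: inertia computes counts, and bounds on [eig]
    are read off from them. *)
Lemma eig_gt n (M : 'M[C]_n) z k : M^t* = M -> (0 < k <= n)%N ->
  (z < eig k M) = (k <= neig z M)%N.
Proof.
case: k => [|k] //= MH kn; rewrite /eig sorted_ge_nth ?size_eigseq //.
exact: eigseq_sorted.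
Qed.

Lemma eig_anti n (M : 'M[C]_n) k l : M^t* = M -> (0 < k)%N -> (k <= l)%N ->
  (l <= n)%N -> eig l M <= eig k M.
Proof.
move=> MH k0 kl ln; have kn := leq_trans kl ln.
rewrite leNgt eig_gt // ?(leq_trans k0 kl) ?ln //.
have /negbT : (eig k M < eig k M) = false by rewrite ltxx.
by rewrite eig_gt ?k0 //; apply: contra; exact: leq_trans.
Qed.

Lemma eigseqE n (M : 'M[C]_n) : M^t* = M ->
  eigseq M = [seq eig k.+1 M | k <- iota 0 n].
Proof.
by move=> MH; rewrite -[LHS](mkseq_nth 0) /mkseq size_eigseq.
Qed.

(** After diagonalisation, [z - M] has a negative entry exactly where an eigenvalue of [M] exceeds
    [z]. *)
Lemma neig_index n (M : 'M[C]_n) z : M^t* = M ->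
  neg_index (z%:C%:M - M) (neig z M).
Proof.
move=> MH; have [V uV ME] := hermitian_spectral MH.
have VV : V^t* *m V = 1%:M.
  by rewrite -(invmx_unitary uV) mulVmx // unitarymx_unit.
pose d : 'rV[C]_n := \row_k (z - eig k.+1 M)%:C.
have -> : z%:C%:M - M = V^t* *m diag_mx d *m (V^t*)^t*.
  rewrite trmxCK {1}ME.
  have -> : diag_mx d = z%:C%:M - diag_mx (\row_(k < n) (eig k.+1 M)%:C).
    apply/matrixP => i j; rewrite !mxE rmorphB -mulrnBl.
    by rewrite /=.
  rewrite mulmxBr mulmxBl; congr (_ - _).
  by rewrite mul_mx_scalar -scalemxAl VV scalemx1.
have uVt : V^t* \in unitmx by apply: unitarymx_unit; rewrite trmxC_unitary.
apply: neg_index_congr => //.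
have dR : d \is a realmx.
  by apply/mxOverP => i j; rewrite mxE; apply/complex_realP; exists (z - eig j.+1 M).
have := neg_index_diag dR; congr neg_index.
rewrite /neig eigseqE // count_map -[iota 0 n]val_enum_ord count_map.
rewrite cardE {1}/enum_mem size_filter -enumT.
apply: eq_count => k /=; rewrite inE mxE.
by rewrite -(rmorph0 (real_complex R)) ltcR subr_lt0.
Qed.

End Eig.

(** * Comparison of Hermitian forms *)

Section Compare.
Variable C : numClosedFieldType.

Lemma qform_real n (H : 'M[C]_n) x : H^t* = H -> qform H x \is Num.real.
Proof.
move=> HH; apply/CrealP; rewrite /qform.
transitivity (((x *m H *m x^t*)^t*) 0 0); first by rewrite !mxE.
by rewrite !trmxC_mul trmxCK HH mulmxA.
Qed.

(** A subspace on which the larger form is negative is one for the smaller form too. *)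
Lemma neg_index_le n (H H' : 'M[C]_n) k k' :
  (forall y, qform H y <= qform H' y) ->
  neg_index H k -> neg_index H' k' -> (k' <= k)%N.
Proof.
move=> HH' [kn _ [F fF pF]] [_ [E nE] _].
have : negdim H k' by exists E => y y0; apply: le_lt_trans (HH' _) (nE y y0).
by move=> /negdim_nonnegdim /(_ (ex_intro2 _ _ F fF pF)); lia.
Qed.

(** Crude Schur test: since |x_i| |x_j| <= (|x_i|^2 + |x_j|^2) / 2, entries of size [eta] give
    operator norm at most [n * eta]. It is applied in the fixed dimension [r], where this loss is
    harmless. *)
Lemma qform_bound n (E : 'M[C]_n) eta x : (forall i j, `|E i j| <= eta) ->
  `|qform E x| <= (n%:R * eta) * \sum_i `|x 0 i| ^+ 2.
Proof.
move=> Eeta; rewrite qformE.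
apply: le_trans (ler_norm_sum _ _ _) _.
have -> : (n%:R * eta) * \sum_i `|x 0 i| ^+ 2 =
    \sum_(i < n) \sum_(j < n) (eta * (`|x 0 i| ^+ 2 / 2%:R) + eta * (`|x 0 j| ^+ 2 / 2%:R)).
  under [in RHS]eq_bigr do rewrite big_split /= sumr_const card_ord.
  rewrite big_split /= sumrMnl sumr_const card_ord -mulr_sumr -mulr_suml.
  by rewrite -mulrnDl -mulrDr -splitr -[in RHS]mulr_natl mulrA.
apply: ler_sum => i _; apply: le_trans (ler_norm_sum _ _ _) _.
apply: ler_sum => j _; rewrite !normrM norm_conjC -mulrDr mulrC.
have xi := normr_ge0 (x 0 i); have xj := normr_ge0 (x 0 j).
have sqle : `|x 0 i| * `|x 0 j| <= `|x 0 i| ^+ 2 / 2%:R + `|x 0 j| ^+ 2 / 2%:R.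
  rewrite -subr_ge0.
  have -> : `|x 0 i| ^+ 2 / 2%:R + `|x 0 j| ^+ 2 / 2%:R - `|x 0 i| * `|x 0 j| =
     (`|x 0 i| - `|x 0 j|) ^+ 2 / 2%:R.
    have : (2%:R : C) != 0 by rewrite pnatr_eq0.
    by move=> ?; field.
  rewrite divr_ge0 ?ler0n // -realEsqr.
  by rewrite realB ?normr_real.
by apply: ler_pM => //; rewrite mulr_ge0.
Qed.

Lemma qform_scalar n a (x : 'rV[C]_n) : qform a%:M x = a * \sum_i `|x 0 i| ^+ 2.
Proof.
rewrite -diag_const_mx.
by rewrite qform_diag mulr_sumr; apply: eq_bigr => i _; rewrite mxE.
Qed.

End Compare.

(** * Eigenvalue counts of the perturbed matrix *)

Section Perturb.
Local Open Scope complex_scope.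
Variable R : realType.
Local Notation C := R[i].

Lemma rcreal (x : R) : x%:C \is Num.real.
Proof. by apply/complex_realP; exists x. Qed.

Lemma conjC_rc (x : R) : Num.conj (x%:C) = x%:C :> C.
Proof. exact/conj_Creal/rcreal. Qed.

Definition rdiag r (d : 'I_r -> R) : 'M[C]_r := diag_mx (\row_i (d i)%:C).

Lemma rdiag_herm r (d : 'I_r -> R) : (rdiag d)^t* = rdiag d.
Proof.
rewrite tr_diag_mx map_diag_mx; congr diag_mx; apply/rowP => i.
by rewrite !mxE; exact: conjC_rc.
Qed.

Lemma neg_index_rdiag r (d : 'I_r -> R) :
  neg_index (rdiag d) #|[set i | d i < 0]%SET|.
Proof.
have dR : (\row_i (d i)%:C : 'rV[C]_r) \is a realmx.
  by apply/mxOverP => i j; rewrite mxE; apply/complex_realP; exists (d j).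
have := neg_index_diag dR; congr neg_index; apply: eq_card => i.
by rewrite !inE mxE -(rmorph0 (real_complex R)) ltcR.
Qed.

Lemma neig_perturb n r (X : 'M[C]_n) (U : 'M[C]_(r, n)) (theta : 'I_r -> R) z l :
  X^t* = X -> z%:C%:M - X \in unitmx -> (forall k, 0 < theta k) ->
  neg_index (rdiag (fun k => (theta k)^-1) - U *m invmx (z%:C%:M - X) *m U^t*) l ->
  neig z (X + U^t* *m rdiag theta *m U) = (neig z X + l)%N.
Proof.
move=> XH uz tpos nl.
have tt : rdiag (fun k => (theta k)^-1) *m rdiag theta = 1%:M.
  rewrite /rdiag mulmx_diag -diag_const_mx; congr diag_mx; apply/rowP => i.
  by rewrite !mxE -rmorphM mulVf // gt_eqF.
have uT : rdiag (fun k => (theta k)^-1) \in unitmx by case/mulmx1_unit: tt.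
have iT : invmx (rdiag (fun k => (theta k)^-1)) = rdiag theta.
  by rewrite -[LHS]mulmx1 -tt mulKmx.
have nT : neg_index (rdiag (fun k => (theta k)^-1)) 0.
  have := neg_index_rdiag (fun k => (theta k)^-1).
  rewrite (_ : #|_| = 0%N) //; apply/eqP; rewrite cards_eq0; apply/eqP.
  by apply/setP => k; rewrite !inE ltNge invr_ge0 ltW.
have scH : (z%:C%:M : 'M[C]_n)^t* = z%:C%:M.
  by rewrite tr_scalar_mx map_scalar_mx /= conjC_rc.
have AH : (z%:C%:M - X)^t* = z%:C%:M - X by rewrite trmxCD trmxCN scH XH.
apply: neg_index_schur uz uT AH (rdiag_herm _) nT (neig_index z XH) nl _.
rewrite iT -addrA -opprD; apply: neig_index.
by rewrite trmxCD !trmxC_mul XH trmxCK rdiag_herm mulmxA.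
Qed.

Section Close.
Variables (n r : nat) (X : 'M[C]_n) (U : 'M[C]_(r, n)) (theta : 'I_r -> R) (z : R).
Hypotheses (XH : X^t* = X) (uz : z%:C%:M - X \in unitmx).
Hypothesis tpos : forall k, 0 < theta k.
Let K := U *m invmx (z%:C%:M - X) *m U^t*.
Let Xt := X + U^t* *m rdiag theta *m U.

Let KH : K^t* = K.
Proof.
rewrite /K !trmxC_mul trmxCK mulmxA; congr (_ *m _ *m _).
rewrite trmx_inv map_invmx; congr invmx.
by rewrite trmxCD trmxCN XH tr_scalar_mx map_scalar_mx /= conjC_rc.
Qed.

Variables (g eta : R).
Hypothesis Kg : forall i j, `|K i j - (g%:C *+ (i == j))| <= eta%:C.

Let close y : `|qform K y - g%:C * \sum_i `|y 0 i| ^+ 2| <=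
   (r%:R * eta%:C) * \sum_i `|y 0 i| ^+ 2.
Proof.
rewrite -qform_scalar -qformN -qformD; apply: qform_bound => i j.
by rewrite mxE [X in _ + X]mxE [X in _ - X]mxE.
Qed.

(** A single identity serves both comparisons: [s = 1] shifts the diagonal matrix up by the largest
    error [r * eta], and [s = -1] shifts it down. *)
Let qdiff s y :
  qform (rdiag (fun k => (theta k)^-1) - K) y =
  qform (rdiag (fun k => (theta k)^-1 - g + s * (r%:R * eta))) y -
  (qform K y - g%:C * (\sum_i `|y 0 i| ^+ 2) + s%:C * (r%:R * eta%:C) * \sum_i `|y 0 i| ^+ 2).
Proof.
rewrite qformD qformN /rdiag !qform_diag.
under [in RHS]eq_bigr do rewrite mxE rmorphD rmorphB !rmorphM /= mulrDl mulrBl.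
rewrite big_split sumrB /= -!mulr_sumr rmorph_nat.
under [in LHS]eq_bigr do rewrite mxE.
by ring.
Qed.

Let qreal y : qform K y - g%:C * (\sum_i `|y 0 i| ^+ 2) \is Num.real.
Proof.
rewrite realB ?qform_real // realM //; first exact: rcreal.
by apply: sum_real => i _; rewrite realX // normr_real.
Qed.

Let sreal (y : 'rV[C]_r) : r%:R * eta%:C * (\sum_i `|y 0 i| ^+ 2) \is Num.real.
Proof.
apply: realM; first by apply: realM; [exact: ger0_real (ler0n _ _)|exact: rcreal].
by apply: sum_real => i _; rewrite realX // normr_real.
Qed.

(** The form of Theta^-1 - K lies below that of the diagonal matrix with entries 1/theta_k - g + r
    eta, whose first [i] entries are negative. *)
Lemma neig_perturb_ge (i : nat) : (i <= r)%N ->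
  (forall k : 'I_r, (k < i)%N -> (theta k)^-1 + r%:R * eta < g) ->
  (neig z X + i <= neig z Xt)%N.
Proof.
move=> ir tg.
have [|l nl] := @neg_index_exists _ _ (rdiag (fun k => (theta k)^-1) - K).
  by rewrite trmxCD trmxCN KH rdiag_herm.
rewrite /Xt (neig_perturb XH uz tpos nl) leq_add2l.
have nd := neg_index_rdiag (fun k => (theta k)^-1 - g + 1 * (r%:R * eta)).
apply: leq_trans (neg_index_le _ nl nd).
  have -> : i = #|[set widen_ord ir k | k in 'I_i]%SET|.
    rewrite card_imset ?card_ord // => a b /(congr1 val) ab; exact: val_inj.
  apply: subset_leq_card; apply/fintype.subsetP => _ /imsetP[k _ ->].
  by rewrite inE mul1r; have /= := tg (widen_ord ir k) (ltn_ord k); lra.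
move=> y; rewrite (qdiff 1) lerBlDr lerDl mul1r.
have := close y; rewrite real_ler_norml // => /andP[+ _].
by rewrite -subr_ge0 opprK.
Qed.

(** Dually, the form lies above that of the diagonal matrix with entries 1/theta_k - g - r eta, and
    only entries of index below [i] can be negative there. *)
Lemma neig_perturb_le (i : nat) :
  (forall k : 'I_r, (i <= k)%N -> g < (theta k)^-1 - r%:R * eta) ->
  (neig z Xt <= neig z X + i)%N.
Proof.
move=> tg.
have [|l nl] := @neg_index_exists _ _ (rdiag (fun k => (theta k)^-1) - K).
  by rewrite trmxCD trmxCN KH rdiag_herm.
rewrite /Xt (neig_perturb XH uz tpos nl) leq_add2l.
have nd := neg_index_rdiag (fun k => (theta k)^-1 - g + (-1) * (r%:R * eta)).
apply: leq_trans (neg_index_le _ nd nl) _.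
  move=> y; rewrite (qdiff (-1)) lerBrDr gerDl rmorphN1 mulNr mul1r mulNr.
  by have := close y; rewrite real_ler_norml // => /andP[_ +]; rewrite -subr_le0.
have [ri|ir] := leqP r i.
  by apply: leq_trans ri; apply: leq_trans (max_card _) _; rewrite card_ord.
have -> : i = #|[set widen_ord (ltnW ir) k | k in 'I_i]%SET|.
  rewrite card_imset ?card_ord // => a b /(congr1 val) ab; exact: val_inj.
apply: subset_leq_card; apply/fintype.subsetP => k; rewrite inE => tk.
have ki : (k < i)%N.
  by rewrite ltnNge; apply/negP => /tg; move: tk; lra.
by apply/imsetP; exists (Ordinal ki) => //; apply: val_inj.
Qed.

End Close.
End Perturb.

(** * Spectral frame of the perturbation *)

Section LowRank.
Local Open Scope complex_scope.
Variable R : realType.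
Local Notation C := R[i].

(** The nonzero eigenvalues being positive, the sorted spectrum of [P] is [theta 1, ..., theta r]
    followed by zeros; hence the first [r] rows of the diagonalising matrix form [U]. *)
Lemma low_rank_decomp n r (P : 'M[C]_n) (theta : nat -> R) :
  P^t* = P -> (r <= n)%N -> 0 < theta r ->
  (forall i, (1 <= i < r)%N -> theta i.+1 <= theta i) ->
  perm_eq [seq x <- eigseq P | x != 0] [seq theta k | k <- iota 1 r] ->
  exists2 U : 'M[C]_(r, n), U *m U^t* = 1%:M &
    P = U^t* *m rdiag (fun k : 'I_r => theta k.+1) *m U.
Proof.
move=> PH rn tr0 tdec tperm.
have tle i k : (1 <= i)%N -> (i + k <= r)%N -> theta (i + k)%N <= theta i.
  move=> i1; elim: k => [|k IH] ikr; first by rewrite addn0.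
  by rewrite addnS in ikr *; apply: le_trans (tdec _ _) (IH _); lia.
have tpos k : (1 <= k <= r)%N -> 0 < theta k.
  move=> /andP[k1 kr]; apply: lt_le_trans tr0 _.
  by have := tle k (r - k)%N k1; rewrite subnKC //; apply.
have Eeig k : (k < n)%N -> eig k.+1 P = (if (k < r)%N then theta k.+1 else 0).
  pose s2 := [seq theta k | k <- iota 1 r] ++ nseq (n - r) 0.
  have sz : sorted (fun x y : R => y <= x) s2.
    have tR : transitive (fun x y : R => y <= x) by move=> x y w /= xy yw; exact: le_trans yw xy.
    rewrite (sorted_pairwise tR) pairwise_cat; apply/and3P; split.
    - rewrite allrel_mapl; apply/allrelP => x y; rewrite mem_iota => xr.
      by move=> /nseqP[-> _]; rewrite ltW // tpos //; lia.
    - rewrite -(sorted_pairwise tR); apply/(sortedP 0) => i.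
      rewrite size_map size_iota => ir.
      rewrite !(nth_map 0%N) ?size_iota ?nth_iota; try lia.
      by rewrite add1n tdec //; lia.
    - rewrite -(sorted_pairwise tR); apply/(sortedP 0) => i.
      by rewrite size_nseq => ir; rewrite !nth_nseq !if_same.
  have pz : perm_eq (eigseq P) s2.
    have pC := perm_filterC (fun x : R => x != 0) (eigseq P).
    rewrite -pC perm_cat //.
    have -> : [seq x <- eigseq P | predC (fun x => x != 0) x] = nseq (n - r) 0.
      have /all_pred1P -> : all (pred1 0) [seq x <- eigseq P | predC (fun x => x != 0) x].
        by rewrite all_filter; apply/allP => x _ /=; rewrite negbK implybb.
      congr nseq; have /permPl/perm_size := pC; rewrite size_cat (perm_size tperm).
      by rewrite size_map size_iota size_eigseq // => nE; rewrite -[X in (X - _)%N]nE addKn.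
    exact: perm_refl.
  have -> : eig k.+1 P = nth 0 s2 k.
    rewrite /eig; congr (nth _ _ _).
    apply: (sorted_eq _ _ (eigseq_sorted P) sz pz).
      by move=> x y w /= xy yw; exact: le_trans yw xy.
    by move=> x y /= xy; apply/eqP; rewrite eq_le andbC.
  move=> kn; rewrite nth_cat size_map size_iota; case: ltnP => kr.
    by rewrite (nth_map 0%N) ?size_iota // nth_iota // add1n.
  by rewrite nth_nseq if_same.
have [V uV PE] := hermitian_spectral PH.
exists (\matrix_(k < r, j < n) V (widen_ord rn k) j).
  have /unitarymxP VV := uV.
  apply/matrixP => k l; rewrite !mxE.
  have /matrixP /(_ (widen_ord rn k) (widen_ord rn l)) := VV.
  by rewrite !mxE => <-; apply: eq_bigr => j _; rewrite !mxE.
apply/matrixP => i j; rewrite {1}PE /rdiag !mul_mx_diag !mxE.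
have -> : \sum_(k < n) (\matrix_(i0, j0) (V^t* i0 j0 * (\row_(k0 < n) (eig k0.+1 P)%:C) 0 j0)) i k * V k j
  = \sum_(k < n) (if (k < r)%N then (V k i)^* * (theta k.+1)%:C * V k j else 0).
  apply: eq_bigr => k _; rewrite !mxE Eeig //; case: ifP => // _.
  by rewrite rmorph0 mulr0 mul0r.
rewrite -big_mkcond /=.
rewrite (big_ord_narrow_cond rn (P := xpredT)) /=.
by apply: eq_bigr => k _; rewrite !mxE.
Qed.

End LowRank.

(** * Concentration of resolvent quadratic forms *)

Section Householder.
Variable C : numClosedFieldType.

Lemma qform_scale n (B : 'M[C]_n) a (v : 'rV[C]_n) :
  qform B (a *: v) = (a * a^*) * qform B v.
Proof.
rewrite /qform trmxCZ -scalemxAl -scalemxAl -scalemxAr scalerA mxE.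
by [].
Qed.

Lemma trmxC_scalar n (a : C) : (a%:M : 'M[C]_n)^t* = (a^*)%:M.
Proof. by rewrite tr_scalar_mx map_scalar_mx. Qed.

Lemma normv_mulmx n (u : 'rV[C]_n) : u *m u^t* = (\sum_i `|u 0 i| ^+ 2)%:M.
Proof.
apply/matrixP => i j; rewrite !ord1 !mxE eqxx mulr1n.
by apply: eq_bigr => k _; rewrite !mxE normCK.
Qed.

(** The reflection along [u - t] sends [u] to [t] when the two have equal norms and a real inner
    product; the second hypothesis expresses that reality. *)
Lemma householder n (u t : 'rV[C]_n) : u *m u^t* = t *m t^t* ->
  u *m t^t* = t *m u^t* ->
  exists h : 'M[C]_n, [/\ h *m h^t* = 1%:M, u *m h = t &
    u \is a realmx -> t \is a realmx -> h \is a realmx].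
Proof.
move=> uutt utR; pose v := u - t.
pose a := \sum_i `|v 0 i| ^+ 2.
have vv : v *m v^t* = a%:M by exact: normv_mulmx.
have [v0|vn0] := eqVneq v 0.
  exists 1%:M; split; rewrite ?trmxC1 ?mulmx1 //.
    by apply/eqP; rewrite -subr_eq0 -/v v0.
  by move=> _ _; apply/mxOverP => i j; rewrite mxE rpred_nat.
have a0 : a != 0.
  have [i vi] := rV0Pn _ vn0; rewrite /a (bigD1 i) //= gt_eqF // ltr_pwDl //.
    by rewrite exprn_gt0 // normr_gt0.
  by rewrite sumr_ge0 // => j _; rewrite exprn_ge0.
have aR : a \is Num.real.
  apply: sum_real => i _.
  by rewrite realX // normr_real.
have uv2 : u *m v^t* = (a / 2)%:M.
  have E : v *m v^t* = u *m v^t* + u *m v^t*.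
    rewrite {1}/v mulmxBl; congr (_ + _).
    rewrite /v trmxCD trmxCN !mulmxDr !mulmxN -uutt utR opprD opprK addrC.
    by rewrite addrC [RHS]addrC addrC.
  apply: (@scalerI _ _ (2 : C)); first by rewrite pnatr_eq0.
  rewrite scaler_nat mulr2n -E vv -scalemx1 -(scalemx1 _ (a/2)) scalerA.
  by rewrite mulrC divfK // pnatr_eq0.
have cR : 2 / a \is Num.real by rewrite rpred_div // rpred_nat.
pose h := 1%:M - (2 / a) *: (v^t* *m v).
have hH : h^t* = h.
  rewrite /h trmxCD trmxCN trmxC1 trmxCZ trmxC_mul trmxCK.
  by rewrite conj_Creal.
exists h; split.
- pose W := v^t* *m v.
  have WW : W *m W = a *: W.
    by rewrite /W mulmxA -(mulmxA _ v) vv mul_mx_scalar scalemxAl.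
  rewrite hH /h -/W mulmxBl mul1mx mulmxBr mulmx1 -scalemxAl -scalemxAr WW !scalerA.
  have -> : 2 / a * (2 / a) * a = 2 / a + 2 / a by rewrite -mulrA divfK //; ring.
  by rewrite scalerDl opprB addrK subrK.
- rewrite /h mulmxBr mulmx1 -scalemxAr mulmxA uv2 mul_scalar_mx scalerA.
  have -> : 2 / a * (a / 2) = 1 :> C.
    by have : (2 : C) != 0 by [rewrite pnatr_eq0]; move=> ?; field; rewrite a0.
  by rewrite scale1r /v opprB addrC subrK.
- move=> /mxOverP uR /mxOverP tR.
  have vR i : v 0 i \is Num.real by rewrite !mxE realB.
  apply/mxOverP => i j; rewrite mxE [X in _ + X]mxE [X in _ - X]mxE.
  rewrite rpredB //; first by rewrite mxE rpred_nat.
  rewrite rpredM // mxE big_ord1 rpredM //.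
  by rewrite [_ i _]mxE [_^T _ _]mxE (conj_Creal (vR i)); exact: vR.
Qed.

End Householder.


Section Rotate.
Local Open Scope complex_scope.
Variable R : realType.
Local Notation C := R[i].

Lemma real_mxE n (M : 'M[C]_n) : real_mx M <-> M \is a realmx.
Proof.
split=> [Mr|/mxOverP Mr i j].
  by apply/mxOverP => i j; rewrite [M i j]complexE Mr mulr0 addr0 rcreal.
by have /complex_realP[k ->] := Mr i j.
Qed.

Lemma normv_real n (u : 'rV[C]_n) :
  \sum_i `|u 0 i| ^+ 2 = (complex.Re (\sum_i `|u 0 i| ^+ 2))%:C.
Proof.
rewrite RRe_real //; apply: sum_real => i _.
by rewrite realX // normr_real.
Qed.

(** In the complex setting the inner product of [u] with the sign vector need not be real, so the
    target is first multiplied by the phase [al]; a factor of modulus 1 disappears from quadratic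
    forms. In the real setting [al] is 1 or -1, and the reflection is orthogonal. *)
Lemma rotate_to_signs cplx n (u : 'rV[C]_n) (e : {ffun 'I_n -> bool}) rho :
  (0 < n)%N -> (~~ cplx -> u \is a realmx) -> \sum_i `|u 0 i| ^+ 2 = rho%:C ->
  exists2 g : 'M[C]_n, setting_group cplx g &
    forall B, qform B (u *m g) = (rho / n%:R)%:C * qform B (sgn_row R e).
Proof.
move=> n0 ur urho.
have rho0 : 0 <= rho.
  by rewrite -ler0c -urho sumr_ge0 // => i _; rewrite exprn_ge0.
pose c0 : R := Num.sqrt (rho / n%:R).
pose s : 'rV[C]_n := c0%:C *: sgn_row R e.
have sr : s \is a realmx.
  by apply/mxOverP => i j; rewrite !mxE -rmorphM rcreal.
have ss : s *m s^t* = u *m u^t*.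
  rewrite !normv_mulmx urho; congr (_%:M).
  under eq_bigr => i _.
    rewrite !mxE -rmorphM normc_def /= expr0n addr0 -rmorphXn /=.
    rewrite sqr_sqrtr ?sqr_ge0 // exprMn sgn_sqr mulr1 sqr_sqrtr ?divr_ge0 //.
  over.
  by rewrite sumr_const card_ord -rmorphMn -mulr_natr divfK // pnatr_eq0 -lt0n.
pose w := (u *m s^t*) 0 0.
have uw : u *m s^t* = w%:M by rewrite [LHS]mx11_scalar.
have swE : s *m u^t* = (Num.conj w)%:M.
  by rewrite -trmxC_scalar -uw trmxC_mul trmxCK.
pose al : C := if w == 0 then 1 else w / `|w|.
have al1 : al * Num.conj al = 1.
  rewrite /al; case: eqVneq => [_|w0]; first by rewrite conjC1 mulr1.
  rewrite rmorphM fmorphV /= (conj_Creal (normr_real w)) mulrACA -invfM -normCK expr2.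
  by rewrite divff // mulf_neq0 // normr_eq0.
have alw : Num.conj al * w = al * Num.conj w.
  rewrite /al; case: eqVneq => [->|w0]; first by rewrite rmorph0 !mulr0.
  rewrite rmorphM fmorphV /= (conj_Creal (normr_real w)).
  by rewrite mulrAC [Num.conj w * w]mulrC mulrAC.
have [||h [hh uh hr]] := @householder _ _ u (al *: s).
- rewrite trmxCZ -scalemxAl -scalemxAr scalerA al1 scale1r.
  by rewrite ss.
- by rewrite trmxCZ -scalemxAl -scalemxAr uw swE !scale_scalar_mx alw.
exists h.
  split; first by rewrite ctrE.
  move=> /ur ureal; apply/real_mxE; apply: (hr ureal); apply/mxOverP => i j.
  have wr : w \is Num.real.
    rewrite /w mxE; apply: sum_real => k _; rewrite !mxE conj_Creal.
      by rewrite realM // ?(mxOverP ureal) // -rmorphM rcreal.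
    by rewrite -rmorphM rcreal.
  rewrite mxE realM ?(mxOverP sr) // /al; case: ifP => _; first exact: real1.
  by rewrite realM // realV normr_real.
move=> B; rewrite uh qform_scale al1 mul1r /s qform_scale.
by rewrite conjC_rc -rmorphM -expr2 sqr_sqrtr ?divr_ge0.
Qed.

End Rotate.

(** * Centred resolvents and the deviation event *)

Section Resolvent.
Local Open Scope complex_scope.
Variable R : realType.
Local Notation C := R[i].

Definition resolv n (z : R) (X : 'M[C]_n) := invmx (z%:C%:M - X).

Definition centred n (B : 'M[C]_n) : 'M[C]_n := B - (\tr B / n%:R)%:M.

Definition frob n (B : 'M[C]_n) : R :=
  \sum_i \sum_j ((complex.Re (B i j)) ^+ 2 + (complex.Im (B i j)) ^+ 2).

Lemma frobE n (B : 'M[C]_n) : (frob B)%:C = \tr (B *m B^t*).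
Proof.
rewrite rmorph_sum; apply: eq_bigr => i _; rewrite rmorph_sum mxE.
by apply: eq_bigr => j _; rewrite /= !mxE add_Re2_Im2 normCK.
Qed.

(** [M] bounds the squared Hilbert-Schmidt norm of the resolvent divided by [n]. For fixed [z] off
    the spectrum this quantity stays bounded, which is what makes the deviation probability
    O(n^-2). *)
Definition bad n z (u : 'rV[C]_n) eta M (X : 'M[C]_n) : bool :=
  [&& z%:C%:M - X \in unitmx, frob (resolv z X) <= n%:R * M &
      eta < `|complex.Re (qform (centred (resolv z X)) u)|].

Lemma centred_conj n (g B : 'M[C]_n) : g *m g^t* = 1%:M ->
  centred (g *m B *m g^t*) = g *m centred B *m g^t*.
Proof.
move=> gg; rewrite /centred mulmxBr mulmxBl; congr (_ - _).
rewrite mul_mx_scalar -scalemxAl gg -scalemx1 mxtrace_mulC mulmxA.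
by rewrite (mulmx1C gg) mul1mx.
Qed.

Lemma resolv_conj n z (g X : 'M[C]_n) : g *m g^t* = 1%:M ->
  (z%:C%:M - g *m X *m g^t* \in unitmx) = (z%:C%:M - X \in unitmx) /\
  (z%:C%:M - X \in unitmx -> resolv z (g *m X *m g^t*) = g *m resolv z X *m g^t*).
Proof.
move=> gg; have [ug ugt] := mulmx1_unit gg.
have E : z%:C%:M - g *m X *m g^t* = g *m (z%:C%:M - X) *m g^t*.
  rewrite mulmxBr mulmxBl; congr (_ - _).
  by rewrite mul_mx_scalar -scalemxAl gg scalemx1.
split; first by rewrite E !unitmx_mul ug ugt andbT.
move=> uX; rewrite /resolv E; set A := _ - X.
have AA : (g *m A *m g^t*) *m (g *m invmx A *m g^t*) = 1%:M.
  rewrite -!mulmxA (mulmxA (g^t*)) (mulmx1C gg) mul1mx (mulmxA A).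
  by rewrite mulmxV // mul1mx.
have [uA' _] := mulmx1_unit AA.
by rewrite -[LHS]mulmx1 -AA mulKmx.
Qed.

(** Invertibility and the Hilbert-Schmidt norm are unitarily invariant and centring commutes with
    conjugation, so rotating [X] amounts to rotating [u]. *)
Lemma bad_conj n z u eta M (g X : 'M[C]_n) : g *m g^t* = 1%:M ->
  bad z u eta M (g *m X *m g^t*) = bad z (u *m g) eta M X.
Proof.
move=> gg; have [uE rE] := resolv_conj z X gg; rewrite /bad uE.
apply: andb_id2l => uX; rewrite (rE uX) (centred_conj _ gg) qform_mul.
congr (_ && _); rewrite -lecR -[RHS]lecR !frobE; congr (_ <= _).
rewrite !trmxC_mul trmxCK !mulmxA -(mulmxA _ _ g) (mulmx1C gg) mulmx1.
by rewrite mxtrace_mulC !mulmxA (mulmx1C gg) mul1mx.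
Qed.

Lemma resolv_herm n z (X : 'M[C]_n) : X^t* = X -> (resolv z X)^t* = resolv z X.
Proof.
move=> XH; rewrite /resolv trmx_inv map_invmx; congr invmx.
by rewrite trmxCD trmxCN XH trmxC_scalar conjC_rc.
Qed.

Lemma centred_herm n (B : 'M[C]_n) : B^t* = B ->
  (centred B)^t* = centred B.
Proof.
move=> BH; rewrite /centred trmxCD trmxCN BH trmxC_scalar; congr (_ - _%:M).
apply: conj_Creal; rewrite rpred_div ?rpred_nat //.
by rewrite CrealE -[X in _ == X]mxtrace_tr -{2}BH map_trmx trmxK trace_map_mx.
Qed.

Lemma tr_centred n (B : 'M[C]_n) : (0 < n)%N -> \tr (centred B) = 0.
Proof.
move=> n0; rewrite /centred mxtraceD linearN /= mxtrace_scalar -[_ *+ n]mulr_natr divfK ?subrr //.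
by rewrite pnatr_eq0 -lt0n.
Qed.

(** Subtracting the normalised trace is the orthogonal projection away from the scalar matrices; the
    squared norm drops by (tr B)^2 / n. *)
Lemma centred_frob n (B : 'M[C]_n) : (0 < n)%N -> B^t* = B ->
  frob (centred B) <= frob B.
Proof.
move=> n0 BH; rewrite -lecR !frobE (centred_herm BH) BH.
have trc := tr_centred B n0.
rewrite {1}/centred mulmxBl mul_scalar_mx linearB /= linearZ /= trc mulr0 subr0.
rewrite {1}/centred mulmxBr linearB /= gerDl oppr_le0 mul_mx_scalar linearZ /=.
have trR : \tr B \is Num.real.
  by rewrite CrealE -[X in _ == X]mxtrace_tr -{2}BH map_trmx trmxK trace_map_mx.
by rewrite mulrAC -expr2 divr_ge0 // -realEsqr.
Qed.

(** The sign row has squared norm [n] where [u] has [rho], so the threshold [eta] becomes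
    [eta * n / rho]. The fraction of bad sign vectors is then at most 432 (n M)^2 / (eta n / rho)^4,
    of order n^-2. *)
Lemma card_bad n z (u : 'rV[C]_n) rho eta M (X : 'M[C]_n)
    (g : {ffun 'I_n -> bool} -> 'M[C]_n) :
  (0 < n)%N -> X^t* = X -> 0 <= eta -> 0 <= rho ->
  (forall e B, qform B (u *m g e) = (rho / n%:R)%:C * qform B (sgn_row R e)) ->
  #|[set e | bad z (u *m g e) eta M X]%SET|%:R * (eta ^+ 4 * n%:R ^+ 2)
   <= #|{: {ffun 'I_n -> bool}}|%:R * (432 * M ^+ 2 * rho ^+ 4).
Proof.
move=> n0 XH eta0 rho0 gE; set N := #|{: _}|%:R.
set B := resolv z X.
have nR : 0 < n%:R :> R by rewrite ltr0n.
have k0 : 0 <= 432 :> R by exact: ler0n.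
have N0 : 0 <= N by exact: ler0n.
have bound0 : 0 <= N * (432 * M ^+ 2 * rho ^+ 4).
  apply: mulr_ge0 N0 _; apply: mulr_ge0; last exact: exprn_ge0.
  exact: mulr_ge0 k0 (sqr_ge0 _).
have [Fr|Fr] := boolP ((z%:C%:M - X \in unitmx) && (frob B <= n%:R * M)); last first.
  rewrite (_ : #|_| = 0%N) ?mul0r //.
  apply/eqP; rewrite cards_eq0; apply/eqP/setP => e; rewrite !inE /bad andbA.
  by rewrite (negbTE Fr).
move: Fr => /andP[_ Fr].
have BH := resolv_herm z XH.
move: rho0; rewrite le_eqVlt => /predU1P[r0|rho0].
  rewrite (_ : #|_| = 0%N) ?mul0r //.
  apply/eqP; rewrite cards_eq0; apply/eqP/setP => e; rewrite !inE /bad gE -r0.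
  by rewrite !mul0r normr0 ltNge eta0 !andbF.
have HF : \sum_i \sum_j `|centred B i j| ^+ 2 <= (n%:R * M)%:C.
  apply: (@le_trans _ _ (frob (centred B))%:C); last first.
    by rewrite lecR; apply: le_trans Fr; exact: centred_frob.
  rewrite rmorph_sum ler_sum // => i _; rewrite rmorph_sum ler_sum // => j _.
  by rewrite /= add_Re2_Im2.
have eta'0 : 0 <= eta * n%:R / rho by rewrite divr_ge0 ?mulr_ge0 // ltW.
have := card_qform_sgn_row (centred_herm BH) (tr_centred B n0) HF eta'0.
move: (432 : R) k0 {bound0} => K k0.
move=> cS; set S' := [set e | bad _ _ _ _ _]%SET.
have -> : #|S'|%:R * (eta ^+ 4 * n%:R ^+ 2) =
   (#|S'|%:R * (eta * n%:R / rho) ^+ 4) * (rho ^+ 4 / n%:R ^+ 2).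
  by field; rewrite !gt_eqF.
have -> : N * (K * M ^+ 2 * rho ^+ 4) =
   N * (K * (n%:R * M) ^+ 2) * (rho ^+ 4 / n%:R ^+ 2).
  by field; rewrite !gt_eqF.
rewrite ler_wpM2r ?divr_ge0 ?exprn_ge0 ?(ltW rho0) //.
apply: le_trans cS; rewrite ler_wpM2r ?exprn_ge0 // ler_nat subset_leq_card //.
apply/fintype.subsetP => e; rewrite !inE => /and3P[_ _].
rewrite gE ReM_rc normrM ger0_norm ?divr_ge0 // ?(ltW rho0) // => h.
set q := `|_| in h *; rewrite ltr_pdivrMr // -ltr_pdivlMr //.
by rewrite (_ : q * rho / n%:R = rho / n%:R * q) // -mulrA mulrC.
Qed.

End Resolvent.

(** * Measurability of the deviation event *)

Lemma measurable_invr (R : realType) : measurable_fun setT (fun x : R => x^-1).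
Proof.
(* This reduces inversion to a real power of a square; at [x = 0] both sides are 0. *)
have E (x : R) : x * (x ^+ 2) `^ (-1) = x^-1.
  rewrite powR_inv1 ?sqr_ge0 //; have [->|x0] := eqVneq x 0.
    by rewrite mul0r invr0.
  by rewrite expr2 invfM mulrA divff // mul1r.
rewrite -(funext E); apply: measurable_funM; first exact: measurable_id.
apply: (measurableT_comp (measurable_powR _)); exact: measurable_funX.
Qed.

Section CMeasurable.
Variables (R : realType) (d : measure_display) (T : measurableType d).
Local Notation C := R[i].

Definition cmeas (f : T -> C) :=
  measurable_fun setT (fun x => complex.Re (f x)) /\
  measurable_fun setT (fun x => complex.Im (f x)).

Lemma eq_cmeas (f g : T -> C) : f =1 g -> cmeas f -> cmeas g.
Proof. by move=> /funext ->. Qed.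

Lemma cmeas_cst c : cmeas (fun=> c).
Proof. by split; exact: measurable_cst. Qed.

Lemma cmeasD f g : cmeas f -> cmeas g -> cmeas (fun x => f x + g x).
Proof.
move=> [f1 f2] [g1 g2]; split.
  have := measurable_funD f1 g1; congr measurable_fun; apply/funext => x /=.
  by case: (f x) (g x) => ? ? [].
have := measurable_funD f2 g2; congr measurable_fun; apply/funext => x /=.
by case: (f x) (g x) => ? ? [].
Qed.

Lemma cmeasM f g : cmeas f -> cmeas g -> cmeas (fun x => f x * g x).
Proof.
move=> [f1 f2] [g1 g2]; split.
  have := measurable_funB (measurable_funM f1 g1) (measurable_funM f2 g2).
  by congr measurable_fun; apply/funext => x /=; case: (f x) (g x) => ? ? [].
have := measurable_funD (measurable_funM f1 g2) (measurable_funM f2 g1).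
by congr measurable_fun; apply/funext => x /=; case: (f x) (g x) => ? ? [].
Qed.

Lemma cmeas_sum (I : Type) (r : seq I) (P : pred I) (F : I -> T -> C) :
  (forall i, cmeas (F i)) -> cmeas (fun x => \sum_(i <- r | P i) F i x).
Proof.
move=> mF; elim: r => [|i r IH].
  by apply: eq_cmeas (cmeas_cst 0) => x; rewrite big_nil.
case Pi : (P i).
  by apply: eq_cmeas (cmeasD (mF i) IH) => x; rewrite big_cons Pi.
by apply: eq_cmeas IH => x; rewrite big_cons Pi.
Qed.

Lemma cmeas_prod (I : Type) (r : seq I) (P : pred I) (F : I -> T -> C) :
  (forall i, cmeas (F i)) -> cmeas (fun x => \prod_(i <- r | P i) F i x).
Proof.
move=> mF; elim: r => [|i r IH].
  by apply: eq_cmeas (cmeas_cst 1) => x; rewrite big_nil.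
case Pi : (P i).
  by apply: eq_cmeas (cmeasM (mF i) IH) => x; rewrite big_cons Pi.
by apply: eq_cmeas IH => x; rewrite big_cons Pi.
Qed.

Lemma cmeasV f : cmeas f -> cmeas (fun x => (f x)^-1).
Proof.
move=> [f1 f2].
have sq : measurable_fun setT
    (fun x => (complex.Re (f x) ^+ 2 + complex.Im (f x) ^+ 2)^-1).
  apply: (measurableT_comp (@measurable_invr R)).
  by apply: measurable_funD; apply: measurable_funX.
split.
  have := measurable_funM f1 sq; congr measurable_fun; apply/funext => x /=.
  by case: (f x).
have := measurableT_comp (@oppr_measurable R setT) (measurable_funM f2 sq).
congr measurable_fun; apply/funext => x /=.
by case: (f x).
Qed.

End CMeasurable.

HB.instance Definition _ (R : realType) := isPointed.Build R[i] 0.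

Section MxMeasurable.
Local Open Scope complex_scope.
Variables (R : realType) (n : nat).
Local Notation C := R[i].

(** The generators of [mx_borel], named so that matrices become a measurable type. *)
Definition mx_gen : set (set 'M[C]_n) :=
  [set B | exists (i j : 'I_n) (A : set R), measurable A /\
         (B = [set M : 'M[C]_n | A (complex.Re (M i j))] \/
          B = [set M : 'M[C]_n | A (complex.Im (M i j))])].

Local Notation MT := (g_sigma_algebraType mx_gen).

Lemma cmeas_entry i j : cmeas (fun M : MT => (M : 'M[C]_n) i j).
Proof.
split=> _ A mA; rewrite setTI; apply: sub_sigma_algebra.
  by exists i, j, A; split=> //; left.
by exists i, j, A; split=> //; right.
Qed.

Lemma cmeas_det k (F : MT -> 'M[C]_k) :
  (forall i j, cmeas (fun M => F M i j)) -> cmeas (fun M => \det (F M)).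
Proof.
move=> mF; rewrite /determinant; apply: cmeas_sum => s.
apply: cmeasM; first exact: cmeas_cst.
by apply: cmeas_prod => i; exact: mF.
Qed.

Lemma cmeas_sub z i j : cmeas (fun M : MT => (z%:C%:M - (M : 'M[C]_n)) i j).
Proof.
apply: eq_cmeas (cmeasD (cmeas_cst _ (((z%:C)%:M : 'M[C]_n) i j))
   (cmeasM (cmeas_cst _ (-1)) (cmeas_entry i j))) => M /=.
by rewrite mulN1r [RHS]mxE [X in _ = _ + X]mxE.
Qed.

(** Cramer's formula, measurable in the entries on all matrices: a singular [z - M] gives 0, as 0^-1
    = 0. It agrees with [resolv] wherever [bad] requires invertibility. *)
Definition adjinv (z : R) (M : 'M[C]_n) : 'M[C]_n :=
  (\det (z%:C%:M - M))^-1 *: \adj (z%:C%:M - M).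

Lemma cmeas_adjinv z i j : cmeas (fun M : MT => adjinv z M i j).
Proof.
have cm := cmeas_det (cmeas_sub z).
have cminor : cmeas (fun M : MT => \det (row' j (col' i (z%:C%:M - (M : 'M[C]_n))))).
  apply: cmeas_det => k l.
  by apply: eq_cmeas (cmeas_sub z (lift j k) (lift i l)) => M; rewrite [RHS]mxE [RHS]mxE.
apply: eq_cmeas (cmeasM (cmeasV cm) (cmeasM (cmeas_cst _ ((-1) ^+ (j + i))) cminor)) => M.
by rewrite /adjinv [RHS]mxE [X in _ = _ * X]mxE.
Qed.

Lemma resolv_adjinv z (M : 'M[C]_n) : z%:C%:M - M \in unitmx ->
  resolv z M = adjinv z M.
Proof. by move=> uz; rewrite /resolv /invmx uz. Qed.

Lemma badE z (u : 'rV[C]_n) (eta K : R) : bad z u eta K =1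
  (fun M => [&& \det (z%:C%:M - M) != 0, frob (adjinv z M) <= n%:R * K &
      eta < `|complex.Re (qform (centred (adjinv z M)) u)|]).
Proof.
move=> M; rewrite /bad -[\det _ != 0]unitfE -unitmxE.
by apply: andb_id2l => uz; rewrite (resolv_adjinv uz).
Qed.

Lemma measurable_bad z (u : 'rV[C]_n) (eta K : R) : mx_borel [set M | bad z u eta K M].
Proof.
suff : measurable ([set M : MT | bad z u eta K M]) by [].
have m1 : measurable_fun setT (fun M : MT => \det (z%:C%:M - (M : 'M[C]_n)) != 0).
  have [dr di] := cmeas_det (cmeas_sub z).
  have er := measurable_fun_eqr dr (@measurable_cst _ _ _ _ _ (0 : R)).
  have ei := measurable_fun_eqr di (@measurable_cst _ _ _ _ _ (0 : R)).
  have := measurable_neg (measurable_and er ei).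
  by congr measurable_fun; apply/funext => M /=; rewrite eq_complex.
have m2 : measurable_fun setT (fun M : MT => frob (adjinv z M) <= n%:R * K).
  apply: measurable_fun_ler; last exact: measurable_cst.
  apply: measurable_sum => i; apply: measurable_sum => j.
  have [ar ai] := cmeas_adjinv z i j.
  by apply: measurable_funD; apply: measurable_funX.
have m3 : measurable_fun setT (fun M : MT =>
    eta < `|complex.Re (qform (centred (adjinv z M)) u)|).
  apply: measurable_fun_ltr; first exact: measurable_cst.
  apply: measurableT_comp => //.
  suff [] : cmeas (fun M : MT => qform (centred (adjinv z M)) u) by [].
  under eq_fun do rewrite qformE.
  apply: cmeas_sum => i; apply: cmeas_sum => j.
  apply: cmeasM; first exact: cmeas_cst.
  have mt : cmeas (fun M : MT => - ((\tr (adjinv z M) / n%:R) *+ (i == j))).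
    have ct := cmeas_sum (index_enum 'I_n) xpredT (fun k => cmeas_adjinv z k k).
    apply: eq_cmeas (cmeasM ct (cmeas_cst _ (- (n%:R^-1 *+ (i == j))))) => M /=.
    by rewrite mulrN mulrnAr.
  apply: eq_cmeas (cmeasD (cmeas_adjinv z i j) mt) => M.
  by rewrite /centred [RHS]mxE [X in _ = _ + X]mxE [X in _ = _ - X]mxE.
have m123 := measurable_and m1 (measurable_and m2 m3).
have mt : measurable [set true] by [].
set f := (f in measurable_fun _ f) in m123.
have -> : [set M : MT | bad z u eta K M] = setT `&` f @^-1` [set true].
  by rewrite setTI; apply/seteqP; split=> M /=; rewrite badE.
exact: m123.
Qed.

End MxMeasurable.

(** * Polarisation *)

Section Sesqui.
Variable C : numClosedFieldType.

Definition sform n (H : 'M[C]_n) (x y : 'rV[C]_n) : C := (x *m H *m y^t*) 0 0.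

Lemma qform_addZ n (H : 'M[C]_n) x y (c : C) :
  qform H (x + c *: y) =
  qform H x + c * Num.conj c * qform H y + Num.conj c * sform H x y + c * sform H y x.
Proof.
rewrite /qform /sform trmxCD trmxCZ !mulmxDl !mulmxDr -!scalemxAl -!scalemxAr.
rewrite scalerA !mxE; ring.
Qed.

Lemma polarization n (H : 'M[C]_n) x y :
  4%:R * sform H x y = qform H (x + 1 *: y) + 'i * qform H (x + 'i *: y)
    - qform H (x + (-1) *: y) - 'i * qform H (x + (- 'i) *: y).
Proof.
rewrite !qform_addZ !rmorphN !rmorph1 /= conjCi.
have i2 : 'i * 'i = -1 :> C by rewrite -expr2 sqrCi.
set q := qform H x; set q' := qform H y; set s := sform H x y; set s' := sform H y x.
transitivity (2 * s * (1 - 'i * 'i) + 2 * s' * (1 + 'i * 'i)); last by ring.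
by rewrite i2; ring.
Qed.

(** Polarisation recovers a matrix entry from four quadratic forms; four errors [eta] are divided by
    4. *)
Lemma norm_sform n (H : 'M[C]_n) x y (eta : C) :
  (forall c : C, c \in [:: 1; 'i; -1; - 'i] -> `|qform H (x + c *: y)| <= eta) ->
  `|sform H x y| <= eta.
Proof.
move=> h.
rewrite -(ler_pM2l (_ : 0 < 4%:R)) ?ltr0n // -[X in X * `|_|]normr_nat -normrM.
rewrite polarization.
have n1 := h 1 _; have n2 := h 'i _; have n3 := h (-1) _; have n4 := h (- 'i) _.
rewrite !inE !eqxx ?orbT in n1 n2 n3 n4.
have -> : 4%:R * eta = eta + eta + eta + eta by ring.
apply: le_trans (ler_normB _ _) _; apply: lerD; last by rewrite normrM normCi mul1r n4.
apply: le_trans (ler_normB _ _) _; apply: lerD; last exact: n3.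
apply: le_trans (ler_normD _ _) _; apply: lerD; first exact: n1.
by rewrite normrM normCi mul1r n2.
Qed.

Lemma normv_addZ_le n (x y : 'rV[C]_n) (c : C) : `|c| = 1 ->
  \sum_i `|(x + c *: y) 0 i| ^+ 2 <=
  2%:R * (\sum_i `|x 0 i| ^+ 2 + \sum_i `|y 0 i| ^+ 2).
Proof.
move=> c1; rewrite -big_split mulr_sumr /=; apply: ler_sum => i _.
rewrite mxE [X in `|_ + X|]mxE; set a := x 0 i; set b := y 0 i.
have nb : `|b| = `|c * b| by rewrite normrM c1 mul1r.
rewrite nb; set b' := c * b.
apply: (@le_trans _ _ ((`|a| + `|b'|) ^+ 2)).
  by rewrite lerXn2r ?nnegrE ?addr_ge0 // ler_normD.
rewrite -subr_ge0.
have -> : 2%:R * (`|a| ^+ 2 + `|b'| ^+ 2) - (`|a| + `|b'|) ^+ 2 = (`|a| - `|b'|) ^+ 2 by ring.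
by rewrite -realEsqr realB ?normr_real.
Qed.

End Sesqui.


(** Integrating the number of events that occur at [w] gives the sum of their probabilities. *)
Lemma prob_average (R : realType) (d : measure_display) (T : measurableType d)
    (P : probability T R) (I : finType) (b : I -> T -> bool) (c : R) :
  (forall i, measurable [set w | b i w]) ->
  (forall w, #|[set i | b i w]%SET|%:R <= c) ->
  (\sum_i P [set w | b i w] <= c%:E)%E.
Proof.
move=> mb cb.
have -> : (\sum_i P [set w | b i w] = \int[P]_x (\sum_i (\1_[set w | b i w] x)%:E))%E.
  have mi i : measurable_fun setT (fun x => (\1_[set w | b i w] x)%:E : \bar R).
    by apply/measurable_EFinP; exact: measurable_indic.
  rewrite (ge0_integral_sum P measurableT mi); last by move=> i x _; rewrite lee_fin.
  by apply: eq_bigr => i _; rewrite integral_indic // setIT.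
rewrite -[leRHS]mule1 -(@probability_setT _ _ _ P) -integral_cst //.
apply: ge0_le_integral => //.
- by move=> x _; apply: sume_ge0 => i _; rewrite lee_fin.
- by apply: emeasurable_sum => i; apply/measurable_EFinP; exact: measurable_indic.
- move=> x _ /=; rewrite sumEFin lee_fin; apply: le_trans (cb x).
  rewrite -sum1_card natr_sum [leRHS]big_mkcond /=.
  apply: ler_sum => i _; rewrite inE indicE.
  by case: (boolP (b i x)) => bi; [rewrite mem_set|rewrite memNset //; exact/negP].
Qed.

(** * Almost sure concentration *)

Section Concentration.
Local Open Scope complex_scope.
Variables (R : realType) (cplx : bool).
Variables (d : measure_display) (T : measurableType d) (P : probability T R).
Local Notation C := R[i].

Lemma setting_herm n (M : 'M[C]_n) : setting_mx cplx M -> M^t* = M.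
Proof. by case; rewrite /Defs.hermitian ctrE. Qed.

Lemma setting_groupV n (g : 'M[C]_n) : setting_group cplx g -> g *m g^t* = 1%:M.
Proof. by case; rewrite ctrE. Qed.

Section OneMatrix.
Variables (n : nat) (X : T -> 'M[C]_n).
Hypothesis Xset : forall w, setting_mx cplx (X w).
Hypothesis Xmeas : forall B : set 'M[C]_n, mx_borel B -> measurable (X @^-1` B).
Hypothesis Xinv : forall U : 'M[C]_n, setting_group cplx U ->
  forall B : set 'M[C]_n, mx_borel B ->
       P (X @^-1` B) = P ((fun w => U *m X w *m ctr U) @^-1` B).

(** By invariance the events for [u *m g e] all have the probability of the event for [u]. At each
    sample [card_bad] bounds how many of them occur, so averaging over the sign vectors bounds the
    common probability. *)
Lemma prob_bad z (u : 'rV[C]_n) rho eta M : (0 < n)%N ->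
  (~~ cplx -> u \is a realmx) -> \sum_i `|u 0 i| ^+ 2 = rho%:C -> 0 < eta ->
  (P (X @^-1` [set A | bad z u eta M A]) <=
    (432 * M ^+ 2 * rho ^+ 4 / (eta ^+ 4 * n%:R ^+ 2))%:E)%E.
Proof.
move=> n0 ur urho eta0.
have rho0 : 0 <= rho.
  by rewrite -ler0c -urho sumr_ge0 // => i _; rewrite exprn_ge0.
have /choice[g gP] : forall e, exists ge : 'M[C]_n, setting_group cplx ge /\
    (forall B, qform B (u *m ge) = (rho / n%:R)%:C * qform B (sgn_row R e)).
  by move=> e; have [ge ? ?] := rotate_to_signs e n0 ur urho; exists ge.
pose N := #|{: {ffun 'I_n -> bool}}|.
have N0 : (0 < N)%N by apply/card_gt0P; exists [ffun=> true].
have mbad v : measurable [set w | bad z v eta M (X w)].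
  by have := Xmeas (measurable_bad z v eta M).
have PE e : P [set w | bad z (u *m g e) eta M (X w)] =
    P (X @^-1` [set A | bad z u eta M A]).
  have [ge _] := gP e; rewrite (Xinv ge (measurable_bad z u eta M)); apply: (congr1 P).
  apply/seteqP; split=> w /=; rewrite ctrE bad_conj //; exact: setting_groupV.
have den0 : 0 < eta ^+ 4 * n%:R ^+ 2 by rewrite mulr_gt0 ?exprn_gt0 ?ltr0n.
move: (@card_bad R n z u rho eta M); set k := 432 => cb.
set c := k * M ^+ 2 * rho ^+ 4 in cb *.
have := @prob_average R d T P _ (fun e w => bad z (u *m g e) eta M (X w))
   (N%:R * (c / (eta ^+ 4 * n%:R ^+ 2))) (fun e => mbad _).
under eq_bigr do rewrite PE.
have : P (X @^-1` [set A | bad z u eta M A]) \is a fin_num.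
  exact: fin_num_measure (mbad u).
move=> /fineK <-; rewrite sumEFin sumr_const -/N -[fine _ *+ _]mulr_natl !lee_fin.
rewrite ler_pM2l ?ltr0n //; apply => w.
rewrite mulrA ler_pdivlMr //; apply: cb => //; first exact: setting_herm.
  exact: ltW.
by move=> e B; have [_] := gP e; apply.
Qed.

End OneMatrix.

Lemma sum_inv_sqr_le (m : nat) : \sum_(0 <= n < m) ((n.+1)%:R ^- 2 : R) <= 2.
Proof.
(* The telescoping remainder 1/m is added to make the induction close; at [m = 0] it is 0 by
   convention. *)
suff : \sum_(0 <= n < m) ((n.+1)%:R ^- 2 : R) + m%:R^-1 <= 2.
  by apply: le_trans; rewrite lerDl invr_ge0.
elim: m => [|[|m] IH]; first by rewrite big_geq // invr0 addr0.
  by rewrite big_nat1 expr1n invr1.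
rewrite big_nat_recr //= -addrA; apply: le_trans IH; rewrite lerD2l.
have m1 : 0 < m.+1%:R :> R by rewrite ltr0n.
have m2 : m.+2%:R = m.+1%:R + 1 :> R by rewrite -natr1.
rewrite m2; set x : R := m.+1%:R in m1 *.
have x1 : 0 < x + 1 by rewrite addr_gt0.
rewrite -subr_ge0.
have -> : x^-1 - ((x + 1) ^- 2 + (x + 1)^-1) = (x ^-1 * (x + 1) ^- 2).
  by field; rewrite !gt_eqF.
by rewrite mulr_ge0 // invr_ge0 ?exprn_ge0 // ltW.
Qed.

Lemma borel_cantelli_sqr (E : nat -> set T) (K : R) :
  (forall n, measurable (E n)) -> 0 <= K ->
  (forall n, (P (E n.+1) <= (K * n.+1%:R ^- 2)%:E)%E) ->
  {ae P, forall w, \forall n \near \oo, ~ E n w}.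
Proof.
(* The sequence is shifted because the bound starts with size 1; a single event does not affect
   eventual behaviour. *)
move=> mE K0 EK; pose F n := E n.+1.
have mF n : measurable (F n) by exact: mE.
exists (lim_sup_set F); split.
- apply: bigcap_measurable => // n _.
  by apply: bigcup_measurable => m _; exact: mF.
- apply: lim_sup_set_cvg0 => //.
  apply: (@le_lt_trans _ _ (K * 2)%:E); last exact: ltry.
  apply: lime_le; first by apply: is_cvg_nneseries => n _ _; exact: measure_ge0.
  apply: nearW => m; rewrite big_mkord.
  apply: (@le_trans _ _ (\sum_(n < m) (K * n.+1%:R ^- 2)%:E)%E).
    by apply: lee_sum => n _; exact: EK.
  rewrite sumEFin lee_fin -mulr_sumr ler_wpM2l //.
  by rewrite -(big_mkord xpredT (fun n => n.+1%:R ^- 2 : R)) sum_inv_sqr_le.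
- move=> w /= nE n _; apply: contrapT => nF; apply: nE.
  exists n.+1 => // -[//|m] /= nm Em; apply: nF.
  by exists m.
Qed.

Section Sequence.
Variable X : forall n : nat, T -> 'M[C]_n.
Hypothesis Xset : forall n w, setting_mx cplx (X n w).
Hypothesis Xmeas : forall n (B : set 'M[C]_n), mx_borel B -> measurable (X n @^-1` B).
Hypothesis Xinv : forall n (U : 'M[C]_n), setting_group cplx U ->
  forall B : set 'M[C]_n, mx_borel B ->
       P (X n @^-1` B) = P ((fun w => U *m X n w *m ctr U) @^-1` B).

Lemma not_bad_setting z (u : forall n, 'rV[C]_n) rho eta M :
  (forall n, ~~ cplx -> u n \is a realmx) ->
  (forall n, \sum_i `|u n 0 i| ^+ 2 <= rho%:C) -> 0 < eta ->
  {ae P, forall w, \forall n \near \oo, ~~ bad z (u n) eta M (X n w)}.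
Proof.
move=> ur urho eta0.
have mE n : measurable (X n @^-1` [set A | bad z (u n) eta M A]).
  exact: Xmeas (measurable_bad _ _ _ _).
have k0 : 0 <= 432 :> R by exact: ler0n.
have K0 : 0 <= 432 * M ^+ 2 * rho ^+ 4 / eta ^+ 4.
  apply: divr_ge0; last by rewrite exprn_ge0 // ltW.
  apply: mulr_ge0; last by rewrite exprn_even_ge0.
  exact: mulr_ge0 k0 (sqr_ge0 _).
have EK n : (P (X n.+1 @^-1` [set A | bad z (u n.+1) eta M A]) <=
    (432 * M ^+ 2 * rho ^+ 4 / eta ^+ 4 * n.+1%:R ^- 2)%:E)%E.
  pose rn := complex.Re (\sum_i `|u n.+1 0 i| ^+ 2).
  have rnE : \sum_i `|u n.+1 0 i| ^+ 2 = rn%:C by exact: normv_real.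
  have rn0 : 0 <= rn.
    by rewrite -ler0c -rnE sumr_ge0 // => i _; rewrite exprn_ge0.
  have rnr : rn <= rho by rewrite -lecR -rnE.
  apply: le_trans (prob_bad (Xset n.+1) (@Xmeas n.+1) (@Xinv n.+1) z M (ltn0Sn n) (ur _) rnE eta0) _.
  rewrite lee_fin invfM mulrA; apply: ler_wpM2r; first by rewrite invr_ge0 exprn_ge0.
  apply: ler_wpM2r; first by rewrite invr_ge0 exprn_ge0 // ltW.
  apply: ler_wpM2l; first exact: mulr_ge0 k0 (sqr_ge0 _).
  by rewrite lerXn2r // nnegrE // (le_trans rn0).
apply: filterS (borel_cantelli_sqr mE K0 EK) => w [N _ h].
by exists N => // n Nn; apply/negP; exact: h.
Qed.

Lemma not_badP n z (u : 'rV[C]_n) (eta M : R) (A : 'M[C]_n) :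
  ~~ bad z u eta M A <->
  (z%:C%:M - A \in unitmx -> frob (resolv z A) <= n%:R * M ->
    `|complex.Re (qform (centred (resolv z A)) u)| <= eta).
Proof.
rewrite /bad; move: (z%:C%:M - A \in unitmx) (frob _ <= _) => b1 b2.
rewrite leNgt; move: (eta < _) => b3.
split=> [+ B1 B2|h]; first by rewrite B1 B2.
by apply/and3P => -[B1 B2]; apply/negP; exact: h.
Qed.

(** For real symmetric [H] the mixed terms of [x + i y] cancel, so real and imaginary parts can be
    treated separately. *)
Lemma qform_realmx n (H : 'M[C]_n) (x y : 'rV[C]_n) : H^t* = H ->
  H \is a realmx -> x \is a realmx -> y \is a realmx ->
  qform H (x + 'i%C *: y) = qform H x + qform H y.
Proof.
move=> HH Hr xr yr.
have tr_real m k (A : 'M[C]_(m, k)) : A \is a realmx -> A^t* = A^T.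
  by move=> Ar; rewrite -map_trmx realmxC.
have HT : H^T = H by rewrite -{2}HH tr_real.
have sxy : sform H x y = sform H y x.
  rewrite /sform (tr_real _ _ _ xr) (tr_real _ _ _ yr).
  transitivity ((x *m H *m y^T)^T 0 0); first by rewrite [RHS]mxE.
  by rewrite !trmx_mul trmxK HT mulmxA.
have ci : Num.conj 'i%C = - 'i%C :> C by apply/eqP; rewrite eq_complex /= oppr0 !eqxx.
have i2 : 'i%C * 'i%C = -1 :> C by rewrite -expr2 sqr_i.
rewrite qform_addZ ci sxy mulrN i2 opprK mul1r -addrA mulNr.
by rewrite [X in _ + X]addNr addr0.
Qed.

Lemma centred_resolv_real n z (A : 'M[C]_n) : setting_mx cplx A -> ~~ cplx ->
  centred (resolv z A) \is a realmx.
Proof.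
move=> Aset nc; have AH := setting_herm Aset; have [_ /(_ nc)/real_mxE Ar] := Aset.
have Rr : resolv z A \is a realmx.
  apply/mxOverP => i j; apply/CrealP.
  have : map_mx Num.conj (resolv z A) = resolv z A.
    rewrite /resolv map_invmx; congr invmx; rewrite map_mxB map_scalar_mx /=.
    by rewrite conjC_rc realmxC.
  by move=> /matrixP/(_ i j); rewrite mxE.
apply/mxOverP => i j; rewrite mxE [X in _ + X]mxE [X in _ - X]mxE.
apply: rpredB; first exact: (mxOverP Rr).
apply: rpredMn; apply: rpred_div; last exact: rpred_nat.
by apply: rpred_sum => k _; exact: (mxOverP Rr).
Qed.

(** Orthogonal matrices cannot move a general complex vector to a sign vector. In the real setting
    the real and imaginary parts of [u n] are handled with [eta / 2] each. *)
Lemma not_bad z (u : forall n, 'rV[C]_n) rho eta M :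
  (forall n, \sum_i `|u n 0 i| ^+ 2 <= rho%:C) -> 0 < eta ->
  {ae P, forall w, \forall n \near \oo, ~~ bad z (u n) eta M (X n w)}.
Proof.
move=> urho eta0; have [c|nc] := boolP cplx.
  by apply: not_bad_setting urho eta0 => n; rewrite c.
pose x n : 'rV[C]_n := map_mx (fun a => (complex.Re a)%:C) (u n).
pose y n : 'rV[C]_n := map_mx (fun a => (complex.Im a)%:C) (u n).
have xr n : x n \is a realmx by apply/mxOverP => i j; rewrite mxE rcreal.
have yr n : y n \is a realmx by apply/mxOverP => i j; rewrite mxE rcreal.
have uE n : u n = x n + 'i%C *: y n.
  by apply/rowP => i; rewrite !mxE -complexE.
have rc2 (a : R) : `|a%:C : C| ^+ 2 = (a ^+ 2)%:C.
  by rewrite -add_Re2_Im2 /= expr0n addr0.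
have xrho n : \sum_i `|x n 0 i| ^+ 2 <= rho%:C.
  apply: le_trans (urho n); apply: ler_sum => i _.
  by rewrite mxE rc2 -add_Re2_Im2 lecR lerDl sqr_ge0.
have yrho n : \sum_i `|y n 0 i| ^+ 2 <= rho%:C.
  apply: le_trans (urho n); apply: ler_sum => i _.
  by rewrite mxE rc2 -add_Re2_Im2 lecR lerDr sqr_ge0.
have e2 : 0 < eta / 2 by rewrite divr_gt0.
have nbx := @not_bad_setting z x rho (eta / 2) M (fun n _ => xr n) xrho e2.
have nby := @not_bad_setting z y rho (eta / 2) M (fun n _ => yr n) yrho e2.
apply: filterS2 nbx nby => w; apply: filterS2 => n xe ye.
apply: (iffRL (not_badP _ _ _ _ _)) => uz Fr.
have := iffLR (not_badP _ _ _ _ _) xe uz Fr.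
have := iffLR (not_badP _ _ _ _ _) ye uz Fr.
have RH := resolv_herm z (setting_herm (Xset n w)).
have Rr := centred_resolv_real z (Xset n w) nc.
rewrite uE (qform_realmx (centred_herm RH) Rr (xr n) (yr n)).
move: (qform _ (x n)) (qform _ (y n)) => qx qy {}ye {}xe.
rewrite (_ : complex.Re (qx + qy) = complex.Re qx + complex.Re qy); last first.
  by case: (qx) (qy) => ? ? [].
apply: le_trans (ler_normD _ _) _; rewrite [leRHS]splitr.
exact: lerD xe ye.
Qed.

Lemma sform_conc r z (U : forall n, 'M[C]_(r, n)) eta M :
  (forall n k, \sum_i `|U n k i| ^+ 2 <= 1) -> 0 < eta ->
  {ae P, forall w, \forall n \near \oo, z%:C%:M - X n w \in unitmx ->
     frob (resolv z (X n w)) <= n%:R * M ->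
     forall k l, `|(U n *m centred (resolv z (X n w)) *m (U n)^t*) k l| <= eta%:C}.
Proof.
move=> Ule eta0.
have h (k l : 'I_r) (c : C) : `|c| = 1 -> {ae P, forall w, \forall n \near \oo,
    ~~ bad z (row k (U n) + c *: row l (U n)) eta M (X n w)}.
  (* Rows have squared norm at most 1, so their combinations have at most 2 (1 + 1) = 4. *)
  move=> c1; apply: (@not_bad _ _ 4) => // n.
  apply: le_trans (normv_addZ_le _ _ c1) _.
  have -> : (4 : R)%:C = 2%:R * (1 + 1) :> C by rewrite rmorph_nat; ring.
  rewrite ler_wpM2l ?ler0n // lerD //.
    by apply: le_trans (Ule n k); apply: ler_sum => i _; rewrite mxE.
  by apply: le_trans (Ule n l); apply: ler_sum => i _; rewrite mxE.
pose Q w (k l : 'I_r) n := forall c : C,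
  c \in [:: 1; Num.imaginary; -1; - Num.imaginary] ->
  ~~ bad z (row k (U n) + c *: row l (U n)) eta M (X n w).
have hQ : {ae P, forall w, forall k l, \forall n \near \oo, Q w k l n}.
  apply: filter_forall => k; apply: filter_forall => l.
  have h1 := h k l 1 (normr1 _); have h2 := h k l Num.imaginary (normCi _).
  have h3 := h k l (-1) (normrN1 _).
  have h4 := h k l (- Num.imaginary) (etrans (normrN _) (normCi _)).
  apply: filterS2 (filterI h1 h2) (filterI h3 h4) => w [w1 w2] [w3 w4].
  apply: filterS2 (filterI w1 w2) (filterI w3 w4) => n [n1 n2] [n3 n4] c.
  by rewrite !inE => /or4P[] /eqP->; [exact: n1|exact: n2|exact: n3|exact: n4].
have hall w : (forall k l, \forall n \near \oo, Q w k l n) ->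
    \forall n \near \oo, forall k l, Q w k l n.
  by move=> wQ; do 2![apply: filter_forall => ?]; exact: wQ.
apply: filterS hQ => w /hall; apply: filterS => n nb uz Fr k l.
have -> : (U n *m centred (resolv z (X n w)) *m (U n)^t*) k l =
    sform (centred (resolv z (X n w))) (row k (U n)) (row l (U n)).
  rewrite /sform mxE [RHS]mxE; apply: eq_bigr => i _; congr (_ * _).
    by rewrite -row_mul [RHS]mxE.
  by rewrite !mxE.
apply: norm_sform => c /(nb k l) /not_badP /(_ uz Fr).
have Hh := centred_herm (resolv_herm z (setting_herm (Xset n w))).
rewrite -(RRe_real (qform_real _ Hh)) => qe.
by rewrite normc_def /= expr0n addr0 sqrtr_sqr lecR.
Qed.

End Sequence.
End Concentration.

(** * The Cauchy transform on a gap of the support *)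

Section BoundedIntegral.
Variables (R : realType) (mu : probability R R).

Definition bmeas (f : R -> R) :=
  measurable_fun setT f /\ exists M, forall x, `|f x| <= M.

Lemma bmeas_integrable f : bmeas f -> mu.-integrable setT (EFin \o f).
Proof.
move=> [mf [M fM]]; apply: measurable_bounded_integrable => //.
  by rewrite -ge0_fin_numE // fin_num_measure.
exists M; split; first exact: num_real.
by move=> x Mx y _; apply: le_trans (fM y) (ltW Mx).
Qed.

Lemma bmeasB f g : bmeas f -> bmeas g -> bmeas (fun x => f x - g x).
Proof.
move=> [mf [M fM]] [mg [N gN]]; split; first exact: measurable_funB.
exists (M + N) => x; apply: le_trans (ler_normB _ _) _.
exact: lerD (fM x) (gN x).
Qed.

Lemma bmeas_cst c : bmeas (fun=> c).
Proof. by split; [exact: measurable_cst|exists `|c|]. Qed.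

Lemma bmeas_min f g : bmeas f -> bmeas g -> bmeas (fun x => Num.min (f x) (g x)).
Proof.
move=> [mf [M fM]] [mg [N gN]]; split; first exact: measurable_minr.
exists (M + N) => x.
have M0 : 0 <= M by apply: le_trans (fM x).
have N0 : 0 <= N by apply: le_trans (gN x).
rewrite minElt; case: ifP => _.
  by apply: le_trans (fM x) _; rewrite lerDl.
by apply: le_trans (gN x) _; rewrite lerDr.
Qed.

Definition Rmean (f : R -> R) := fine (\int[mu]_t (f t)%:E).

Lemma Rmean_ae f g (N : set R) : measurable N -> mu N = 0%E ->
  measurable_fun setT f -> measurable_fun setT g ->
  (forall t, ~ N t -> f t = g t) -> Rmean f = Rmean g.
Proof.
move=> mN N0 mf mg fg; rewrite /Rmean; congr fine; apply: ae_eq_integral => //.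
- exact/measurable_EFinP.
- exact/measurable_EFinP.
exists N; split => // t /= nfg; apply: contrapT => Nt; apply: nfg => _.
by rewrite fg.
Qed.

(** Replacing [f] by its minimum with [g] changes it only on the null set [N] and makes the
    inequality hold everywhere. *)
Lemma Rmean_le f g (N : set R) : measurable N -> mu N = 0%E ->
  bmeas f -> bmeas g -> (forall t, ~ N t -> f t <= g t) -> Rmean f <= Rmean g.
Proof.
move=> mN N0 bf bg fg.
have bm := bmeas_min bf bg.
rewrite (Rmean_ae mN N0 bf.1 bm.1); last first.
  by move=> t /fg fgt; rewrite min_l.
apply: (@le_Rintegral _ _ _ mu setT) => //; [exact: bmeas_integrable..|].
by move=> x _; rewrite ge_min lexx orbT.
Qed.

Lemma Rmean_sub f g : bmeas f -> bmeas g -> Rmean (fun t => f t - g t) = Rmean f - Rmean g.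
Proof.
move=> bf bg; apply: (@RintegralB _ _ _ mu setT) => //; exact: bmeas_integrable.
Qed.

Lemma Rmean_cst c : Rmean (fun=> c) = c.
Proof.
have -> : Rmean (fun=> c) = fine (c%:E * mu setT).
  by congr fine; apply: (@integral_cst _ _ _ mu setT measurableT c%:E).
have -> : mu setT = 1%E by exact: probability_setT.
by rewrite mule1.
Qed.

End BoundedIntegral.

(* Bounded continuous function agreeing with [t |-> (z - t)^-1] outside [ ]z - delta, z + delta[ ]. *)
Definition trunc_inv (R : realType) (z delta t : R) : R :=
  (z - t) / Num.max ((z - t) ^+ 2) (delta ^+ 2).

Section TruncInv.
Variable R : realType.
Implicit Types z t delta : R.

Lemma trunc_invE z t delta : 0 < delta -> delta <= `|z - t| ->
  trunc_inv z delta t = (z - t)^-1.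
Proof.
move=> d0 dzt; rewrite /trunc_inv max_l.
  by rewrite expr2 invfM mulrA divff ?mul1r // -normr_gt0 (lt_le_trans d0).
by rewrite -[leRHS]real_normK ?num_real // lerXn2r ?nnegrE // ltW.
Qed.

Lemma trunc_inv_continuous z delta : 0 < delta -> continuous (trunc_inv z delta).
Proof.
move=> d0 t; apply: cvgM.
  by apply: cvgB; [exact: cvg_cst|exact: cvg_id].
apply: cvgV; first by rewrite gt_eqF // lt_max orbC exprn_gt0.
apply: (@continuous_max _ _ (fun t => (z - t) ^+ 2) (fun=> delta ^+ 2)) => //=.
  apply: (@continuous_comp _ _ _ (fun t => z - t) (fun x => x ^+ 2)).
    by apply: cvgB; [exact: cvg_cst|exact: cvg_id].
  exact: exprn_continuous.
exact: cvg_cst.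
Qed.

Lemma trunc_inv_bound z t delta : 0 < delta -> `|trunc_inv z delta t| <= delta^-1.
Proof.
move=> d0; rewrite /trunc_inv normrM normfV.
have m0 : 0 < Num.max ((z - t) ^+ 2) (delta ^+ 2) by rewrite lt_max orbC exprn_gt0.
rewrite (gtr0_norm m0) ler_pdivrMr // mulrC ler_pdivlMr //.
have [le|/ltW le] := leP `|z - t| delta.
  apply: (@le_trans _ _ (delta * delta)); first by rewrite ler_wpM2r // ltW.
  by rewrite le_max -expr2 lexx orbT.
apply: (@le_trans _ _ (`|z - t| * `|z - t|)); first by rewrite ler_wpM2l.
by rewrite le_max -expr2 real_normK ?num_real // lexx.
Qed.

Lemma bmeas_trunc_inv z delta : 0 < delta -> bmeas (trunc_inv z delta).
Proof.
move=> d0; split.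
  by apply: continuous_measurable_fun; exact: trunc_inv_continuous.
by exists delta^-1 => t; exact: trunc_inv_bound.
Qed.

End TruncInv.

Section Cauchy.
Variables (R : realType) (mu : probability R R) (A B lo hi : R).
Hypotheses (muAB : mu (~` `[A, B]%classic) = 0%E) (gap : mu `]lo, hi[%classic = 0%E).
Hypothesis lohi : lo < hi.
Local Notation G := (cauchy_tr mu).

Let N := (~` `[A, B]%classic) `|` `]lo, hi[%classic.

Let mN : measurable N.
Proof. by apply: measurableU => //; apply: measurableC. Qed.

Let N0 : mu N = 0%E.
Proof.
apply/eqP; rewrite -measure_le0; apply: le_trans (measureU2 _ _ _) _ => //.
  exact: measurableC.
by rewrite [X in (X + _)%E]muAB [X in (_ + X)%E]gap adde0.
Qed.

Let notN t : ~ N t -> A <= t <= B /\ (t <= lo \/ hi <= t).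
Proof.
move=> /not_orP[/contrapT]; rewrite /= in_itv /= => tAB; split=> //.
have [tlo|lot] := leP t lo; first by left.
have [hit|thi] := leP hi t; first by right.
by exfalso; apply: b; rewrite /= in_itv /= lot thi.
Qed.

(** Almost every [t] is at distance at least [delta] from [z], so the Cauchy kernel can be replaced
    by a bounded continuous function, to which weak convergence of the spectra applies. *)
Lemma cauchy_trE z delta : 0 < delta -> lo <= z - delta -> z + delta <= hi ->
  G z = Rmean mu (trunc_inv z delta).
Proof.
move=> d0 zlo zhi; apply: (Rmean_ae mN N0) => //.
- apply: (measurableT_comp (@measurable_invr R)).
  by apply: measurable_funB; [exact: measurable_cst|exact: measurable_id].
- exact: (bmeas_trunc_inv z d0).1.
move=> t /notN[_ tt]; rewrite trunc_invE //.
by case: tt => ht; [rewrite ger0_norm; lra|rewrite ler0_norm; lra].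
Qed.

Let pickd z z' : lo < z -> z <= z' -> z' < hi -> exists2 delta, 0 < delta &
  (lo <= z - delta /\ z' + delta <= hi).
Proof.
move=> lz zz zh; exists (Num.min (z - lo) (hi - z')).
  by rewrite lt_min; apply/andP; split; lra.
have : Num.min (z - lo) (hi - z') <= z - lo by rewrite ge_min lexx.
have : Num.min (z - lo) (hi - z') <= hi - z' by rewrite ge_min lexx orbT.
by split; lra.
Qed.

Let diffE z z' t : lo < z -> z <= z' -> z' < hi -> ~ N t ->
  (z - t)^-1 - (z' - t)^-1 = (z' - z) / ((z - t) * (z' - t)) /\
  0 < (z - t) * (z' - t).
Proof.
move=> lz zz zh /notN[_ tt]; split.
  have z0 : z - t != 0 by case: tt => ht; apply/eqP; lra.
  have z'0 : z' - t != 0 by case: tt => ht; apply/eqP; lra.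
  by field; rewrite z0 z'0.
by case: tt => ht; nra.
Qed.

Lemma cauchy_tr_decr z z' : lo < z -> z < z' -> z' < hi -> G z' < G z.
Proof.
move=> lz zz zh; have zz' := ltW zz.
have [delta d0 [dl dh]] := pickd lz zz' zh.
rewrite (@cauchy_trE z delta) //; last lra.
rewrite (@cauchy_trE z' delta) //; last lra.
rewrite -subr_gt0 -Rmean_sub; [|exact: bmeas_trunc_inv..].
(* [D] bounds the distances from [z] and [z'] to the support. The difference of the kernels is thus
   at least the positive constant (z' - z) / D^2, which makes the inequality strict. *)
pose D := `|z| + `|z'| + `|A| + `|B| + 1.
have D0 : 0 < D by rewrite ltr_wpDl // !addr_ge0.
apply: (@lt_le_trans _ _ (Rmean mu (fun=> (z' - z) / D ^+ 2))).
  by rewrite Rmean_cst divr_gt0 ?exprn_gt0 // subr_gt0.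
apply: (Rmean_le mN N0); first exact: bmeas_cst.
  by apply: bmeasB; exact: bmeas_trunc_inv.
move=> t nNt; have [tAB tt] := notN nNt.
have d1 : delta <= `|z - t|.
  by case: tt => ht; [rewrite ger0_norm; lra|rewrite ler0_norm; lra].
have d2 : delta <= `|z' - t|.
  by case: tt => ht; [rewrite ger0_norm; lra|rewrite ler0_norm; lra].
rewrite !trunc_invE //; have [-> pos] := diffE lz zz' zh nNt.
rewrite ler_pM2l ?subr_gt0 // lef_pV2 ?posrE ?exprn_gt0 //.
have tle : `|t| <= `|A| + `|B|.
  rewrite ler_norml; have := ler_norm B; have := ler_norm (- A); rewrite normrN.
  have := normr_ge0 A; have := normr_ge0 B; lra.
have zD : `|z - t| <= D.
  apply: le_trans (ler_normB _ _) _; rewrite /D.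
  by have := normr_ge0 z'; lra.
have z'D : `|z' - t| <= D.
  apply: le_trans (ler_normB _ _) _; rewrite /D.
  by have := normr_ge0 z; lra.
rewrite -(gtr0_norm pos) normrM expr2.
by apply: ler_pM.
Qed.

Lemma cauchy_tr_lip z z' delta : 0 < delta ->
  lo + delta <= z -> z <= z' -> z' <= hi - delta ->
  `|G z - G z'| <= (z' - z) / delta ^+ 2.
Proof.
move=> d0 dl zz dh.
have lz : lo < z by lra. have zh : z' < hi by lra.
rewrite (@cauchy_trE z delta); [|lra..].
rewrite (@cauchy_trE z' delta); [|lra..].
rewrite -Rmean_sub; [|exact: bmeas_trunc_inv..].
have key t : ~ N t -> 0 <= trunc_inv z delta t - trunc_inv z' delta t <= (z' - z) / delta ^+ 2.
  move=> nNt; have [tAB tt] := notN nNt.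
  have d1 : delta <= `|z - t|.
    by case: tt => ht; [rewrite ger0_norm; lra|rewrite ler0_norm; lra].
  have d2 : delta <= `|z' - t|.
    by case: tt => ht; [rewrite ger0_norm; lra|rewrite ler0_norm; lra].
  rewrite !trunc_invE //; have [-> pos] := diffE lz zz zh nNt.
  rewrite divr_ge0 ?subr_ge0 ?(ltW pos) //=.
  rewrite ler_wpM2l ?subr_ge0 // lef_pV2 ?posrE ?exprn_gt0 //.
  by rewrite -(gtr0_norm pos) normrM expr2; apply: ler_pM => //; exact: ltW.
have bd : bmeas (fun t => trunc_inv z delta t - trunc_inv z' delta t).
  by apply: bmeasB; exact: bmeas_trunc_inv.
rewrite ger0_norm.
  rewrite -[leRHS](Rmean_cst mu); apply: (Rmean_le mN N0) => //; first exact: bmeas_cst.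
  by move=> t /key/andP[].
rewrite -[leLHS](Rmean_cst mu); apply: (Rmean_le mN N0) => //; first exact: bmeas_cst.
by move=> t /key/andP[].
Qed.

Lemma cauchy_tr_IVT z z' y : lo < z -> z < z' -> z' < hi -> G z' < y < G z ->
  exists2 x, z < x < z' & G x = y.
Proof.
move=> lz zz zh /andP[yz' yz]; have [delta d0 [dl dh]] := pickd lz (ltW zz) zh.
(* [G] is controlled only inside the gap, so the argument is clamped to [[z, z']] to obtain a
   function continuous on the whole line. *)
pose cl x := Num.min (Num.max x z) z'.
have clE x : z <= x <= z' -> cl x = x.
  by move=> /andP[zx xz]; rewrite /cl max_l // min_l.
have clb x : z <= cl x <= z'.
  by rewrite /cl le_min le_max lexx orbT (ltW zz) ge_min lexx orbT.
have cl_le x x' : x <= x' -> cl x <= cl x' /\ cl x' - cl x <= x' - x.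
  by move=> xx; rewrite /cl; split; rewrite /Num.min /Num.max; do ![case: ifP]; lra.
have lip x x' : x <= x' -> `|G (cl x) - G (cl x')| <= (x' - x) / delta ^+ 2.
  move=> xx; have [c1 c2] := cl_le _ _ xx.
  have /andP[h1 h2] := clb x; have /andP[h3 h4] := clb x'.
  apply: (@le_trans _ _ ((cl x' - cl x) / delta ^+ 2)).
    by apply: cauchy_tr_lip => //; lra.
  by rewrite ler_wpM2r // invr_ge0 exprn_ge0 // ltW.
have ct : continuous (fun x => G (cl x)).
  move=> x; apply/cvgrPdist_le => e e0; near=> x'.
  have dist : `|x - x'| <= e * delta ^+ 2.
    near: x'; apply: cvgr_dist_le; first exact: cvg_id.
    by rewrite mulr_gt0 // exprn_gt0.
  have [xx|/ltW xx] := leP x x'.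
    apply: le_trans (lip _ _ xx) _; rewrite ler_pdivrMr ?exprn_gt0 //.
    by move: dist; rewrite distrC ger0_norm // subr_ge0.
  rewrite distrC; apply: le_trans (lip _ _ xx) _; rewrite ler_pdivrMr ?exprn_gt0 //.
  by move: dist; rewrite ger0_norm // subr_ge0.
have [|||x] := @IVT R (fun x => G (cl x)) z z' y.
- exact: ltW.
- exact: continuous_subspaceT.
- by rewrite !clE ?lexx ?(ltW zz) // ge_min le_max (ltW yz) (ltW yz') ?orbT.
rewrite in_itv /= => xzz; rewrite clE // => Gx; exists x => //.
move: xzz => /andP[]; rewrite !le_eqVlt => /predU1P[zx|->].
  by move: yz; rewrite zx Gx ltxx.
move=> /predU1P[zx|->//].
by move: yz'; rewrite -zx Gx ltxx.
Unshelve. all: by end_near. Qed.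

Lemma right_limE : right_lim G lo = ereal_sup ((fun z => (G z)%:E) @` `]lo, hi[%classic).
Proof.
apply: cvg_lim => //.
apply: (@nonincreasing_at_right_cvge _ (fun z => (G z)%:E) lo (BLeft hi)).
  by rewrite bnd_simp.
move=> x y; rewrite !in_itv /= => /andP[lx _] /andP[_ yh].
rewrite le_eqVlt => /predU1P[->//|xy].
by rewrite lee_fin ltW // cauchy_tr_decr.
Qed.

Lemma right_lim_gt z : lo < z < hi -> ((G z)%:E < right_lim G lo)%E.
Proof.
move=> /andP[lz zh]; rewrite right_limE.
apply: (@lt_le_trans _ _ (G ((lo + z) / 2))%:E).
  by rewrite lte_fin cauchy_tr_decr //; lra.
by apply: ereal_sup_ubound; exists ((lo + z) / 2) => //=; rewrite in_itv /=; apply/andP; split; lra.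
Qed.

Lemma right_lim_exists y : (y%:E < right_lim G lo)%E -> exists2 z, lo < z < hi & y < G z.
Proof.
rewrite right_limE => /ereal_sup_gt[_ [z /= + <-]].
by rewrite in_itv /= lte_fin => zg yz; exists z.
Qed.

(** The reflection z -> -z turns the left limit into the right limit of a nondecreasing function. *)
Lemma left_limE : left_lim G hi = ereal_inf ((fun z => (G z)%:E) @` `]lo, hi[%classic).
Proof.
apply: cvg_lim => //; apply/cvg_at_leftNP.
have -> : (fun z => (G z)%:E) @` `]lo, hi[%classic =
    (fun z => (G (- z))%:E) @` [set` Interval (BRight (- hi)) (BLeft (- lo))].
  apply/seteqP; split=> _ [z /= zg <-]; exists (- z) => //=; rewrite ?opprK //.
    by move: zg; rewrite !in_itv /= ltrN2 ltrN2 andbC.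
  by move: zg; rewrite !in_itv /= ltrNl ltrNr andbC.
apply: (@nondecreasing_at_right_cvge _ (fun z => (G (- z))%:E) (- hi) (BLeft (- lo))).
  by rewrite bnd_simp ltrN2.
move=> x y; rewrite !in_itv /= => /andP[hx xl] /andP[hy yl].
rewrite le_eqVlt => /predU1P[->//|xy].
by rewrite lee_fin ltW // cauchy_tr_decr //; lra.
Qed.

Lemma left_lim_lt z : lo < z < hi -> (left_lim G hi < (G z)%:E)%E.
Proof.
move=> /andP[lz zh]; rewrite left_limE.
apply: (@le_lt_trans _ _ (G ((hi + z) / 2))%:E).
  by apply: ereal_inf_lbound; exists ((hi + z) / 2) => //=; rewrite in_itv /=; apply/andP; split; lra.
by rewrite lte_fin cauchy_tr_decr //; lra.
Qed.

Lemma left_lim_exists y : (left_lim G hi < y%:E)%E -> exists2 z, lo < z < hi & G z < y.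
Proof.
rewrite left_limE => /ereal_inf_lt[_ [z /= + <-]].
by rewrite in_itv /= lte_fin => zg yz; exists z.
Qed.

End Cauchy.

(** * The unbounded gap above the support *)

Section CauchyInfinity.
Variables (R : realType) (mu : probability R R) (A B : R).
Hypothesis muAB : mu (~` `[A, B]%classic) = 0%E.
Local Notation G := (cauchy_tr mu).

(** Bounded windows to the right of the support carry no mass; through them the unbounded gap comes
    under the results for []lo, hi[]. *)
Lemma gap_right hi : mu `]B, hi[%classic = 0%E.
Proof.
apply/eqP; rewrite -measure_le0 -muAB; apply: le_measure; rewrite ?inE //.
  exact: measurableC.
move=> t /=; rewrite in_itv /= => /andP[Bt _]; rewrite in_itv /= => /andP[_].
by rewrite leNgt Bt.
Qed.

Lemma cauchy_tr_bounds z : B < z -> 0 <= G z <= (z - B)^-1.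
Proof.
move=> Bz; have d0 : 0 < z - B by rewrite subr_gt0.
have mN : measurable (~` `[A, B]%classic) by exact: measurableC.
(* The window is given the right end [z + (z - B)] so that the margin [z - B] fits on both sides of
   [z]. *)
rewrite (@cauchy_trE _ mu A B B (z + (z - B)) muAB (gap_right _) z (z - B)) //; [|lra..].
have key t : ~ (~` `[A, B]%classic) t -> 0 <= trunc_inv z (z - B) t <= (z - B)^-1.
  move=> /contrapT; rewrite /= in_itv /= => /andP[_ tB].
  have zt : 0 < z - t by lra.
  rewrite trunc_invE //; last by rewrite ger0_norm; lra.
  by rewrite invr_ge0 (ltW zt) /= lef_pV2 ?posrE //; lra.
have bt := bmeas_trunc_inv z d0.
apply/andP; split.
  rewrite -[leLHS](Rmean_cst mu); apply: (Rmean_le mN muAB) => //; first exact: bmeas_cst.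
  by move=> t /key/andP[].
rewrite -[leRHS](Rmean_cst mu); apply: (Rmean_le mN muAB) => //; first exact: bmeas_cst.
by move=> t /key/andP[].
Qed.

Lemma cauchy_tr_small y : 0 < y -> exists2 z, B < z & G z < y.
Proof.
move=> y0; exists (B + 2 / y); first by rewrite ltrDl divr_gt0.
have Bz : B < B + 2 / y by rewrite ltrDl divr_gt0.
have /andP[_ h] := cauchy_tr_bounds Bz; apply: le_lt_trans h _.
by rewrite addrAC subrr add0r invf_div ltr_pdivrMr // ltr_pMr // ltr1n.
Qed.

Lemma lim_pinfty_cauchy_tr : lim_pinfty G = 0%E.
Proof.
apply: cvg_lim => //; apply: cvg_EFin; first by near=> z.
apply/cvgrPdist_le => e e0; near=> z.
have Bz : B + e^-1 < z by near: z; apply: nbhs_pinfty_gt; exact: num_real.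
have Bz' : B < z by apply: lt_trans Bz; rewrite ltrDl invr_gt0.
have /andP[h1 h2] := cauchy_tr_bounds Bz'.
rewrite sub0r normrN ger0_norm //=; apply: le_trans h2 _.
rewrite -[leRHS]invrK lef_pV2 ?posrE ?invr_gt0 ?subr_gt0 //.
by rewrite lerBrDr addrC ltW.
Unshelve. all: by end_near. Qed.

End CauchyInfinity.

(** * Outlying eigenvalues *)

Section ResolventSpectrum.
Local Open Scope complex_scope.
Variable R : realType.
Local Notation C := R[i].

Lemma frob_conj n (g B : 'M[C]_n) : g *m g^t* = 1%:M ->
  frob (g *m B *m g^t*) = frob B.
Proof.
move=> gg; apply: complexI; rewrite !frobE.
rewrite !trmxC_mul trmxCK !mulmxA -(mulmxA _ _ g) (mulmx1C gg) mulmx1.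
by rewrite mxtrace_mulC !mulmxA (mulmx1C gg) mul1mx.
Qed.

Lemma frob_rdiag n (d : 'I_n -> R) : frob (rdiag d) = \sum_i d i ^+ 2.
Proof.
apply: eq_bigr => i _; rewrite (bigD1 i) //= big1 ?addr0.
  by rewrite !mxE eqxx mulr1n /= expr0n addr0.
by move=> j ji; rewrite !mxE eq_sym (negbTE ji) mulr0n /= expr0n addr0.
Qed.

(** Diagonalisation turns traces into sums over eigenvalues. This discharges the truncation in [bad]
    with [M] equal to delta^-2, and shows the centring term to be a linear statistic of a bounded
    continuous function. *)
Lemma resolv_spectrum n (X : 'M[C]_n) z delta : X^t* = X -> 0 < delta ->
  (forall k, (k < n)%N -> delta <= `|z - eig k.+1 X|) ->
  [/\ z%:C%:M - X \in unitmx,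
      \tr (resolv z X) = (\sum_(1 <= k < n.+1) trunc_inv z delta (eig k X))%:C &
      frob (resolv z X) <= n%:R * delta ^- 2].
Proof.
move=> XH d0 sep; have [V uV XE] := hermitian_spectral XH.
pose lam (k : 'I_n) := eig k.+1 X.
have gg : V^t* *m (V^t*)^t* = 1%:M.
  by rewrite trmxCK -(invmx_unitary uV) mulVmx // unitarymx_unit.
have XE' : X = V^t* *m rdiag lam *m (V^t*)^t* by rewrite trmxCK.
have zl k : z - lam k != 0.
  by rewrite -normr_gt0; apply: lt_le_trans d0 (sep k (ltn_ord k)).
have E : z%:C%:M - rdiag lam = rdiag (fun k => z - lam k).
  apply/matrixP => i j; rewrite [LHS]mxE [X in _ + X]mxE [_%:M _ _]mxE [X in _ - X]mxE [RHS]mxE !mxE.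
  by rewrite rmorphB mulrnBl.
have EV : rdiag (fun k => z - lam k) *m rdiag (fun k => (z - lam k)^-1) = 1%:M.
  rewrite /rdiag mulmx_diag -diag_const_mx; congr diag_mx; apply/rowP => i.
  by rewrite !mxE -rmorphM divff.
have uD : z%:C%:M - rdiag lam \in unitmx by rewrite E; case/mulmx1_unit: EV.
have RD : resolv z (rdiag lam) = rdiag (fun k => (z - lam k)^-1).
  by rewrite /resolv -[LHS]mulmx1 E -EV mulKmx // -E.
have [uE rE] := resolv_conj z (rdiag lam) gg.
rewrite -XE' in uE rE; have RX := rE uD; rewrite RD in RX.
split; first by rewrite uE.
  rewrite RX mxtrace_mulC mulmxA (mulmx1C gg) mul1mx.
  rewrite big_add1 /= big_mkord rmorph_sum; apply: eq_bigr => k _.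
  by rewrite !mxE eqxx mulr1n trunc_invE //; exact: sep.
rewrite RX frob_conj // frob_rdiag.
apply: (@le_trans _ _ (\sum_(k < n) delta ^- 2)).
  apply: ler_sum => k _; rewrite -[leLHS]real_normK ?num_real // normfV -exprVn.
  by rewrite lerXn2r ?nnegrE ?invr_ge0 ?(ltW d0) // lef_pV2 ?posrE ?normr_gt0 // sep.
by rewrite sumr_const card_ord mulr_natl.
Qed.

(** Weyl's inequalities as counts. The lower bound holds because [Q] is a nonnegative form. For the
    upper one, a negative subspace of [z - (X + Q)] loses at most [r] dimensions when restricted to
    the vectors orthogonal to the rows of [U], where [Q] vanishes. *)
Lemma neig_low_rank n r (X : 'M[C]_n) (U : 'M[C]_(r, n)) (theta : 'I_r -> R) z :
  X^t* = X -> (forall k, 0 < theta k) ->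
  (neig z X <= neig z (X + U^t* *m rdiag theta *m U) <= neig z X + r)%N.
Proof.
move=> XH tpos; set Q := U^t* *m rdiag theta *m U.
have QH : Q^t* = Q by rewrite !trmxC_mul trmxCK rdiag_herm mulmxA.
have XQH : (X + Q)^t* = X + Q by rewrite trmxCD XH QH.
have Qge0 x : 0 <= qform Q x.
  rewrite /Q -{2}[U]trmxCK -qform_mul qform_diag sumr_ge0 // => i _.
  by rewrite mulr_ge0 ?exprn_ge0 // mxE ler0c ltW.
have nX := neig_index z XH; have nXQ := neig_index z XQH.
have HE x : qform (z%:C%:M - X) x = qform (z%:C%:M - (X + Q)) x + qform Q x.
  by rewrite -qformD opprD addrA subrK.
apply/andP; split.
  by apply: neg_index_le nXQ nX => y; rewrite HE lerDl.
have [mn [E nE] _] := nXQ; have [kn _ pX] := nX.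
set m := neig z (X + Q) in mn E nE *.
pose M := kermx (E *m U^t*).
have nd : negdim (z%:C%:M - X) (\rank M).
  exists (row_base M *m E) => y y0; rewrite mulmxA HE.
  have yM : y *m row_base M != 0.
    apply: contraNneq y0 => yM0; have := row_base_free M => /row_freeP[W MW].
    by rewrite -[y]mulmx1 -MW mulmxA yM0 mul0mx.
  have -> : qform Q (y *m row_base M *m E) = 0.
    rewrite /Q -{2}[U]trmxCK -qform_mul.
    have -> : y *m row_base M *m E *m U^t* = 0.
      rewrite -mulmxA; apply/sub_kermxP.
      by rewrite (submx_trans (submxMl _ _)) // eq_row_base.
    by rewrite /qform !mul0mx mxE.
  by rewrite addr0 nE.
have := negdim_nonnegdim nd pX; rewrite /M mxrank_ker.
have := rank_leq_col (E *m U^t*); move: (\rank _) => rk; lia.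
Qed.

End ResolventSpectrum.

Lemma quarter_half (R : realFieldType) (x y : R) : 0 < x ->
  x * (2 * (y / (4 * x))) = y / 2.
Proof. by move=> x0; field; rewrite gt_eqF. Qed.

(** * Counting eigenvalues above one point of a gap *)

Section AtPoint.
Local Open Scope complex_scope.
Variables (R : realType) (cplx : bool).
Variables (d : measure_display) (T : measurableType d) (P : probability T R).
Local Notation C := R[i].
Variable X : forall n : nat, T -> 'M[C]_n.
Hypothesis Xset : forall n w, setting_mx cplx (X n w).
Hypothesis Xmeas : forall n (B : set 'M[C]_n), mx_borel B -> measurable (X n @^-1` B).
Hypothesis Xinv : forall n (U : 'M[C]_n), setting_group cplx U ->
  forall B : set 'M[C]_n, mx_borel B ->
       P (X n @^-1` B) = P ((fun w => U *m X n w *m ctr U) @^-1` B).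
Variables (r : nat) (theta : nat -> R) (U : forall n, 'M[C]_(r, n)).
Hypothesis Ule : forall n k, \sum_i `|U n k i| ^+ 2 <= 1.
Hypothesis UU : forall n, (r <= n)%N -> U n *m (U n)^t* = 1%:M.
Hypothesis tpos : forall k, (1 <= k <= r)%N -> 0 < theta k.
Hypothesis tdec : forall k l, (1 <= k)%N -> (k <= l)%N -> (l <= r)%N -> theta l <= theta k.
Let th (k : 'I_r) := theta k.+1.
Let Xt n w := X n w + (U n)^t* *m rdiag th *m U n.
Variables (z delta g : R) (i : nat).
Hypothesis d0 : 0 < delta.
Hypothesis ir : (1 <= i <= r)%N.
Hypothesis sep : {ae P, forall w, \forall n \near \oo,
  forall k, (k < n)%N -> delta <= `|z - eig k.+1 (X n w)|}.
Hypothesis trcv : {ae P, forall w,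
  (fun n : nat => n%:R^-1 * \sum_(1 <= k < n.+1) trunc_inv z delta (eig k (X n w))) @ \oo --> g}.

Let thpos k : 0 < th k.
Proof. by apply: tpos; rewrite /= ltn_ord. Qed.

(** One [eta] comes from the concentration of the centred form, the other from the convergence of
    the normalised trace to [g]. *)
Lemma overlap_conc eta : 0 < eta -> {ae P, forall w, \forall n \near \oo,
  z%:C%:M - X n w \in unitmx /\ forall k l,
  `|(U n *m invmx (z%:C%:M - X n w) *m (U n)^t*) k l - g%:C *+ (k == l)| <= (2 * eta)%:C}.
Proof.
move=> eta0.
have conc := sform_conc Xset Xmeas Xinv z (delta ^- 2) Ule eta0.
apply: filterS2 (filterI sep trcv) conc => w [wsep wtr] wconc.
have wtr' : \forall n \near \oo, `|g - n%:R^-1 * \sum_(1 <= k < n.+1) trunc_inv z delta (eig k (X n w))| <= eta.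
  by move/cvgrPdist_le : wtr => /(_ _ eta0).
have rn : \forall n \near \oo, (r <= n)%N by exact: nbhs_infty_ge.
apply: filterS2 (filterI wsep wtr') (filterI wconc rn) => n [nsep ntr] [nconc nr].
have [uz trE Fr] := resolv_spectrum (setting_herm (Xset n w)) d0 nsep.
split=> // k l.
have := nconc uz Fr k l; rewrite -/(resolv z (X n w)).
rewrite /centred mulmxBr mulmxBl mul_mx_scalar -scalemxAl (UU nr) scalemx1 trE.
set S := \sum_(1 <= k < n.+1) _ in ntr *.
rewrite mxE [X in _ + X]mxE [X in _ - X]mxE => h.
set Kkl := (U n *m _ *m _) k l in h *.
have SE : S%:C / n%:R = (n%:R^-1 * S)%:C by rewrite rmorphM fmorphV rmorph_nat mulrC.
rewrite SE in h.
have -> : Kkl - g%:C *+ (k == l) = (Kkl - (n%:R^-1 * S)%:C *+ (k == l)) +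
   ((n%:R^-1 * S)%:C - g%:C) *+ (k == l).
  by rewrite mulrnBl addrA subrK.
apply: le_trans (ler_normD _ _) _; rewrite mulr_natl mulr2n rmorphD; apply: lerD => //.
rewrite normrMn -rmorphB; apply: (@le_trans _ _ `|(n%:R^-1 * S - g)%:C|).
  by case: (k == l); rewrite ?mulr1n ?mulr0n.
rewrite normc_def /= expr0n addr0 sqrtr_sqr lecR distrC.
exact: ntr.
Qed.

Lemma neig_at_point_ge : (theta i)^-1 < g ->
  {ae P, forall w, \forall n \near \oo, (neig z (X n w) + i <= neig z (Xt n w))%N}.
Proof.
move=> tg; have r0 : 0 < r%:R :> R by rewrite ltr0n; lia.
(* Chosen so that the total error [r * (2 * eta)] is half of the distance between [g] and
   1/theta_i. *)
pose eta := (g - (theta i)^-1) / (4 * r%:R).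
have eta0 : 0 < eta by rewrite divr_gt0 ?subr_gt0 ?mulr_gt0.
have reta : r%:R * (2 * eta) = (g - (theta i)^-1) / 2.
  exact: quarter_half.
apply: filterS (overlap_conc eta0) => w; apply: filterS => n [uz Kg].
apply: (neig_perturb_ge (setting_herm (Xset n w)) uz thpos Kg); first lia.
move=> k ki; rewrite reta.
have : (th k)^-1 <= (theta i)^-1.
  rewrite lef_pV2 ?posrE ?thpos ?tpos //; apply: tdec => //; lia.
by lra.
Qed.

Lemma neig_at_point_le : g < (theta i)^-1 ->
  {ae P, forall w, \forall n \near \oo, (neig z (Xt n w) < neig z (X n w) + i)%N}.
Proof.
move=> tg; have r0 : 0 < r%:R :> R by rewrite ltr0n; lia.
pose eta := ((theta i)^-1 - g) / (4 * r%:R).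
have eta0 : 0 < eta by rewrite divr_gt0 ?subr_gt0 ?mulr_gt0.
have reta : r%:R * (2 * eta) = ((theta i)^-1 - g) / 2.
  exact: quarter_half.
apply: filterS (overlap_conc eta0) => w; apply: filterS => n [uz Kg].
(* [th] is indexed from 0, so [theta i] is its entry [i.-1]; the inverses of the entries from there
   on exceed [g] by more than the error. *)
have -> : i = i.-1.+1 by lia.
rewrite addnS ltnS.
apply: (neig_perturb_le (setting_herm (Xset n w)) uz thpos Kg) => k ki; rewrite reta.
have : (theta i)^-1 <= (th k)^-1.
  rewrite lef_pV2 ?posrE ?thpos ?tpos //; apply: tdec; rewrite ?ltn_ord //; lia.
by lra.
Qed.

End AtPoint.

(** * The limit measure and its gaps *)

Section LimitMeasure.
Variables (R : realType) (ell : nat) (p a b : nat -> R).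
Variables (mu : nat -> probability R R) (muX : probability R R).
Hypothesis ppos : forall j, (1 <= j <= ell)%N -> 0 < p j.
Hypothesis ab : forall j, (1 <= j <= ell)%N -> a j < b j.
Hypothesis ba : forall j, (2 <= j <= ell)%N -> b j < a j.-1.
Hypothesis musupp : forall j, (1 <= j <= ell)%N -> mu j (~` `[a j, b j]%classic) = 0%E.
Hypothesis mupos : forall j, (1 <= j <= ell)%N -> forall x y, a j <= x -> x < y -> y <= b j ->
     (0 < mu j `]x, y[%classic)%E.
Hypothesis muXE : forall A : set R, measurable A ->
     muX A = (\sum_(1 <= j < ell.+1) (p j)%:E * mu j A)%E.

Lemma band_order i k : (1 <= i)%N -> (i + k <= ell)%N ->
  a (i + k)%N <= a i /\ b (i + k)%N <= b i.
Proof.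
move=> i1; elim: k => [|k IH] ik; first by rewrite addn0.
have [h1 h2] : a (i + k)%N <= a i /\ b (i + k)%N <= b i by apply: IH; lia.
have e1 : b (i + k.+1)%N < a (i + k)%N.
  by have := @ba (i + k.+1)%N; rewrite addnS; apply; lia.
have e2 : a (i + k.+1)%N < b (i + k.+1)%N by apply: ab; lia.
have e3 : a (i + k)%N < b (i + k)%N by apply: ab; lia.
by split; lra.
Qed.

Lemma band_orderP i j : (1 <= i)%N -> (i <= j)%N -> (j <= ell)%N ->
  a j <= a i /\ b j <= b i.
Proof. by move=> i1 ij je; have := @band_order i (j - i) i1; rewrite subnKC //; apply. Qed.

Lemma muX_null (A : set R) : measurable A ->
  (forall m, (1 <= m <= ell)%N -> A `<=` ~` `[a m, b m]%classic) -> muX A = 0%E.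
Proof.
move=> mA h; rewrite muXE // big_nat_cond big1 // => m /andP[/andP[m1 me] _].
have mm : (1 <= m <= ell)%N by lia.
suff -> : mu m A = 0%E by rewrite mule0.
apply/eqP; rewrite -measure_le0 -(musupp mm); apply: le_measure (h m mm); rewrite ?inE //.
exact: measurableC.
Qed.

Lemma muX_supp : muX (~` `[a ell, b 1%N]%classic) = 0%E.
Proof.
apply: muX_null => [|m mm]; first exact: measurableC.
have [h1 _] : a ell <= a m /\ b ell <= b m by apply: band_orderP; lia.
have [_ h2] : a m <= a 1%N /\ b m <= b 1%N by apply: band_orderP; lia.
move=> t /= nt tm; apply: nt; move: tm; rewrite !in_itv /= => /andP[? ?].
by apply/andP; split; lra.
Qed.

Lemma muX_gap j : (2 <= j <= ell)%N -> muX `]b j, a j.-1[%classic = 0%E.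
Proof.
move=> je; apply: muX_null => // m mm t /=; rewrite !in_itv /= => /andP[bt ta] /andP[amt tbm].
have [mj|jm] := leqP m j.-1.
  have [h _] : a j.-1 <= a m /\ b j.-1 <= b m by apply: band_orderP; lia.
  lra.
have [_ h] : a m <= a j /\ b m <= b j by apply: band_orderP; lia.
lra.
Qed.

Lemma muX_pos j x y : (1 <= j <= ell)%N -> a j <= x -> x < y -> y <= b j ->
  (0 < muX `]x, y[%classic)%E.
Proof.
move=> je ax xy yb; rewrite muXE //.
have h := mupos je ax xy yb.
rewrite (bigD1_seq j) /= ?iota_uniq //; last by rewrite mem_index_iota; lia.
apply: (@lt_le_trans _ _ ((p j)%:E * mu j `]x, y[%classic)%E).
  by rewrite mule_gt0 // lte_fin ppos.
rewrite leeDl // big_nat_cond; apply: sume_ge0 => m /andP[/andP[m1 me] _].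
by rewrite mule_ge0 // lee_fin ltW // ppos //; lia.
Qed.

Variable j : nat.
Hypothesis je : (1 <= j <= ell)%N.
Let G := cauchy_tr muX.
Let Gb := right_lim G (b j).
Let Ga := if j == 1%N then lim_pinfty G else left_lim G (a j.-1).
Let hi := if j == 1%N then +oo%E else (a j.-1)%:E.

Definition in_gap z := ((b j)%:E < z%:E < hi)%E.

Lemma in_gapP z : in_gap z <-> b j < z /\ (j = 1%N \/ (2 <= j)%N /\ z < a j.-1).
Proof.
rewrite /in_gap /hi lte_fin; split.
  move=> /andP[-> ]; have [j1|j1] := eqVneq j 1%N; first by split=> //; left.
  by rewrite lte_fin => za; split=> //; right; split => //; lia.
move=> [-> [->|[j2 za]]]; first by rewrite eqxx ltry.
by rewrite gtn_eqF // lte_fin.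
Qed.

(** For [j = 1] the gap is unbounded; a bounded massless window around [z] lets the results on []lo,
    hi[] apply to all [j] alike. *)
Lemma gap_window z : in_gap z -> exists hi', [/\ z < hi', b j < hi',
  muX `]b j, hi'[%classic = 0%E & forall x, b j < x -> x < hi' -> in_gap x].
Proof.
move=> /in_gapP[bz [j1|[j2 za]]].
  exists (z + 1); split; [lra|lra| |].
    by rewrite j1; apply: gap_right muX_supp _.
  by move=> x bx _; apply/in_gapP; split=> //; left.
exists (a j.-1); split=> //; [lra| |].
  by apply: muX_gap; lia.
by move=> x bx xa; apply/in_gapP; split=> //; right.
Qed.

Lemma gap_decr z z' : in_gap z -> in_gap z' -> z < z' -> G z' < G z.
Proof.
move=> /in_gapP[bz _] gz' zz'; have [h [zh bh m0 _]] := gap_window gz'.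
exact: (cauchy_tr_decr muX_supp m0).
Qed.

Lemma gap_nonempty : exists z, in_gap z.
Proof.
have [j1|j1] := eqVneq j 1%N.
  by exists (b j + 1); apply/in_gapP; split; [lra|left].
have bj : b j < a j.-1 by apply: ba; lia.
exists ((b j + a j.-1) / 2); apply/in_gapP; split; first lra.
by right; split; [lia|lra].
Qed.

Lemma gap_lt_Gb z : in_gap z -> ((G z)%:E < Gb)%E.
Proof.
move=> gz; have [h [zh bh m0 _]] := gap_window gz.
apply: (right_lim_gt muX_supp m0 bh); rewrite zh andbT.
by move/in_gapP: gz => [].
Qed.

Lemma gap_Gb_exists y : (y%:E < Gb)%E -> exists2 z, in_gap z & y < G z.
Proof.
move=> yG; have [z0 gz0] := gap_nonempty; have [h [zh bh m0 hg]] := gap_window gz0.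
have [z /andP[bz zh'] yz] := right_lim_exists muX_supp m0 bh yG.
by exists z => //; exact: hg.
Qed.

Lemma gap_gt_Ga z : in_gap z -> (Ga < (G z)%:E)%E.
Proof.
move=> gz; rewrite /Ga; have [j1|j1] := eqVneq j 1%N.
  move: (gz) => /in_gapP[bz _].
  rewrite (lim_pinfty_cauchy_tr muX_supp) lte_fin.
  (* Strict positivity of [G z] comes from [0 <= G (z + 1)] and strict decrease. *)
  have gz1 : in_gap (z + 1) by apply/in_gapP; split; [lra|left].
  have zz1 : z < z + 1 by lra.
  apply: le_lt_trans (gap_decr gz gz1 zz1).
  have bz1 : b 1%N < z + 1 by rewrite -j1; lra.
  by have /andP[] := cauchy_tr_bounds muX_supp bz1.
move: gz => /in_gapP[bz [//|[j2 za]]]; first by move/eqP: j1.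
have mg : muX `]b j, a j.-1[%classic = 0%E by apply: muX_gap; lia.
have bj : b j < a j.-1 by apply: ba; lia.
by apply: (left_lim_lt muX_supp mg bj); rewrite bz za.
Qed.

Lemma gap_Ga_exists y : 0 < y -> (Ga < y%:E)%E -> exists2 z, in_gap z & G z < y.
Proof.
move=> y0; rewrite /Ga; have [j1 _|j1 Gy] := eqVneq j 1%N.
  have [z bz zy] := cauchy_tr_small muX_supp y0.
  by exists z => //; apply/in_gapP; split; [rewrite j1|left].
have j2 : (2 <= j)%N by lia.
have mg : muX `]b j, a j.-1[%classic = 0%E by apply: muX_gap; lia.
have bj : b j < a j.-1 by apply: ba; lia.
have [z /andP[bz za] zy] := left_lim_exists muX_supp mg bj Gy.
by exists z => //; apply/in_gapP; split => //; right.
Qed.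

Lemma gap_value_exists y : 0 < y -> (Ga < y%:E < Gb)%E -> exists2 x, in_gap x & G x = y.
Proof.
move=> y0 /andP[/(gap_Ga_exists y0)[z' gz' z'y] /gap_Gb_exists[z gz zy]].
have zz' : z < z'.
  rewrite ltNge le_eqVlt; apply/negP => /predU1P[z'z|].
    by move: z'y zy; rewrite z'z; lra.
  by move=> /(gap_decr gz' gz); lra.
have [h [zh bh m0 hg]] := gap_window gz'.
have bz : b j < z by move/in_gapP: gz => [].
have [|x /andP[zx xz'] Gx] := cauchy_tr_IVT muX_supp m0 bz zz' zh (y := y).
  by rewrite z'y zy.
by exists x => //; apply: hg; lra.
Qed.

Lemma gap_margin z : in_gap z -> exists2 delta, 0 < delta &
  [/\ b j < z - delta, (2 <= j)%N -> z + delta < a j.-1 & G z = Rmean muX (trunc_inv z delta)].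
Proof.
move=> gz; have [h [zh bh m0 hg]] := gap_window gz.
have bz : b j < z by move/in_gapP: gz => [].
(* Half of the distance to the ends of the window keeps [z - delta] and [z + delta] strictly
   inside. *)
pose delta := Num.min (z - b j) (h - z) / 2.
have m1 : Num.min (z - b j) (h - z) <= z - b j by rewrite ge_min lexx.
have m2 : Num.min (z - b j) (h - z) <= h - z by rewrite ge_min lexx orbT.
have m3 : 0 < Num.min (z - b j) (h - z) by rewrite lt_min; apply/andP; split; lra.
exists delta; first by rewrite /delta; lra.
split; first by rewrite /delta; lra.
  move=> j2; have : in_gap (z + delta) by apply: hg; rewrite /delta; lra.
  by move=> /in_gapP[_ [j1|[]//]]; lia.
by apply: (cauchy_trE muX_supp m0); rewrite /delta; lra.
Qed.

End LimitMeasure.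

(** * Ranks attached to the cumulated masses *)

Section CeilIndex.
Variable R : realType.
Implicit Types c : R.

Lemma ceil_index_itv n c : 0 <= c ->
  n%:R * c <= (`|Num.ceil (n%:R * c)|%N)%:R < n%:R * c + 1.
Proof.
move=> c0; have nc : 0 <= n%:R * c by rewrite mulr_ge0.
have /andP[h1 h2] := ceil_itv (n%:R * c).
rewrite natr_absz ger0_norm; last by rewrite ceil_ge0; lra.
by rewrite h2 /= -ltrBlDr; move: h1; rewrite rmorphB.
Qed.

(** As [c < 1], the rank eventually stays below [n] by any fixed margin; beyond [n], [eig] would
    return the default 0. *)
Lemma ceil_index_room c m : 0 <= c -> c < 1 ->
  \forall n \near \oo, (`|Num.ceil (n%:R * c)| + m <= n)%N.
Proof.
move=> c0 c1; apply: filterS (nbhs_infty_ger ((1 + m%:R) / (1 - c))) => n.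
rewrite ler_pdivrMr ?subr_gt0 // => nm.
have /andP[_ h] := ceil_index_itv n c0.
rewrite -(ler_nat R) natrD ltW //; move: nm h; set k := _%:R; lra.
Qed.

End CeilIndex.

(** * Positive mass forces many eigenvalues *)

Section Bump.
Variable R : realType.

(** A continuous minorant of the indicator of []x, y[], because weak convergence is tested on
    continuous functions only. *)
Definition bump (x y t : R) : R := Num.max 0 (Num.min 1 (Num.min (t - x) (y - t))).

Lemma bump_continuous x y : continuous (bump x y).
Proof.
move=> t; apply: (@continuous_max _ _ (fun=> 0) (fun t => Num.min 1 (Num.min (t - x) (y - t)))).
  exact: cvg_cst.
apply: (@continuous_min _ _ (fun=> 1) (fun t => Num.min (t - x) (y - t))).
  exact: cvg_cst.
apply: (@continuous_min _ _ (fun t => t - x) (fun t => y - t)).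
  by apply: cvgB; [exact: cvg_id|exact: cvg_cst].
by apply: cvgB; [exact: cvg_cst|exact: cvg_id].
Qed.

Lemma bump_le x y t : 0 <= bump x y t <= ((x < t < y)%R : bool)%:R.
Proof.
rewrite /bump le_max lexx /= ge_max ler0n /= !ge_min.
case: (ltP x t) => xt; case: (ltP t y) => ty /=; rewrite ?mulr1n ?mulr0n ?lexx //;
  by rewrite !subr_le0 ?xt ?ty ?orbT.
Qed.

Lemma bmeas_bump x y : bmeas (bump x y).
Proof.
split; first by apply: continuous_measurable_fun; exact: bump_continuous.
exists 1 => t; have /andP[h1 h2] := bump_le x y t.
by rewrite ger0_norm //; apply: le_trans h2 _; case: (_ && _).
Qed.

Lemma bump_ge x y x' y' t : x' < t < y' ->
  Num.min 1 (Num.min (x' - x) (y - y')) <= bump x y t.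
Proof.
move=> /andP[h1 h2]; rewrite /bump le_max; apply/orP; right.
by rewrite !le_min !ge_min lexx /=; apply/andP; split; apply/orP; right; apply/orP; [left|right]; lra.
Qed.

Lemma Rmean_bump_gt0 (mu : probability R R) x y x' y' : x < x' -> y' < y ->
  (0 < mu `]x', y'[%classic)%E -> 0 < Rmean mu (bump x y).
Proof.
move=> xx yy mpos; set S := `]x', y'[%classic in mpos.
have mS : measurable S by exact: measurable_itv.
pose c := Num.min 1 (Num.min (x' - x) (y - y')).
have c0 : 0 < c by rewrite !lt_min ltr01 !subr_gt0 xx.
pose g t := c * \1_S t : R.
have mg : measurable_fun setT g.
  by apply: measurable_funM; [exact: measurable_cst|exact: measurable_indic].
have bg : bmeas g.
  split=> //; exists c => t; rewrite /g indicE.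
  by case: (_ \in _); rewrite ?mulr1 ?mulr0 ?normr0 ?(ltW c0) // gtr0_norm.
have Ig : 0 < Rmean mu g.
  have -> : Rmean mu g = fine (c%:E * mu S).
    have mi : measurable_fun setT (fun t : R => (\1_S t)%:E : \bar R).
      by apply/measurable_EFinP; exact: measurable_indic.
    have i0 (t : R) : setT t -> (0 <= (\1_S t)%:E :> \bar R)%E by rewrite lee_fin.
    rewrite /Rmean; congr fine; rewrite -[X in mu X]setIT -integral_indic //.
    transitivity (\int[mu]_t (c%:E * (\1_S t)%:E))%E; first by apply: eq_integral.
    apply: ge0_integralZl_EFin => //; exact: ltW.
  have fS : mu S \is a fin_num by exact: fin_num_measure.
  by rewrite fineM // mulr_gt0 // fine_gt0 // mpos /= ltey_eq fS.
apply: lt_le_trans Ig _.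
apply: (Rmean_le measurable0 (measure0 mu) bg (bmeas_bump x y)).
move=> t _; rewrite /g indicE; case: (boolP (t \in S)) => [/set_mem|_].
  by rewrite /S /= in_itv /= mulr1 => h; exact: bump_ge h.
by rewrite mulr0; have /andP[] := bump_le x y t.
Qed.

End Bump.

Lemma count_add_le (T : Type) (p1 p2 p3 : pred T) (s : seq T) :
  (forall x, (p1 x + p2 x <= p3 x)%N) -> (count p1 s + count p2 s <= count p3 s)%N.
Proof.
move=> h; elim: s => //= x s IH; rewrite addnACA leq_add //.
Qed.

Section Counts.
Local Open Scope complex_scope.
Variables (R : realType).
Local Notation C := R[i].
Variables (muX : probability R R) (Y : forall n, 'M[C]_n).
Hypothesis YH : forall n, (Y n)^t* = Y n.
Hypothesis wc : forall f : R -> R, continuous f -> (exists M, forall x, `|f x| <= M) ->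
  (fun n : nat => n%:R^-1 * \sum_(1 <= k < n.+1) f (eig k (Y n))) @ \oo --> Rmean muX f.

Lemma sum_eig n (f : R -> R) :
  \sum_(1 <= k < n.+1) f (eig k (Y n)) = \sum_(l <- eigseq (Y n)) f l.
Proof.
rewrite eigseqE // big_map big_add1 /=.
by rewrite /index_iota subn0.
Qed.

(** Mass on the inner interval gives [bump] a positive mean [L]; eventually the count is at least n
    L / 2, which exceeds any fixed [m]. *)
Lemma bump_count x y x' y' m : x < x' -> y' < y -> (0 < muX `]x', y'[%classic)%E ->
  \forall n \near \oo, (m <= count (fun l => (x < l < y)%R) (eigseq (Y n)))%N.
Proof.
move=> xx yy mpos; have I0 := Rmean_bump_gt0 xx yy mpos.
set L := Rmean _ _ in I0.
have cv : (fun n : nat => n%:R^-1 * \sum_(1 <= k < n.+1) bump x y (eig k (Y n))) @ \oo --> L.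
  by apply: wc; [exact: bump_continuous|exact: (bmeas_bump x y).2].
have L2 : L / 2 < L by lra.
have n0 : \forall n \near \oo, (0 < n)%N by exact: nbhs_infty_gt.
apply: filterS3 n0 (cvgr_gt _ cv _ L2) (nbhs_infty_ger (m%:R / (L / 2))) => n n0 h1 h2.
have nR : 0 < n%:R :> R by rewrite ltr0n.
have : m%:R <= n%:R * (L / 2) by rewrite -ler_pdivrMr //; lra.
move: h1; rewrite ltr_pdivlMl // sum_eig => h1 h3.
rewrite -(ler_nat R); apply: le_trans h3 _; apply: le_trans (ltW h1) _.
elim: (eigseq _) => [|l s IH]; first by rewrite big_nil.
rewrite big_cons /= natrD lerD //.
by have /andP[] := bump_le x y l.
Qed.

End Counts.

(** * Eigenvalue counts at the band edges *)

Section Edges.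
Local Open Scope complex_scope.
Variables (R : realType) (ell : nat) (p a b : nat -> R).
Local Notation C := R[i].
Variables (mu : nat -> probability R R) (muX : probability R R).
Hypothesis ppos : forall j, (1 <= j <= ell)%N -> 0 < p j.
Hypothesis psum : \sum_(1 <= j < ell.+1) p j = 1.
Hypothesis ab : forall j, (1 <= j <= ell)%N -> a j < b j.
Hypothesis ba : forall j, (2 <= j <= ell)%N -> b j < a j.-1.
Hypothesis musupp : forall j, (1 <= j <= ell)%N -> mu j (~` `[a j, b j]%classic) = 0%E.
Hypothesis mupos : forall j, (1 <= j <= ell)%N -> forall x y, a j <= x -> x < y -> y <= b j ->
     (0 < mu j `]x, y[%classic)%E.
Hypothesis muXE : forall A : set R, measurable A ->
     muX A = (\sum_(1 <= j < ell.+1) (p j)%:E * mu j A)%E.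
Let c k := \sum_(1 <= m < k.+1) p m.
Let idx (n k : nat) := `|Num.ceil (n%:R * c k)|%N.
Variables (Y : forall n, 'M[C]_n).
Hypothesis YH : forall n, (Y n)^t* = Y n.
Hypothesis wc : forall f : R -> R, continuous f -> (exists M, forall x, `|f x| <= M) ->
  (fun n : nat => n%:R^-1 * \sum_(1 <= k < n.+1) f (eig k (Y n))) @ \oo --> Rmean muX f.
Hypothesis edges : forall j, (1 <= j <= ell)%N ->
     (fun n : nat => eig (idx n j.-1).+1 (Y n)) @ \oo --> b j /\
     (fun n : nat => eig (idx n j) (Y n)) @ \oo --> a j.
Variable j : nat.
Hypothesis je : (1 <= j <= ell)%N.
Let K n := idx n j.-1.

Lemma cum_bounds : 0 <= c j.-1 < 1.
Proof.
have cS k : c k.+1 = c k + p k.+1 by rewrite /c big_nat_recr.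
have cge k : (k <= ell)%N -> 0 <= c k.
  elim: k => [|k IH] ke; first by rewrite /c big_geq.
  by rewrite cS addr_ge0 ?IH 1?ltnW // ltW // ppos //; lia.
have cmono k m : (k + m <= ell)%N -> c k <= c (k + m)%N.
  elim: m => [|m IH] km; first by rewrite addn0.
  rewrite addnS cS; apply: le_trans (IH _) _; first lia.
  by rewrite lerDl ltW // ppos //; lia.
have jj : j = j.-1.+1 by lia.
have c1 : c j.-1 < 1.
  apply: (@lt_le_trans _ _ (c j)); first by rewrite {2}jj cS -jj ltrDl ppos.
  by rewrite -psum -/(c ell); have := cmono j (ell - j)%N; rewrite subnKC; [apply; lia|lia].
by rewrite c1 cge //; lia.
Qed.

Lemma idx_room m : \forall n \near \oo, (K n + m <= n)%N.
Proof.
have /andP[c0 c1] := cum_bounds; exact: ceil_index_room.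
Qed.

Lemma gap_sep z delta : 0 < delta -> b j < z - delta ->
  ((2 <= j)%N -> z + delta < a j.-1) ->
  \forall n \near \oo, neig z (Y n) = K n /\
    (forall k, (k < n)%N -> delta <= `|z - eig k.+1 (Y n)|).
Proof.
move=> d0 bz za.
have e1 : \forall n \near \oo, eig (K n).+1 (Y n) < z - delta.
  by apply: cvgr_lt bz; have [] := edges je.
(* For [j = 1] the rank [K n] is 0 and no eigenvalue has to lie above the gap, which the guard
   [0 < K n] takes into account. *)
have e2 : \forall n \near \oo, (0 < K n)%N -> z + delta < eig (K n) (Y n).
  have [j1|j1] := eqVneq j 1%N.
    apply: nearW => n; rewrite /K /idx j1 /c big_geq // mulr0.
    by rewrite -[0]/(0%:~R) intrKceil.
  have j2 : (2 <= j)%N by lia.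
  have /edges[_ ea] : (1 <= j.-1 <= ell)%N by lia.
  by apply: filterS (cvgr_gt _ ea _ (za j2)).
apply: filterS3 e1 e2 (idx_room 1) => n n1 n2 n3.
have Kn : (0 < (K n).+1 <= n)%N by lia.
split.
  apply/eqP; rewrite eqn_leq; apply/andP; split.
    rewrite leqNgt -(eig_gt z (YH n) Kn) -leNgt ltW //; lra.
  case: (posnP (K n)) => [->//|K0].
  rewrite -(eig_gt z (YH n)); last lia.
  by apply: lt_trans (n2 K0); lra.
move=> k kn; have [kK|Kk] := leqP k.+1 (K n).
  have K0 : (0 < K n)%N by lia.
  have h : eig (K n) (Y n) <= eig k.+1 (Y n) by apply: eig_anti => //; lia.
  by have h' := n2 K0; rewrite ler0_norm; lra.
have h : eig k.+1 (Y n) <= eig (K n).+1 (Y n) by apply: eig_anti => //; lia.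
by rewrite ger0_norm; lra.
Qed.

Let gap_point : exists z, exists2 delta, 0 < delta & [/\ b j < z - delta &
  (2 <= j)%N -> z + delta < a j.-1].
Proof.
have [z gz] := gap_nonempty ba je.
by have [delta d0 [h1 h2 _]] := gap_margin ab ba musupp muXE je gz; exists z, delta.
Qed.

(** [K n] eigenvalues lie above a gap point, and the mass of band [j] just below [b j] supplies [r]
    more. *)
Lemma lower_edge_count e r : 0 < e ->
  \forall n \near \oo, (K n + r <= neig (b j - e) (Y n))%N.
Proof.
move=> e0; have [z [delta d0 [bz za]]] := gap_point.
pose x := Num.max (a j) (b j - e).
have xb : x < b j by rewrite /x gt_max ab //=; lra.
have xa : a j <= x by rewrite /x le_max lexx.
have xe : b j - e <= x by rewrite /x le_max lexx orbT.
(* The middle third of []x, b j[] leaves room on both sides for the slopes of the bump. *)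
pose x1 := x + (b j - x) / 3; pose x2 := b j - (b j - x) / 3.
have mpos : (0 < muX `]x1, x2[%classic)%E.
  by rewrite /x1 /x2; apply: (muX_pos ppos mupos muXE je); lra.
have h1 : x < x1 by rewrite /x1; lra.
have h2 : x2 < b j by rewrite /x2; lra.
apply: filterS2 (gap_sep d0 bz za) (bump_count YH wc r h1 h2 mpos) => n [nz _] nr.
rewrite -nz; apply: leq_trans (leq_add (leqnn _) nr) _.
apply: count_add_le => l; case: ltP => zl; case: ltP => xl; case: ltP => lb;
  case: ltP => el //=; exfalso; lra.
Qed.

(** Among the [K n] eigenvalues above a gap point at least [r] lie at the bottom of band [j.-1]. A
    perturbation of rank [r] raises a count by at most [r], so the count above [a j.-1 + e] cannot
    pass [K n]. *)
Lemma upper_edge_count e r : 0 < e -> (2 <= j)%N ->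
  \forall n \near \oo, (neig (a j.-1 + e) (Y n) + r <= K n)%N.
Proof.
move=> e0 j2; have [z [delta d0 [bz za]]] := gap_point.
have {}za' := za j2.
have j1e : (1 <= j.-1 <= ell)%N by lia.
have ab1 := ab j1e.
pose y := Num.min (b j.-1) (a j.-1 + e).
have ya : a j.-1 < y by rewrite /y lt_min ab1 /=; lra.
have yb : y <= b j.-1 by rewrite /y ge_min lexx.
have ye : y <= a j.-1 + e by rewrite /y ge_min lexx orbT.
pose x1 := a j.-1 + (y - a j.-1) / 3; pose x2 := y - (y - a j.-1) / 3.
have mpos : (0 < muX `]x1, x2[%classic)%E.
  by rewrite /x1 /x2; apply: (muX_pos ppos mupos muXE j1e); lra.
have h1 : a j.-1 < x1 by rewrite /x1; lra.
have h2 : x2 < y by rewrite /x2; lra.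
apply: filterS2 (gap_sep d0 bz za) (bump_count YH wc r h1 h2 mpos) => n [nz _] nr.
rewrite -nz; apply: leq_trans (leq_add (leqnn _) nr) _.
apply: count_add_le => l; case: ltP => zl; case: ltP => xl; case: ltP => lb;
  case: ltP => el //=; exfalso; lra.
Qed.

End Edges.

(** Each [e] has its own null set; the countably many values 1/(m + 1) suffice for convergence. *)
Lemma ae_cvg (R : realType) (d : measure_display) (T : measurableType d)
    (P : probability T R) (u : T -> nat -> R) (L : R) :
  (forall e, 0 < e -> {ae P, forall w, \forall n \near \oo, L - e <= u w n}) ->
  (forall e, 0 < e -> {ae P, forall w, \forall n \near \oo, u w n <= L + e}) ->
  {ae P, forall w, u w @ \oo --> L}.
Proof.
move=> lo up; have e0 m : 0 < m.+1%:R^-1 :> R by rewrite invr_gt0 ltr0n.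
apply: filterS (ae_foralln (fun m => filterI (lo _ (e0 m)) (up _ (e0 m)))) => w h; apply/cvgrPdist_le => e epos.
have [m _ /(_ m (leqnn m)) me] := near_infty_natSinv_lt (PosNum epos).
have [h1 h2] := h m; apply: filterS2 h1 h2 => n h1 h2.
have me' : m.+1%:R^-1 < e := me.
by rewrite ler_distl; set q := m.+1%:R^-1 in me' h1 h2; apply/andP; split; lra.
Qed.

(** * Limits of the perturbed eigenvalues *)

Section Outliers.
Local Open Scope complex_scope.
Variables (R : realType) (cplx : bool).
Variables (d : measure_display) (T : measurableType d) (P : probability T R).
Local Notation C := R[i].
Variable X : forall n : nat, T -> 'M[C]_n.
Variables (ell : nat) (p a b : nat -> R).
Variables (mu : nat -> probability R R) (muX : probability R R).
Variables (r : nat) (theta : nat -> R) (Pn : forall n : nat, 'M[C]_n).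
Let c k := \sum_(1 <= m < k.+1) p m.
Let idx (n k : nat) := `|Num.ceil (n%:R * c k)|%N.
Hypothesis Xset : forall n w, setting_mx cplx (X n w).
Hypothesis Xmeas : forall n (B : set 'M[C]_n), mx_borel B -> measurable (X n @^-1` B).
Hypothesis Xinv : forall n (U : 'M[C]_n), setting_group cplx U ->
  forall B : set 'M[C]_n, mx_borel B ->
       P (X n @^-1` B) = P ((fun w => U *m X n w *m ctr U) @^-1` B).
Hypothesis ppos : forall j, (1 <= j <= ell)%N -> 0 < p j.
Hypothesis psum : \sum_(1 <= j < ell.+1) p j = 1.
Hypothesis ab : forall j, (1 <= j <= ell)%N -> a j < b j.
Hypothesis ba : forall j, (2 <= j <= ell)%N -> b j < a j.-1.
Hypothesis musupp : forall j, (1 <= j <= ell)%N -> mu j (~` `[a j, b j]%classic) = 0%E.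
Hypothesis mupos : forall j, (1 <= j <= ell)%N -> forall x y, a j <= x -> x < y -> y <= b j ->
     (0 < mu j `]x, y[%classic)%E.
Hypothesis muXE : forall A : set R, measurable A ->
     muX A = (\sum_(1 <= j < ell.+1) (p j)%:E * mu j A)%E.
Hypothesis wc : {ae P, forall w, forall f : R -> R, continuous f ->
  (exists M, forall x, `|f x| <= M) ->
  (fun n : nat => n%:R^-1 * \sum_(1 <= k < n.+1) f (eig k (X n w)))
       @ \oo --> fine (\int[muX]_t (f t)%:E)}.
Hypothesis edges : {ae P, forall w, forall j, (1 <= j <= ell)%N ->
     (fun n : nat => eig (idx n j.-1).+1 (X n w)) @ \oo --> b j /\
     (fun n : nat => eig (idx n j) (X n w)) @ \oo --> a j}.
Hypothesis tstep : forall i, (1 <= i < r)%N -> theta i.+1 <= theta i.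
Hypothesis tr0 : 0 < theta r.
Hypothesis Pset : forall n, setting_mx cplx (Pn n).
Hypothesis Peig : forall n, (r <= n)%N -> \rank (Pn n) = r /\
     perm_eq [seq x <- eigseq (Pn n) | x != 0] [seq theta k | k <- iota 1 r].
Variables (i j : nat).
Hypothesis ir : (1 <= i <= r)%N.
Hypothesis je : (1 <= j <= ell)%N.
Let lam w n := eig (idx n j.-1 + i) (X n w + Pn n).

Let tdec k l : (1 <= k)%N -> (k <= l)%N -> (l <= r)%N -> theta l <= theta k.
Proof.
move=> k1 /subnKC <-; elim: (l - k)%N => [|m IH] kmr; first by rewrite addn0.
by rewrite addnS in kmr *; apply: le_trans (tstep _) (IH _); lia.
Qed.

Let tpos k : (1 <= k <= r)%N -> 0 < theta k.
Proof. by move=> /andP[k1 kr]; apply: lt_le_trans tr0 (tdec k1 kr (leqnn r)). Qed.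

Let Xh n w : (X n w)^t* = X n w.
Proof. exact: setting_herm (Xset n w). Qed.

Let Xth n w : (X n w + Pn n)^t* = X n w + Pn n.
Proof. by rewrite trmxCD Xh (setting_herm (Pset n)). Qed.

(** For [n < r] there is no orthonormal frame and [U = 0] fills in, so that the norm bound holds for
    all [n]. *)
Lemma perturbation_frame n : exists U : 'M[C]_(r, n),
  (forall k, \sum_i `|U k i| ^+ 2 <= 1) /\
  ((r <= n)%N -> U *m U^t* = 1%:M /\
    Pn n = U^t* *m rdiag (fun k : 'I_r => theta k.+1) *m U).
Proof.
have [rn|nr] := leqP r n; last first.
  exists 0; split=> [k|]; last by lia.
  by rewrite big1 // => l _; rewrite mxE normr0 expr0n.
have [_ pe] := Peig rn.
have [U UU PE] := low_rank_decomp (setting_herm (Pset n)) rn tr0 tstep pe.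
exists U; split=> // k.
suff -> : \sum_l `|U k l| ^+ 2 = (U *m U^t*) k k by rewrite UU mxE eqxx.
by rewrite mxE; apply: eq_bigr => l _; rewrite !mxE normCK.
Qed.

Let U n : 'M[C]_(r, n) := sval (cid (perturbation_frame n)).
Let Ule n k : \sum_i `|U n k i| ^+ 2 <= 1.
Proof. by rewrite /U; case: cid => /= V [] + _; apply. Qed.
Let UU n : (r <= n)%N -> U n *m (U n)^t* = 1%:M.
Proof. by rewrite /U; case: cid => /= V [_ h] /h[]. Qed.
Let PE n : (r <= n)%N -> Pn n = (U n)^t* *m rdiag (fun k : 'I_r => theta k.+1) *m U n.
Proof. by rewrite /U; case: cid => /= V [_ h] /h[]. Qed.

Let room n : (idx n j.-1 + r <= n)%N -> (0 < idx n j.-1 + i <= n)%N.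
Proof. by move=> h; lia. Qed.

Let idx_room' m : \forall n \near \oo, (idx n j.-1 + m <= n)%N.
Proof. exact: (idx_room ppos psum je m). Qed.

Local Notation G := (cauchy_tr muX).

(** A single margin [delta] serves for the separation of [z] from the spectrum and as truncation
    level of the Cauchy kernel. *)
Let gap_point_ae z : in_gap a b j z -> exists delta, [/\ 0 < delta,
  {ae P, forall w, \forall n \near \oo, neig z (X n w) = idx n j.-1},
  {ae P, forall w, \forall n \near \oo,
    forall k, (k < n)%N -> delta <= `|z - eig k.+1 (X n w)|} &
  {ae P, forall w, (fun n : nat => n%:R^-1 *
    \sum_(1 <= k < n.+1) trunc_inv z delta (eig k (X n w))) @ \oo --> G z}].
Proof.
move=> gz; have [delta d0 [bz za GE]] := gap_margin ab ba musupp muXE je gz.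
have sep : {ae P, forall w, \forall n \near \oo, neig z (X n w) = idx n j.-1 /\
    (forall k, (k < n)%N -> delta <= `|z - eig k.+1 (X n w)|)}.
  apply: filterS edges => w ew.
  exact: (gap_sep ppos psum (fun n => Xh n w) ew je d0 bz za).
exists delta; split=> //.
- by apply: filterS sep => w; apply: filterS => n [].
- by apply: filterS sep => w; apply: filterS => n [].
- apply: filterS wc => w ww; rewrite GE; apply: ww.
    exact: trunc_inv_continuous d0.
  exact: (bmeas_trunc_inv z d0).2.
Qed.

Lemma eig_gt_gap_point z : in_gap a b j z -> (theta i)^-1 < G z ->
  {ae P, forall w, \forall n \near \oo, z < lam w n}.
Proof.
move=> gz tG; have [delta [d0 num sep tr]] := gap_point_ae gz.
have := neig_at_point_ge Xset Xmeas Xinv Ule UU tpos tdec d0 ir sep tr tG.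
apply: filterS2 num => w h1 h2.
apply: filterS3 h1 h2 (idx_room' r) => n nz nge nr.
have rn : (r <= n)%N by lia.
by rewrite /lam (eig_gt _ (Xth n w) (room nr)) -nz (PE rn).
Qed.

Lemma eig_le_gap_point z : in_gap a b j z -> G z < (theta i)^-1 ->
  {ae P, forall w, \forall n \near \oo, lam w n <= z}.
Proof.
move=> gz tG; have [delta [d0 num sep tr]] := gap_point_ae gz.
have := neig_at_point_le Xset Xmeas Xinv Ule UU tpos tdec d0 ir sep tr tG.
apply: filterS2 num => w h1 h2.
apply: filterS3 h1 h2 (idx_room' r) => n nz nlt nr.
have rn : (r <= n)%N by lia.
by rewrite /lam leNgt (eig_gt _ (Xth n w) (room nr)) -ltnNge -nz (PE rn).
Qed.

Let weyl n w z : (r <= n)%N ->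
  (neig z (X n w) <= neig z (X n w + Pn n) <= neig z (X n w) + r)%N.
Proof.
move=> rn; rewrite (PE rn); apply: (neig_low_rank _ _ (Xh n w)) => k.
by apply: tpos; rewrite /= ltn_ord.
Qed.

Lemma eig_ge_lower_edge e : 0 < e ->
  {ae P, forall w, \forall n \near \oo, b j - e <= lam w n}.
Proof.
move=> e0; apply: filterS2 wc edges => w ww we.
have := lower_edge_count ppos psum ab ba musupp mupos muXE (fun n => Xh n w) ww we je r e0.
apply: filterS2 (idx_room' r) => n nr h.
apply: ltW; rewrite /lam (eig_gt _ (Xth n w) (room nr)).
have rn : (r <= n)%N by lia.
have /andP[h' _] := weyl w (b j - e) rn.
by apply: leq_trans h'; apply: leq_trans h; rewrite leq_add2l; case/andP: ir.
Qed.

Lemma eig_le_upper_edge e : (2 <= j)%N -> 0 < e ->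
  {ae P, forall w, \forall n \near \oo, lam w n <= a j.-1 + e}.
Proof.
move=> j2 e0; apply: filterS2 wc edges => w ww we.
have := upper_edge_count ppos psum ab ba musupp mupos muXE (fun n => Xh n w) ww we je r e0 j2.
apply: filterS2 (idx_room' r) => n nr h.
rewrite leNgt /lam (eig_gt _ (Xth n w) (room nr)).
have rn : (r <= n)%N by lia.
have /andP[_ h'] := weyl w (a j.-1 + e) rn.
rewrite -ltnNge; apply: leq_ltn_trans h' _; apply: leq_ltn_trans h _.
by rewrite -[X in (X < _)%N]addn0 ltn_add2l; case/andP: ir.
Qed.

Lemma outlier_cvg x : in_gap a b j x -> G x = (theta i)^-1 ->
  {ae P, forall w, lam w @ \oo --> x}.
Proof.
move=> gx Gx; have [delta d0 [bz za _]] := gap_margin ab ba musupp muXE je gx.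
have ing z : x - delta <= z -> z <= x + delta -> in_gap a b j z.
  move=> h1 h2; apply/(in_gapP a b je); split; first lra.
  have [j1|j1] := eqVneq j 1%N; [by left|right].
  have j2 : (2 <= j)%N by lia.
  by split => //; have := za j2; lra.
(* Capping [e] by the margin keeps [x - m] and [x + m] in the gap, and strict decrease of [G] puts
   1/theta_i strictly between the values there. *)
apply: ae_cvg => e e0; pose m := Num.min e delta.
- have m1 : m <= e by rewrite /m ge_min lexx.
  have m2 : m <= delta by rewrite /m ge_min lexx orbT.
  have m0 : 0 < m by rewrite /m lt_min e0.
  have gz : in_gap a b j (x - m) by apply: ing; lra.
  have tG : (theta i)^-1 < G (x - m).
    by rewrite -Gx; apply: (gap_decr ab ba musupp muXE je gz gx); lra.
  by apply: filterS (eig_gt_gap_point gz tG) => w; apply: filterS => n; lra.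
- have m1 : m <= e by rewrite /m ge_min lexx.
  have m2 : m <= delta by rewrite /m ge_min lexx orbT.
  have m0 : 0 < m by rewrite /m lt_min e0.
  have gz : in_gap a b j (x + m) by apply: ing; lra.
  have tG : G (x + m) < (theta i)^-1.
    by rewrite -Gx; apply: (gap_decr ab ba musupp muXE je gx gz); lra.
  by apply: filterS (eig_le_gap_point gz tG) => w; apply: filterS => n; lra.
Qed.

Let near_left e : 0 < e -> exists2 z, in_gap a b j z & z <= b j + e.
Proof.
move=> e0; have [z0 gz0] := gap_nonempty ba je.
have [bz0 hz0] : b j < z0 /\ _ := (in_gapP a b je z0).1 gz0.
exists (Num.min z0 (b j + e)); last by rewrite ge_min lexx orbT.
apply/(in_gapP a b je); split; first by rewrite lt_min bz0; lra.
case: hz0 => [->|[j2 za]]; [by left|right]; split=> //.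
by rewrite gt_min za.
Qed.

(** The mass of the band and Weyl's inequality hold the eigenvalue up. From above, every gap point
    satisfies G(z) < 1/theta_i, and gap points come arbitrarily close to [b j]. *)
Lemma lower_edge_cvg : (right_lim G (b j) <= (theta i)^-1%:E)%E ->
  {ae P, forall w, lam w @ \oo --> b j}.
Proof.
move=> Gt; apply: ae_cvg; first exact: eig_ge_lower_edge.
move=> e e0; have [z gz ze] := near_left e0.
have tG : G z < (theta i)^-1.
  rewrite -lte_fin; apply: lt_le_trans Gt.
  exact: (gap_lt_Gb ab ba musupp muXE je gz).
apply: filterS (eig_le_gap_point gz tG) => w; apply: filterS => n h.
exact: le_trans h ze.
Qed.

(** Mirror image of the lower edge: gap points close to [a j.-1] push the eigenvalue up, and Weyl's
    inequality keeps it down. *)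
Lemma upper_edge_cvg :
  ((theta i)^-1%:E <= (if j == 1%N then lim_pinfty G else left_lim G (a j.-1)))%E ->
  {ae P, forall w, lam w @ \oo --> a j.-1}.
Proof.
move=> tGa; have [j1|j1] := eqVneq j 1%N.
  (* For [j = 1] the limit of [G] at infinity is 0, and 1/theta_i is positive, so this case cannot
     occur. *)
  exfalso; move: tGa; rewrite j1 eqxx.
  rewrite (lim_pinfty_cauchy_tr (muX_supp ab ba musupp muXE)) lee_fin.
  by apply/negP; rewrite -ltNge invr_gt0 tpos.
have j2 : (2 <= j)%N by lia.
have bj : b j < a j.-1 by apply: ba; lia.
apply: ae_cvg => [e e0|e]; last exact: eig_le_upper_edge.
pose z := Num.max ((b j + a j.-1) / 2) (a j.-1 - e).
have za : z < a j.-1 by rewrite /z gt_max; apply/andP; split; lra.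
have ze : a j.-1 - e <= z by rewrite /z le_max lexx orbT.
have bz : b j < z by rewrite /z lt_max; apply/orP; left; lra.
have gz : in_gap a b j z by apply/(in_gapP a b je); split=> //; right.
have tG : (theta i)^-1 < G z.
  rewrite -lte_fin; apply: le_lt_trans tGa _.
  exact: (gap_gt_Ga ab ba musupp muXE je gz).
by apply: filterS (eig_gt_gap_point gz tG) => w; apply: filterS => n; lra.
Qed.

(** The case conditions are deterministic, so they can be decided before the null set is chosen. *)
Lemma ae_imply (A : Prop) (Q : T -> Prop) :
  (A -> {ae P, forall w, Q w}) -> {ae P, forall w, A -> Q w}.
Proof.
move=> h; have [HA|nA] := pselect A; last by apply: aeW => w /nA.
by apply: filterS (h HA) => w.
Qed.

Lemma outlier_trichotomy :
  let Gb := right_lim G (b j) in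
  let Ga := if j == 1%N then lim_pinfty G else left_lim G (a j.-1) in
  let hi := if j == 1%N then +oo%E else (a j.-1)%:E in
  {ae P, forall w,
     ((Ga < (theta i)^-1%:E < Gb)%E ->
        lam w @ \oo --> inv_on G (b j)%:E hi (theta i)^-1) /\
     (((theta i)^-1%:E >= Gb)%E -> lam w @ \oo --> b j) /\
     (((theta i)^-1%:E <= Ga)%E -> lam w @ \oo --> a j.-1)}.
Proof.
move=> Gb Ga hi.
have ti : 0 < (theta i)^-1 by rewrite invr_gt0 tpos.
have h1 := @ae_imply (Ga < (theta i)^-1%:E < Gb)%E
  (fun w => lam w @ \oo --> inv_on G (b j)%:E hi (theta i)^-1).
have h2 := ae_imply lower_edge_cvg; have h3 := ae_imply upper_edge_cvg.
apply: filterS3 (h1 _) h2 h3 => [w w1 w2 w3|GG]; first by split.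
have [x0 gx0 Gx0] := gap_value_exists ab ba musupp muXE je ti GG.
(* The point chosen by [inv_on] is a genuine preimage: existence rules out the default 0. *)
rewrite /inv_on; case: xgetP => [x _ [gx Gx]|/(_ x0)]; last by case; split.
exact: outlier_cvg gx Gx.
Qed.

End Outliers.

Local Close Scope sesquilinear_scope.
Unset Implicit Arguments.

Theorem mainTheorem3
  (R : realType) (cplx : bool)
  (d : measure_display) (T : measurableType d) (P : probability T R)
  (X : forall n : nat, T -> 'M[R[i]]_n)
  (ell : nat) (p : nat -> R) (a b : nat -> R)
  (mu : nat -> probability R R) (muX : probability R R)
  (r : nat) (theta : nat -> R) (Pn : forall n : nat, 'M[R[i]]_n) :
  let c := fun k : nat => \sum_(1 <= m < k.+1) p m in
  let idx := fun (n k : nat) => `|Num.ceil (n%:R * c k)|%N in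
  (* X_n: random matrices in the setting, measurable, conjugation invariant *)
  (forall n w, setting_mx cplx (X n w)) ->
  (forall n (B : set 'M[R[i]]_n), mx_borel B -> measurable (X n @^-1` B)) ->
  (forall n (U : 'M[R[i]]_n), setting_group cplx U ->
     forall B : set 'M[R[i]]_n, mx_borel B ->
       P (X n @^-1` B) = P ((fun w => U *m X n w *m ctr U) @^-1` B)) ->
  (* structure of the limit measure *)
  (1 <= ell)%N ->
  (forall j, (1 <= j <= ell)%N -> 0 < p j) ->
  \sum_(1 <= j < ell.+1) p j = 1 ->
  (forall j, (1 <= j <= ell)%N -> a j < b j) ->
  (forall j, (2 <= j <= ell)%N -> b j < a j.-1) ->
  (forall j, (1 <= j <= ell)%N -> mu j (~` `[a j, b j]%classic) = 0%E) ->
  (forall j, (1 <= j <= ell)%N -> forall x y, a j <= x -> x < y -> y <= b j ->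
     (0 < mu j `]x, y[%classic)%E) ->
  (forall A : set R, measurable A ->
     muX A = (\sum_(1 <= j < ell.+1) (p j)%:E * mu j A)%E) ->
  (* a.s. weak convergence of the empirical eigenvalue distribution *)
  {ae P, forall w, forall f : R -> R, continuous f -> (exists M, forall x, `|f x| <= M) ->
     (fun n : nat => n%:R^-1 * \sum_(1 <= k < n.+1) f (eig k (X n w)))
       @ \oo --> fine (\int[muX]_t (f t)%:E)} ->
  (* a.s. convergence of the edge eigenvalues *)
  {ae P, forall w, forall j, (1 <= j <= ell)%N ->
     (fun n : nat => eig (idx n j.-1).+1 (X n w)) @ \oo --> b j /\
     (fun n : nat => eig (idx n j) (X n w)) @ \oo --> a j} ->
  (* the perturbation *)
  (1 <= r)%N ->
  (forall i, (1 <= i < r)%N -> theta i.+1 <= theta i) ->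
  0 < theta r ->
  (forall n, setting_mx cplx (Pn n)) ->
  (forall n, (r <= n)%N -> \rank (Pn n) = r /\
     perm_eq [seq x <- eigseq (Pn n) | x != 0] [seq theta k | k <- iota 1 r]) ->
  (* conclusion *)
  forall i j, (1 <= i <= r)%N -> (1 <= j <= ell)%N ->
  let G := cauchy_tr muX in
  let Gb := right_lim G (b j) in
  let Ga := if j == 1%N then lim_pinfty G else left_lim G (a j.-1) in
  let hi := if j == 1%N then +oo%E else (a j.-1)%:E in
  let lam := fun (w : T) (n : nat) => eig (idx n j.-1 + i) (X n w + Pn n) in
  {ae P, forall w,
     ((Ga < (theta i)^-1%:E < Gb)%E ->
        lam w @ \oo --> inv_on G (b j)%:E hi (theta i)^-1) /\
     (((theta i)^-1%:E >= Gb)%E -> lam w @ \oo --> b j) /\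
     (((theta i)^-1%:E <= Ga)%E -> lam w @ \oo --> a j.-1)}.
Proof.
move=> c idx Xset Xmeas Xinv _ ppos psum ab ba musupp mupos muXE wc edges _ tstep tr0.
move=> Pset Peig i j ir je G Gb Ga hi lam.
exact: (outlier_trichotomy Xset Xmeas Xinv ppos psum ab ba musupp mupos muXE wc edges
  tstep tr0 Pset Peig ir je).
Qed.
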